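(* Let $A$ be an infinite dimensional simple separable unital C*-algebra which is a Popa algebra, let $G$ be a second countable compact group, and let $\alpha \colon G \to \operatorname{Aut}(A)$ be an action which has the tracial Rokhlin property with comparison. Then $A^{\alpha}$ is a Popa algebra.
   Context: Definition. A simple separable unital C*-algebra $A$ is called a Popa algebra if for every finite subset $F\subseteq A$ and every $\varepsilon>0$ there are a nonzero projection $p\in A$, a finite dimensional C*-algebra $B$, and a unital homomorphism $\varphi\colon B\to pAp$, such that $\|pa-ap\|<\varepsilon$ for all $a\in F$ and $\operatorname{dist}(pap,\varphi(B))<\varepsilon$ for all $a\in F$. All group actions $\alpha\colon G\to\operatorname{Aut}(A)$ on C*-algebras are continuous (that is, $g\mapsto\alpha_g(a)$ is norm continuous for every $a\in A$), and $A^\alpha=\{a\in A:\alpha_g(a)=a\text{ for all }g\in G\}$. For a C*-algebra $A$ let $M_\infty(A)=\bigcup_n M_n(A)$; for $a,b\in M_\infty(A)_+$, write $a\precsim_A b$ (Cuntz subequivalence in $A$) if there is a sequence $(v_n)$ in $M_\infty(A)$ with $\lim_n v_nbv_n^*=a$. For a compact group $G$, let $\mathrm{Lt}\colon G\to\operatorname{Aut}(C(G))$ be given by $\mathrm{Lt}_g(f)(h)=f(g^{-1}h)$. Definition. Let $A$ be an infinite dimensional simple unital C*-algebra, and let $\alpha\colon G\to\operatorname{Aut}(A)$ be an action of a second countable compact group $G$ on $A$. The action $\alpha$ has the tracial Rokhlin property with comparison if for every finite set $F\subseteq A$, every finite set $S\subseteq C(G)$, every $\varepsilon>0$, every $x\in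 A_+$ with $\|x\|=1$, and every $y\in(A^\alpha)_+\setminus\{0\}$, there exist a projection $p\in A^\alpha$ and a unital completely positive map $\varphi\colon C(G)\to pAp$ (unital means $\varphi(1)=p$) such that: (1) $\|\varphi(f_1f_2)-\varphi(f_1)\varphi(f_2)\|<\varepsilon$ for all $f_1,f_2\in S$; $\|\varphi(f)a-a\varphi(f)\|<\varepsilon$ for all $f\in S$, $a\in F$; and $\sup_{g\in G}\|\varphi(\mathrm{Lt}_g(f))-\alpha_g(\varphi(f))\|<\varepsilon$ for all $f\in S$; (2) $1-p\precsim_A x$; (3) $1-p\precsim_{A^\alpha}y$; (4) $1-p\precsim_{A^\alpha}p$; (5) $\|pxp\|>1-\varepsilon$. *)

(* Defs.v *)
From HB Require Import structures.
From mathcomp Require Import all_boot all_order all_algebra.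
From mathcomp Require Import complex.
From mathcomp Require Import all_classical all_reals all_analysis.
From mathcomp Require Import ring lra.

Set Implicit Arguments.
Unset Strict Implicit.
Unset Printing Implicit Defensive.

Import Order.TTheory GRing.Theory Num.Theory.
Import ComplexField.
Import numFieldNormedType.Exports.
Local Open Scope classical_set_scope.
Local Open Scope ring_scope.

HB.mixin Record Algebra_isStar (R : realType) A of GRing.Algebra R[i] A := {
  star : A -> A;
  starK : involutive star;
  starD : forall x y, star (x + y) = star x + star y;
  starZ : forall (c : R[i]) x, star (c *: x) = c^* *: star x;
  starM : forall x y, star (x * y) = star y * star x
}.

#[short(type="starAlgType")]
HB.structure Definition StarAlgebra (R : realType) :=
  {A of GRing.Algebra R[i] A & Algebra_isStar R A}.

HB.mixin Record isCstar (R : realType) A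
    of StarAlgebra R A & Uniform A := {
  cnorm : A -> R;
  cnorm_entourage : forall E : set (A * A), entourage E <->
    exists2 e : R, 0 < e & forall x y, cnorm (x - y) < e -> E (x, y);
  cnormD : forall x y, cnorm (x + y) <= cnorm x + cnorm y;
  cnormZ : forall (c : R[i]) x, cnorm (c *: x) = Normc.normc c * cnorm x;
  cnorm_eq0 : forall x, cnorm x = 0 -> x = 0;
  cnormM : forall x y, cnorm (x * y) <= cnorm x * cnorm y;
  cnormE : forall x, cnorm (star x * x) = cnorm x ^+ 2;
  cnorm_complete : forall F : set_system A, ProperFilter F -> cauchy F ->
    exists x : A, F --> x
}.

(* Unital nonzero C*-algebras. The norm is real-valued and is tied to the
   library through the uniform structure; a join of normedModType and algType
   is excluded by the existing hierarchy below numDomainType. *)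
#[short(type="cstarAlgType")]
HB.structure Definition CstarAlgebra (R : realType) :=
  {A of StarAlgebra R A & Uniform A & isCstar R A}.

HB.mixin Record Group_isTopological G of Group G & Topological G := {
  mulg_continuous : continuous (fun xy : G * G => (xy.1 * xy.2)%g);
  invg_continuous : continuous (fun x : G => (x^-1)%g)
}.

#[short(type="topGroupType")]
HB.structure Definition TopGroup :=
  {G of Group G & Topological G & Group_isTopological G}.

Section ContinuousFunctions.
Context {R : realType} {G : topGroupType}.

(* C(G); the sup norm is not needed, complete positivity being a condition on
   the *-algebra structure only. *)
Definition contC : Type := continuousType G R[i]^o.
HB.instance Definition _ := Choice.on contC.
Definition contC_fun (f : contC) : G -> R[i] := (f : continuousType G R[i]^o).
Coercion contC_fun : contC >-> Funclass.

Lemma contC_cts (f : contC) : continuous (contC_fun f : G -> R[i]^o).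
Proof. exact: (@cts_fun _ _ (f : continuousType G R[i]^o)). Qed.

Lemma contCP (f g : contC) : f =1 g -> f = g.
Proof. by move=> fg; apply/(@continuousEP G R[i]^o f g). Qed.

Definition mkcontC (f : G -> R[i]) (cf : continuous (f : G -> R[i]^o)) : contC :=
  @mkcts G R[i]^o f cf : continuousType G R[i]^o.

Lemma conj_continuous : continuous (fun z : R[i]^o => z^* : R[i]^o).
Proof.
move=> z U /= [e e0 eU]; exists e => // y /= zy; apply: eU => /=.
by rewrite -rmorphB norm_conjC.
Qed.

Definition contC_zero : contC :=
  @mkcontC (fun=> 0) (fun x => @cvg_cst _ _ _ _ _).
Definition contC_one : contC :=
  @mkcontC (fun=> 1) (fun x => @cvg_cst _ _ _ _ _).

Lemma contC_opp_cts (f : contC) : continuous (fun x => - f x : R[i]^o).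
Proof. by move=> x; apply: (@cvgN R[i] R[i]^o); exact: contC_cts. Qed.
Definition contC_opp (f : contC) : contC :=
  @mkcontC (fun x => - f x) (@contC_opp_cts f).

Lemma contC_add_cts (f g : contC) : continuous (fun x => f x + g x : R[i]^o).
Proof. by move=> x; apply: (@cvgD R[i] R[i]^o); exact: contC_cts. Qed.
Definition contC_add (f g : contC) : contC :=
  @mkcontC (fun x => f x + g x) (@contC_add_cts f g).

Lemma contC_mul_cts (f g : contC) : continuous (fun x => f x * g x : R[i]^o).
Proof. by move=> x; apply: (@cvgM R[i]); exact: contC_cts. Qed.
Definition contC_mul (f g : contC) : contC :=
  @mkcontC (fun x => f x * g x) (@contC_mul_cts f g).

Lemma contC_scale_cts (c : R[i]) (f : contC) :
  continuous (fun x => c * f x : R[i]^o).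
Proof.
by move=> x; apply: (@cvgM R[i]); [exact: cvg_cst | exact: contC_cts].
Qed.
Definition contC_scale (c : R[i]) (f : contC) : contC :=
  @mkcontC (fun x => c * f x) (@contC_scale_cts c f).

Lemma contC_star_cts (f : contC) : continuous (fun x => (f x)^* : R[i]^o).
Proof.
move=> x; apply: (@continuous_comp G R[i]^o R[i]^o).
  exact: contC_cts.
exact: conj_continuous.
Qed.
Definition contC_star (f : contC) : contC :=
  @mkcontC (fun x => (f x)^*) (@contC_star_cts f).

Lemma contC_addA : associative contC_add.
Proof. by move=> f g h; apply: contCP => x; exact: addrA. Qed.
Lemma contC_addC : commutative contC_add.
Proof. by move=> f g; apply: contCP => x; exact: addrC. Qed.
Lemma contC_add0 : left_id contC_zero contC_add.
Proof. by move=> f; apply: contCP => x; exact: add0r. Qed.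
Lemma contC_addN : left_inverse contC_zero contC_opp contC_add.
Proof. by move=> f; apply: contCP => x; exact: addNr. Qed.
HB.instance Definition _ :=
  GRing.isZmodule.Build contC contC_addA contC_addC contC_add0 contC_addN.

Lemma contC_mulA : associative contC_mul.
Proof. by move=> f g h; apply: contCP => x; exact: mulrA. Qed.
Lemma contC_mul1 : left_id contC_one contC_mul.
Proof. by move=> f; apply: contCP => x; exact: mul1r. Qed.
Lemma contC_1mul : right_id contC_one contC_mul.
Proof. by move=> f; apply: contCP => x; exact: mulr1. Qed.
Lemma contC_mulDl : left_distributive contC_mul contC_add.
Proof. by move=> f g h; apply: contCP => x; exact: mulrDl. Qed.
Lemma contC_mulDr : right_distributive contC_mul contC_add.
Proof. by move=> f g h; apply: contCP => x; exact: mulrDr. Qed.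
Lemma contC_one_neq0 : contC_one != 0 :> contC.
Proof.
apply/eqP => e; have : contC_fun contC_one 1%g = contC_fun contC_zero 1%g.
  by rewrite e.
by move/eqP; rewrite oner_eq0.
Qed.
HB.instance Definition _ := GRing.Zmodule_isNzRing.Build contC
  contC_mulA contC_mul1 contC_1mul contC_mulDl contC_mulDr contC_one_neq0.

Lemma contC_scaleA a b (f : contC) : contC_scale a (contC_scale b f) = contC_scale (a * b) f.
Proof. by apply: contCP => x; exact: mulrA. Qed.
Lemma contC_scale1 : left_id 1 contC_scale.
Proof. by move=> f; apply: contCP => x; exact: mul1r. Qed.
Lemma contC_scaleDr : right_distributive contC_scale +%R.
Proof. by move=> c f g; apply: contCP => x; exact: mulrDr. Qed.
Lemma contC_scaleDl (f : contC) : {morph contC_scale^~ f : a b / a + b}.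
Proof. by move=> a b; apply: contCP => x; exact: mulrDl. Qed.
HB.instance Definition _ := GRing.Zmodule_isLmodule.Build R[i] contC
  contC_scaleA contC_scale1 contC_scaleDr contC_scaleDl.

Lemma contC_scaleAl (c : R[i]) (f g : contC) : c *: (f * g) = (c *: f) * g.
Proof. by apply: contCP => x; exact: mulrA. Qed.
HB.instance Definition _ :=
  GRing.Lmodule_isLalgebra.Build R[i] contC contC_scaleAl.
Lemma contC_scaleAr (c : R[i]) (f g : contC) : c *: (f * g) = f * (c *: g).
Proof. by apply: contCP => x; exact: mulrCA. Qed.
HB.instance Definition _ :=
  GRing.Lalgebra_isAlgebra.Build R[i] contC contC_scaleAr.

Lemma contC_starK : involutive contC_star.
Proof. by move=> f; apply: contCP => x; exact: conjCK. Qed.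
Lemma contC_starD (f g : contC) :
  contC_star (f + g) = contC_star f + contC_star g.
Proof. by apply: contCP => x; exact: rmorphD. Qed.
Lemma contC_starZ (c : R[i]) (f : contC) :
  contC_star (c *: f) = c^* *: contC_star f.
Proof. by apply: contCP => x; exact: rmorphM. Qed.
Lemma contC_starM (f g : contC) :
  contC_star (f * g) = contC_star g * contC_star f.
Proof.
by apply: contCP => x; rewrite [RHS]mulrC; exact: rmorphM.
Qed.
HB.instance Definition _ := Algebra_isStar.Build R contC
  contC_starK contC_starD contC_starZ contC_starM.

Lemma translate_cts (g : G) (f : contC) :
  continuous (fun h => f (g^-1 * h)%g : R[i]^o).
Proof.
have Hp : continuous (fun h : G => (g^-1%g, h)).
  by move=> y; apply: cvg_pair; [exact: cvg_cst | exact: cvg_id].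
have Hm : continuous (fun h : G => (g^-1 * h)%g).
  by move=> y; exact: (continuous_comp (Hp y) (@mulg_continuous G _)).
by move=> x; exact: (continuous_comp (Hm x) (@contC_cts f _)).
Qed.
Definition translate (g : G) (f : contC) : contC :=
  @mkcontC (fun h => f (g^-1 * h)%g) (@translate_cts g f).

End ContinuousFunctions.
Arguments contC : clear implicits.
Section CstarTheory.
Context {R : realType}.
Implicit Types A B : cstarAlgType R.

Lemma cnormN A (x : A) : cnorm (- x) = cnorm x.
Proof.
rewrite -scaleN1r cnormZ (_ : Normc.normc _ = 1) ?mul1r//.
by rewrite /= oppr0 expr0n addr0 sqrrN expr1n sqrtr1.
Qed.

Lemma cnorm0 A : cnorm (0 : A) = 0.
Proof. by rewrite -(scale0r 0) cnormZ Normc.normc0 mul0r. Qed.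

Lemma cnorm_ge0 A (x : A) : 0 <= cnorm x.
Proof. by have := cnormD x (- x); rewrite subrr cnorm0 cnormN; lra. Qed.

Lemma cnormB A (x y : A) : cnorm (x - y) = cnorm (y - x).
Proof. by rewrite -cnormN opprB. Qed.

Lemma cnorm_tri A (y x z : A) : cnorm (x - z) <= cnorm (x - y) + cnorm (y - z).
Proof. by rewrite (le_trans _ (cnormD _ _))// addrA subrK. Qed.

Lemma cnorm_half A (x : A) : cnorm (2^-1 *: x) = 2^-1 * cnorm x.
Proof.
rewrite cnormZ; congr (_ * _).
have -> : (2^-1 : R[i]) = real_complex R 2^-1.
  by rewrite fmorphV rmorph_nat.
by rewrite /= expr0n addr0 sqrtr_sqr ger0_norm// invr_ge0.
Qed.

Lemma cnorm_small A (x : A) (c : R) :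
  (forall e : R, 0 < e -> e <= 1 -> cnorm x <= c * e) -> x = 0.
Proof.
move=> h; apply: cnorm_eq0; have x0 := cnorm_ge0 x.
apply/eqP; rewrite eq_le x0 andbT leNgt; apply/negP => xp.
have k0 := normr_ge0 c; have ck := ler_norm c.
have d0 : 0 < cnorm x + 1 + `|c| by lra.
pose e := cnorm x / (cnorm x + 1 + `|c|).
have eE : e * (cnorm x + 1 + `|c|) = cnorm x by rewrite /e divfK// gt_eqF.
have e0 : 0 < e by rewrite divr_gt0.
have e1 : e <= 1 by rewrite ler_pdivrMr// mul1r; lra.
have := h e e0 e1; nra.
Qed.

Lemma star0 (A : starAlgType R) : star (0 : A) = 0.
Proof. by apply: (@addrI _ (star 0)); rewrite -starD !addr0. Qed.

Lemma starN (A : starAlgType R) (x : A) : star (- x) = - star x.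
Proof. by apply: (@addrI _ (star x)); rewrite -starD !subrr star0. Qed.

Lemma starB (A : starAlgType R) (x y : A) : star (x - y) = star x - star y.
Proof. by rewrite starD starN. Qed.

Lemma star1 (A : starAlgType R) : star (1 : A) = 1.
Proof. by rewrite -[LHS]mulr1 -{2}(starK 1) -starM mulr1 starK. Qed.

Lemma cnorm_star A (x : A) : cnorm (star x) = cnorm x.
Proof.
suff h (y : A) : cnorm y <= cnorm (star y).
  by apply/eqP; rewrite eq_le h -{2}(starK x) h.
have := cnormM (star y) y; rewrite cnormE.
by have := cnorm_ge0 y; have := cnorm_ge0 (star y); nra.
Qed.

Lemma cnorm1 A : cnorm (1 : A) = 1.
Proof.
have := cnormE (1 : A); rewrite star1 mulr1 => /eqP.
rewrite -subr_eq0 -{1}(mulr1 (cnorm 1)) expr2 -mulrBr mulf_eq0 subr_eq0.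
case/orP => /eqP //; first by move/cnorm_eq0/eqP; rewrite oner_eq0.
Qed.

Lemma cnorm_nbhs A (x : A) (U : set A) :
  nbhs x U <-> exists2 e : R, 0 < e & forall y, cnorm (x - y) < e -> U y.
Proof.
rewrite -nbhs_entourageE; split=> [[E /cnorm_entourage[e e0 eE] EU]|[e e0 eU]].
  by exists e => // y xy; apply: EU; rewrite /xsection/= inE; exact: eE.
exists [set z | cnorm (z.1 - z.2) < e].
  by apply/cnorm_entourage; exists e.
by move=> y; rewrite /xsection/= inE; exact: eU.
Qed.

Lemma cnorm_cauchy A (u : nat -> A) :
  (forall e : R, 0 < e -> exists N, forall n m, (N <= n)%N -> (N <= m)%N ->
     cnorm (u n - u m) < e) ->
  exists l : A, forall e : R, 0 < e -> exists N, forall n, (N <= n)%N ->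
     cnorm (l - u n) < e.
Proof.
move=> h; have [|l ul] := @cnorm_complete R A (u @ \oo) _.
  move=> E /cnorm_entourage[e e0 eE]; have [N hN] := h e e0.
  pose U := u @` [set n | (N <= n)%N].
  exists (U, U) => /=; first by split; exists N => // n Nn; exists n.
  by move=> [_ _] /= [[n Nn <-] [m Nm <-]]; apply: eE; exact: hN.
exists l => e e0.
have /ul[N _ hN] : nbhs l [set y | cnorm (l - y) < e].
  by apply/cnorm_nbhs; exists e.
by exists N.
Qed.

Lemma expr_small (r e : R) : 0 <= r -> r < 1 -> 0 < e ->
  exists N, forall n, (N <= n)%N -> r ^+ n < e.
Proof.
move=> r0 r1 e0; have : `|r| < 1 by rewrite ger0_norm.
move=> /cvg_expr/cvgrPdist_lt/(_ _ e0)[N _ hN].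
exists N => n /hN; rewrite sub0r normrN ger0_norm// exprn_ge0//.
Qed.

Lemma cnorm_sqr_sub A (s t : A) :
  cnorm (2^-1 *: (s * s - t * t)) <= 2^-1 * (cnorm s + cnorm t) * cnorm (s - t).
Proof.
have -> : s * s - t * t = s * (s - t) + (s - t) * t.
  by rewrite mulrBr mulrBl addrA subrK.
rewrite cnorm_half -mulrA ler_pM2l ?invr_gt0//.
have := cnormD (s * (s - t)) ((s - t) * t).
by have := cnormM s (s - t); have := cnormM (s - t) t; lra.
Qed.

(* For self-adjoint h with |h| < 1, the unitary h + i sqrt(1 - h^2) shows that
   unital *-homomorphisms are contractive; this makes the fixed points of an
   action a norm-closed, hence complete, subalgebra. *)
Lemma sqrt_one_sub A (h : A) : star h = h -> cnorm h < 1 ->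
  exists s : A, [/\ star s = s, h * s = s * h & h * h + s * s = 1].
Proof.
move=> hs h1; pose r := cnorm h; have r0 : 0 <= r := cnorm_ge0 h.
pose f (t : A) := 2^-1 *: (h * h + t * t).
pose t n := iter n f 0.
have tS n : t n.+1 = f (t n) by [].
have fB x y : f x - f y = 2^-1 *: (x * x - y * y).
  by rewrite /f -scalerBr opprD addrACA subrr add0r.
have tr n : cnorm (t n) <= r.
  elim: n => [|n ih]; first by rewrite /t /= cnorm0.
  rewrite tS cnorm_half; have := cnormD (h * h) (t n * t n).
  have := cnormM h h; have := cnormM (t n) (t n).
  have := cnorm_ge0 (t n); rewrite -/r in h1 *.
  move: (cnorm (t n)) (cnorm (_ * _)) (cnorm (_ * _)) (cnorm (_ + _)) ih.
  by move=> a b c d *; nra.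
have tstar n : star (t n) = t n.
  elim: n => [|n ih]; first exact: star0.
  rewrite tS /f starZ starD !starM hs ih; congr (_ *: _).
  by rewrite fmorphV rmorph_nat.
have tcomm n : h * t n = t n * h.
  elim: n => [|n ih]; first by rewrite mulr0 mul0r.
  rewrite tS /f -scalerAr -scalerAl mulrDr mulrDl !mulrA.
  by rewrite ih -!mulrA ih.
have ctr n m : cnorm (t (n + m)%N - t n) <= r ^+ n.
  elim: n => [|n ih].
    by rewrite expr0 /t /= subr0 (le_trans (tr _))// ltW.
  rewrite addSn !tS fB (le_trans (cnorm_sqr_sub _ _))// exprS.
  have := tr (n + m)%N; have := tr n.
  have := cnorm_ge0 (t (n + m)%N - t n).
  have := exprn_ge0 n r0; set c := cnorm (_ - _) in ih *; nra.
have [|l tl] := @cnorm_cauchy A t.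
  move=> e e0; have [N hN] := expr_small r0 h1 e0; exists N.
  suff H n m : (n <= m)%N -> (N <= n)%N -> cnorm (t m - t n) < e.
    move=> n m Nn Nm; have [nm|mn] := leqP n m.
      by rewrite cnormB H.
    by rewrite H// ltnW.
  move=> nm Nn; rewrite -(subnKC nm); apply: le_lt_trans (ctr _ _) _.
  exact: hN.
have tlim e : 0 < e -> exists n, cnorm (l - t n) < e /\ cnorm (l - t n.+1) < e.
  by move=> /tl[N hN]; exists N; split; apply: hN.
have lstar : star l = l.
  apply/eqP; rewrite -subr_eq0; apply/eqP/(@cnorm_small _ _ 2) => e e0 _.
  have [n [ln _]] := tlim e e0.
  have := cnorm_tri (t n) (star l) l.
  by rewrite -{1}(tstar n) -starB cnorm_star (cnormB (t n)); lra.
have lcomm : h * l = l * h.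
  apply/eqP; rewrite -subr_eq0; apply/eqP/(@cnorm_small _ _ 2) => e e0 _.
  have [n [ln _]] := tlim e e0.
  have -> : h * l - l * h = h * (l - t n) - (l - t n) * h.
    by rewrite mulrBr mulrBl tcomm opprB addrA subrK.
  apply: le_trans (cnormD _ _) _; rewrite cnormN.
  have := cnormM h (l - t n); have := cnormM (l - t n) h.
  have := cnorm_ge0 (l - t n); rewrite -/r in h1 *; nra.
have lfix : l = f l.
  apply/eqP; rewrite -subr_eq0; apply/eqP/(@cnorm_small _ _ 3) => e e0 e1.
  have [n [ln lSn]] := tlim e e0.
  have := cnorm_tri (t n.+1) l (f l).
  have := cnorm_sqr_sub (t n) l; rewrite -fB -tS (cnormB (t n)).
  have := cnormD (l - t n) (t n); rewrite subrK.
  have := tr n; have d0 := cnorm_ge0 (l - t n); rewrite -/r in h1.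
  set a := cnorm (t n); set b := cnorm l; set d := cnorm (l - t n) in ln d0 *.
  move=> ar bda sd tri.
  have : 2^-1 * (a + b) * d <= 3 / 2 * d by rewrite ler_wpM2r//; lra.
  lra.
exists (1 - l); split.
- by rewrite starB star1 lstar.
- by rewrite mulrBr mulrBl mulr1 mul1r lcomm.
- have e : h * h + l * l = l + l.
    rewrite {3 4}lfix /f -scalerDl.
    have -> : 2^-1 + 2^-1 = 1 :> R[i] by field.
    by rewrite scale1r.
  have -> : h * h = l + l - l * l by rewrite -e addrK.
  rewrite mulrBr !mulrBl !mulr1 !mul1r opprB [1 - l + _]addrC.
  by rewrite addrA [_ + (l * l - l)]addrA subrK addrK addrC subrK.
Qed.

Lemma star_hom_le1 A B (f : {lrmorphism A -> B}) (h : A) :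
  (forall x, f (star x) = star (f x)) -> star h = h -> cnorm h < 1 ->
  cnorm (f h) <= 1.
Proof.
move=> fs hs h1; have [s [ss sh e]] := sqrt_one_sub hs h1.
pose u := f h + 'i *: f s.
have fh : star (f h) = f h by rewrite -fs hs.
have fss : star (f s) = f s by rewrite -fs ss.
have us : star u = f h - 'i *: f s.
  by rewrite /u starD starZ fh fss conjCi scaleNr.
have uu : star u * u = 1.
  have ii : ('i *: f s) * ('i *: f s) = - (f s * f s).
    by rewrite -scalerAl -scalerAr scalerA -expr2 sqrCi scaleN1r.
  have comm : f h * ('i *: f s) = ('i *: f s) * f h.
    by rewrite -scalerAl -scalerAr -!rmorphM sh.
  rewrite us /u mulrBl !mulrDr ii comm opprD opprK addrA addrK.
  by rewrite -!rmorphM -rmorphD e rmorph1.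
have u1 : cnorm u = 1.
  by have := cnormE u; rewrite uu cnorm1; have := cnorm_ge0 u; nra.
have -> : f h = 2^-1 *: (star u + u).
  rewrite us /u addrACA addNr addr0 -mulr2n -scalerMnr scalerMnl.
  by rewrite -mulr_natr mulVf ?scale1r// pnatr_eq0.
rewrite cnorm_half; have := cnormD (star u) u; rewrite cnorm_star u1; lra.
Qed.

Lemma star_hom_contract A B (f : {lrmorphism A -> B}) (x : A) :
  (forall x, f (star x) = star (f x)) -> cnorm (f x) <= cnorm x.
Proof.
move=> fs.
have real_contract h : star h = h -> cnorm (f h) <= cnorm h.
  move=> hs; rewrite leNgt; apply/negP => lt.
  pose m := (cnorm h + cnorm (f h)) / 2.
  have h0 := cnorm_ge0 h.
  have [hm mf] : cnorm h < m /\ m < cnorm (f h) by rewrite /m; split; lra.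
  have m0 : 0 < m by lra.
  pose c : R[i] := real_complex R m^-1.
  have nc (B' : cstarAlgType R) (z : B') : cnorm (c *: z) = m^-1 * cnorm z.
    rewrite cnormZ; congr (_ * _).
    by rewrite /= expr0n addr0 sqrtr_sqr ger0_norm// invr_ge0 ltW.
  have cs : star (c *: h) = c *: h.
    rewrite starZ hs; congr (_ *: _); rewrite conj_Creal//.
    by rewrite realE ler0c invr_ge0 ltW.
  have := star_hom_le1 fs cs; rewrite linearZ !nc mulrC ltr_pdivrMr// mul1r.
  by move=> /(_ hm); rewrite mulrC ler_pdivrMr// mul1r leNgt mf.
have := real_contract (star x * x); rewrite starM starK => /(_ erefl).
have -> : f (star x * x) = star (f x) * f x by rewrite -fs rmorphM.
rewrite !cnormE.
by have := cnorm_ge0 x; have := cnorm_ge0 (f x); nra.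
Qed.
End CstarTheory.


(* Each act g is bijective, with inverse act g^-1, by act1 and actM. *)
Record cstar_action (R : realType) (G : topGroupType) (A : cstarAlgType R) :=
    Action {
  act :> G -> {lrmorphism A -> A};
  act_star : forall g a, act g (star a) = star (act g a);
  act1 : forall a, act 1%g a = a;
  actM : forall g h a, act (g * h)%g a = act g (act h a);
  act_continuous : forall a, continuous (fun g => act g a)
}.

Section FixedPointAlgebra.
Context {R : realType} {G : topGroupType} {A : cstarAlgType R}.
Variable alpha : cstar_action G A.

Definition fixed_pred : {pred A} := fun a => `[< forall g, alpha g a = a >].

Lemma fixed_pred_subalg : GRing.subalg_closed fixed_pred.
Proof.
split=> [|c x y /asboolP fx /asboolP fy|x y /asboolP fx /asboolP fy];
  apply/asboolP => g.
- exact: rmorph1.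
- by rewrite linearP /= fx fy.
- by rewrite rmorphM /= fx fy.
Qed.
HB.instance Definition _ :=
  GRing.isSubalgClosed.Build R[i] A fixed_pred fixed_pred_subalg.

Record fixalg := Fixalg { fixval :> A; fixvalP : fixval \in fixed_pred }.
HB.instance Definition _ := [isSub for fixval].
HB.instance Definition _ := [Choice of fixalg by <:].
HB.instance Definition _ := [SubChoice_isSubAlgebra of fixalg by <:].
HB.instance Definition _ := Uniform.copy fixalg (initial_topology fixval).

Lemma fixalg_star_subproof (x : fixalg) : star (fixval x) \in fixed_pred.
Proof.
by case: x => x /= /asboolP fx; apply/asboolP => g; rewrite act_star fx.
Qed.
Definition fixalg_star (x : fixalg) := Fixalg (fixalg_star_subproof x).

Lemma fixalg_starK : involutive fixalg_star.
Proof. by move=> x; apply: val_inj; exact: starK. Qed.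
Lemma fixalg_starD (x y : fixalg) :
  fixalg_star (x + y) = fixalg_star x + fixalg_star y.
Proof. by apply: val_inj; exact: starD. Qed.
Lemma fixalg_starZ (c : R[i]) (x : fixalg) :
  fixalg_star (c *: x) = c^* *: fixalg_star x.
Proof. by apply: val_inj; exact: starZ. Qed.
Lemma fixalg_starM (x y : fixalg) :
  fixalg_star (x * y) = fixalg_star y * fixalg_star x.
Proof. by apply: val_inj; exact: starM. Qed.
HB.instance Definition _ := Algebra_isStar.Build R fixalg
  fixalg_starK fixalg_starD fixalg_starZ fixalg_starM.

Let fnorm (x : fixalg) : R := cnorm (fixval x).

Lemma fixalg_entourage (E : set (fixalg * fixalg)) : entourage E <->
  exists2 e : R, 0 < e & forall x y : fixalg, fnorm (x - y) < e -> E (x, y).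
Proof.
split=> [[D /cnorm_entourage[e e0 eD] DE]|[e e0 eE]].
  by exists e => // x y xy; apply: DE; exact: eD.
exists [set z : A * A | cnorm (z.1 - z.2) < e].
  by apply/cnorm_entourage; exists e.
by move=> [x y] /= xy; exact: eE.
Qed.

Lemma fixalg_complete (F : set_system fixalg) : ProperFilter F -> cauchy F ->
  exists x : fixalg, F --> x.
Proof.
move=> FF Fc.
have [|l Fl] := @cnorm_complete R A (fixval @ F) _.
  move=> E /cnorm_entourage[e e0 eE].
  have /Fc[[U V] /= [FU FV] UV] :
      entourage [set z : fixalg * fixalg | fnorm (z.1 - z.2) < e].
    by apply/fixalg_entourage; exists e.
  exists (fixval @` U, fixval @` V) => /=.
    by split; [apply: filterS FU|apply: filterS FV] => x Ux; exists x.
  by move=> [_ _] /= [[x Ux <-] [y Vy <-]]; apply: eE; exact: (UV (x, y)).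
have lfix : l \in fixed_pred.
  apply/asboolP => g; apply/eqP; rewrite -subr_eq0; apply/eqP.
  apply: (@cnorm_small _ _ _ 2) => e e0 _.
  have ln : nbhs l [set y | cnorm (l - y) < e] by apply/cnorm_nbhs; exists e.
  have [x /= lx] := @filter_ex _ F _ _ (Fl _ ln).
  have := cnorm_tri (fixval x) (alpha g l) l.
  have /asboolP/(_ g) {1}<- := fixvalP x.
  rewrite -linearB (cnormB (fixval x)).
  by have := star_hom_contract (l - fixval x) (@act_star _ _ _ alpha g); lra.
exists (Fixalg lfix) => U /= [V [[W oW <-] /= Wl] WU].
have lW : nbhs l W by rewrite nbhsE; exists W.
have FW : F (fixval @^-1` W) := Fl _ lW.
exact: filterS WU FW.
Qed.

HB.instance Definition _ := isCstar.Build R fixalg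
  fixalg_entourage
  (fun x y => cnormD (fixval x) (fixval y))
  (fun c x => cnormZ c (fixval x))
  (fun x h => val_inj (cnorm_eq0 (fixval x) h : fixval x = fixval 0))
  (fun x y => cnormM (fixval x) (fixval y))
  (fun x => cnormE (fixval x))
  fixalg_complete.

End FixedPointAlgebra.

Section Predicates.
Context {R : realType}.
Implicit Types A B : cstarAlgType R.

Definition is_positive (A : starAlgType R) (a : A) : Prop :=
  exists b : A, a = star b * b.

Definition is_projection (A : starAlgType R) (p : A) : Prop :=
  p * p = p /\ star p = p.

Definition corner (A : starAlgType R) (p : A) : set A :=
  [set p * a * p | a in [set: A]].

Definition finite_dimensional A : Prop :=
  exists (n : nat) (e : 'I_n -> A),
    forall a : A, exists c : 'I_n -> R[i], a = \sum_(i < n) c i *: e i.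

Definition infinite_dimensional A : Prop := ~ finite_dimensional A.

Definition closed_ideal A (I : set A) : Prop :=
  [/\ closed I, I 0, forall x y, I x -> I y -> I (x + y),
      forall (c : R[i]) x, I x -> I (c *: x)
    & forall a x, I x -> I (a * x) /\ I (x * a)].

Definition is_simple A : Prop :=
  forall I : set A, closed_ideal I -> I = [set 0] \/ I = [set: A].

Definition separable A : Prop := exists2 S : set A, countable S & dense S.

Definition dist_to A (x : A) (S : set A) : R :=
  inf [set cnorm (x - y) | y in S].

(* Unital homomorphisms from B to the corner p A p, whose unit is p. *)
Definition unital_hom_to_corner A B (p : A) (phi : {linear B -> A}) : Prop :=
  [/\ forall x, corner p (phi x), phi 1 = p,
      forall x y, phi (x * y) = phi x * phi y
    & forall x, phi (star x) = star (phi x)].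

Definition popa A : Prop :=
  [/\ is_simple A, separable A
    & forall (F : seq A) (e : R), 0 < e ->
      exists (p : A) (B : cstarAlgType R) (phi : {linear B -> A}),
        [/\ is_projection p, p != 0, finite_dimensional B,
            unital_hom_to_corner p phi
          & forall a, a \in F ->
              cnorm (p * a - a * p) < e /\ dist_to (p * a * p) (range phi) < e]].

Definition mxstar (A : starAlgType R) m n (a : 'M[A]_(m, n)) : 'M[A]_(n, m) :=
  (map_mx (@star R A) a)^T.

(* Unital completely positive maps from C to the corner p A p; a matrix over
   a C*-algebra is positive when it is of the form b^* b. *)
Definition ucp_to_corner (C : starAlgType R) A (p : A) (phi : {linear C -> A}) :
    Prop :=
  [/\ forall x, corner p (phi x), phi 1 = p
    & forall n (b : 'M[C]_n), exists c : 'M[A]_n,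
        (forall i j, corner p (c i j)) /\
        map_mx phi (mxstar b *m b) = mxstar c *m c].

(* The C*-norm of M_n(A), as the operator norm on the right Hilbert A-module
   A^n with inner product <x, y> = \sum_i x_i^* y_i. *)
Definition hilbert_norm A n (x : 'cV[A]_n) : R :=
  Num.sqrt (cnorm (\sum_(i < n) star (x i 0) * x i 0)).

Definition mxnorm A n (a : 'M[A]_n) : R :=
  sup [set hilbert_norm (a *m x) | x in [set x | hilbert_norm x <= 1]].

(* M_oo(A) is the union of the M_n(A) along a |-> diag(a, 0); operations on
   matrices of different sizes are computed in a common size. *)
Definition mxpad A m n (a : 'M[A]_m) : 'M[A]_n :=
  \matrix_(i, j) if (insub (val i), insub (val j)) is (Some i', Some j')
                 then a i' j' else 0.

Definition minf A := {n : nat & 'M[A]_n}.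

Definition minf_mul A (x y : minf A) : minf A :=
  let n := maxn (tag x) (tag y) in
  existT _ n (mxpad n (tagged x) *m mxpad n (tagged y)).

Definition minf_sub A (x y : minf A) : minf A :=
  let n := maxn (tag x) (tag y) in
  existT _ n (mxpad n (tagged x) - mxpad n (tagged y)).

Definition minf_star A (x : minf A) : minf A :=
  existT _ (tag x) (mxstar (tagged x)).

Definition minf_norm A (x : minf A) : R := mxnorm (tagged x).

Definition to_minf A (a : A) : minf A := existT _ 1%N (a%:M).

Definition minf_cuntz_sub A (a b : minf A) : Prop :=
  exists v : nat -> minf A,
    minf_norm (minf_sub (minf_mul (minf_mul (v n) b) (minf_star (v n))) a)
      @[n --> \oo] --> (0 : R).

Definition cuntz_sub A (a b : A) : Prop :=
  minf_cuntz_sub (to_minf a) (to_minf b).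

Definition tracial_rokhlin_with_comparison (G : topGroupType) A
    (alpha : cstar_action G A) : Prop :=
  forall (F : seq A) (S : seq (contC R G)) (e : R) (x : A) (y : fixalg alpha),
    0 < e -> is_positive x -> cnorm x = 1 -> is_positive y -> y != 0 ->
  exists (p : fixalg alpha) (phi : {linear contC R G -> A}),
    [/\ is_projection p, ucp_to_corner (fixval p) phi,
        [/\ forall f1 f2, f1 \in S -> f2 \in S ->
              cnorm (phi (f1 * f2) - phi f1 * phi f2) < e,
            forall f a, f \in S -> a \in F ->
              cnorm (phi f * a - a * phi f) < e
          & forall f, f \in S ->
              sup [set cnorm (phi (translate g f) - alpha g (phi f))
                    | g in [set: G]] < e]
      & [/\ cuntz_sub (1 - fixval p) x,
            cuntz_sub (1 - p) y,
            cuntz_sub (1 - p) p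
          & 1 - e < cnorm (fixval p * x * fixval p)]].

End Predicates.

(* Main.v *)
(* For a finite set L in A, a partition of unity (E k ^ 2) of C(G) along which
   g |-> alpha_g (a), a in L, is nearly constant turns the completely positive
   map phi of the tracial Rokhlin property into
     Psi a = \sum_k phi (E k) alpha_(g k) (a) phi (E k),
   which is nearly multiplicative on L, nearly invariant under the group (hence,
   after averaging, nearly valued in the fixed point algebra), nearly a module
   map over fixed elements, and sends 1 close to the Rokhlin projection p.
   - Simplicity. If y <> 0 is fixed then 1 is approximately a sum of elements
     a y b in A, and applying Psi exhibits p as approximately a sum a' y b' with
     a', b' fixed. So p lies in the ideal of y, and so does 1 - p, which is
     Cuntz subequivalent to p.
   - The Popa property. If sigma : B -> q A q comes from the Popa property of A,
     Psi sigma is an almost multiplicative map from B to the fixed point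
     algebra. As B has a separability idempotent, a Newton iteration (B. E.
     Johnson) moves it to a nearby *-homomorphism S, and S 1 is the required
     projection; it is nonzero since 1 is approximately a sum of elements a q b.
   The norm estimates rest on the positivity of b^* b (Kaplansky), proved here
   from the C*-identity with square roots in place of spectral theory. *)

From HB Require Import structures.
From mathcomp Require Import all_boot all_order all_algebra.
From mathcomp Require Import complex.
From mathcomp Require Import all_classical all_reals all_analysis.
From mathcomp Require Import ring lra.
Require Import Defs.

Set Implicit Arguments.
Unset Strict Implicit.
Unset Printing Implicit Defensive.

Import Order.TTheory GRing.Theory Num.Theory.
Import ComplexField.
Import numFieldNormedType.Exports.
Local Open Scope classical_set_scope.
Local Open Scope ring_scope.

(** Two kinds of error must be kept apart. The completely positive map phi is multiplicative only
    approximately and on a finite set fixed in advance, and Psi has as many terms as the partition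
    of unity, a number dictated by the oscillation of the action. The errors of phi vanish along a
    sequence of Rokhlin maps while the partition stays fixed ([asy]). The oscillation does not
    vanish along that sequence, so its contribution must not grow with the number of terms: this is
    the bound |sum r_i^* D_i r_i| <= 2 max |D_i| |sum r_i^* r_i| ([cnorm_sum_conj]), and the reason
    why positivity is developed. The corner q, the algebra B and sigma determine the tolerance at
    which the Rokhlin property is invoked, so Johnson's correction must be quantitative before Psi
    is known. Estimates on B use a gauge read off coordinates, for which a linear map is bounded by
    its values on a basis. Compactness replaces Haar measure: averages over finite nets contract the
    oscillation of an almost invariant element, and iteration leads to a fixed point. *)

Local Notation "r %:C" := (real_complex _ r).

(** * Deciding identities in noncommutative rings *)

Section NoncommutativeRing.
Variable A : pzRingType.

Inductive ncexpr :=
  NCvar of nat | NC0 | NC1 | NCadd of ncexpr & ncexpr | NCopp of ncexpr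
| NCmul of ncexpr & ncexpr.

Fixpoint nceval (env : seq A) e : A :=
  match e with
  | NCvar i => nth 0 env i
  | NC0 => 0
  | NC1 => 1
  | NCadd e1 e2 => nceval env e1 + nceval env e2
  | NCopp e1 => - nceval env e1
  | NCmul e1 e2 => nceval env e1 * nceval env e2
  end.

(* A noncommutative polynomial as a list of signed words. *)
Fixpoint ncwords e : seq (bool * seq nat) :=
  match e with
  | NCvar i => [:: (false, [:: i])]
  | NC0 => [::]
  | NC1 => [:: (false, [::])]
  | NCadd e1 e2 => ncwords e1 ++ ncwords e2
  | NCopp e1 => [seq (~~ w.1, w.2) | w <- ncwords e1]
  | NCmul e1 e2 =>
      [seq (w.1 (+) v.1, w.2 ++ v.2) | w <- ncwords e1, v <- ncwords e2]
  end.

Definition ncword env (w : bool * seq nat) : A :=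
  (-1) ^+ w.1 * \prod_(i <- w.2) nth 0 env i.

Lemma ncwordsE env e : nceval env e = \sum_(w <- ncwords e) ncword env w.
Proof.
elim: e => [i|||e1 IH1 e2 IH2|e IH|e1 IH1 e2 IH2] /=.
- by rewrite big_seq1 /ncword big_seq1 mul1r.
- by rewrite big_nil.
- by rewrite big_seq1 /ncword big_nil mul1r.
- by rewrite big_cat IH1 IH2.
- rewrite big_map IH -sumrN; apply: eq_bigr => -[b w] _.
  by rewrite /ncword /= signrN mulNr.
- rewrite big_allpairs_dep IH1 IH2 mulr_suml; apply: eq_bigr => -[b w] _.
  rewrite mulr_sumr; apply: eq_bigr => -[b' w'] _.
  rewrite /ncword /= signr_addb big_cat /= !mulrA; congr (_ * _).
  by rewrite -!mulrA; congr (_ * _); rewrite commr_sign.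
Qed.

(** Cancels the leading word against an equal word of opposite sign. The fuel [n] makes the
    recursion structural; each cancellation uses one unit and removes two words, so the length of
    the list is enough. *)
Fixpoint ncnull (n : nat) (s : seq (bool * seq nat)) :=
  match n, s with
  | _, [::] => true
  | n.+1, (b, w) :: s' =>
      ((~~ b, w) \in s') && ncnull n (rem (~~ b, w) s')
  | _, _ => false
  end.

Lemma ncnullP env n s : ncnull n s -> \sum_(w <- s) ncword env w = 0.
Proof.
elim: n s => [|n IH] [|[b w] s] //=; rewrite ?big_nil//.
move=> /andP[ws /IH e]; rewrite big_cons (big_rem _ ws) /= e addr0.
by rewrite /ncword /= signrN mulNr subrr.
Qed.

Lemma ncring_correct env e1 e2 :
  (let s := ncwords (NCadd e1 (NCopp e2)) in ncnull (size s) s) ->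
  nceval env e1 = nceval env e2.
Proof.
move=> /(ncnullP env); rewrite -ncwordsE /= => /eqP.
by rewrite subr_eq0 => /eqP.
Qed.

End NoncommutativeRing.

(* Atoms are compared up to unification because canonical structures give one
   and the same term several syntactic forms. *)
Ltac ncindex x env :=
  match env with
  | ?y :: _ => let _ := match goal with _ => unify x y end in constr:(0%N)
  | _ :: ?env' => let i := ncindex x env' in constr:(i.+1)
  end.

Ltac ncenv A env t :=
  lazymatch t with
  | (?a + ?b)%R => let env := ncenv A env a in ncenv A env b
  | (- ?a)%R => ncenv A env a
  | (?a * ?b)%R => let env := ncenv A env a in ncenv A env b
  | 0%R => env
  | 1%R => env
  | _ => match env with
         | _ => let i := ncindex t env in env
         | _ => constr:(t :: env)
         end
  end.

Ltac ncreify env t :=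
  lazymatch t with
  | (?a + ?b)%R =>
      let a := ncreify env a in let b := ncreify env b in constr:(NCadd a b)
  | (- ?a)%R => let a := ncreify env a in constr:(NCopp a)
  | (?a * ?b)%R =>
      let a := ncreify env a in let b := ncreify env b in constr:(NCmul a b)
  | 0%R => constr:(NC0)
  | 1%R => constr:(NC1)
  | _ => let i := ncindex t env in constr:(NCvar i)
  end.

(** Every subterm that is not a sum, opposite, product, 0 or 1 is an atom; scalar multiples in
    particular are opaque. *)
Ltac ncring :=
  rewrite ?expr2;
  lazymatch goal with |- @eq ?A ?x ?y =>
    let env := ncenv A (@nil A) x in let env := ncenv A env y in
    let e1 := ncreify env x in let e2 := ncreify env y in
    refine (@ncring_correct _ env e1 e2 _); vm_compute; reflexivity
  end.

(** * Positive elements of C*-algebras *)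

Section RealScalars.
Context {R : realType}.
Implicit Types A : cstarAlgType R.

Lemma realD (r s : R) : (r + s)%:C = r%:C + s%:C. Proof. exact: rmorphD. Qed.
Lemma realB (r s : R) : (r - s)%:C = r%:C - s%:C. Proof. exact: rmorphB. Qed.
Lemma realM (r s : R) : (r * s)%:C = r%:C * s%:C. Proof. exact: rmorphM. Qed.

Lemma cnorm_real A (r : R) (x : A) : cnorm (r%:C *: x) = `|r| * cnorm x.
Proof. by rewrite cnormZ /= expr0n addr0 sqrtr_sqr. Qed.

Lemma star_real (A : starAlgType R) (r : R) (x : A) :
  star (r%:C *: x) = r%:C *: star x.
Proof. by rewrite starZ conj_Creal//; apply/complex_realP; exists r. Qed.

Lemma star_const (A : starAlgType R) (r : R) : star (r%:C%:A : A) = r%:C%:A.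
Proof. by rewrite star_real star1. Qed.

Lemma cnorm_const A (r : R) : cnorm (r%:C%:A : A) = `|r|.
Proof. by rewrite cnorm_real cnorm1 mulr1. Qed.

Lemma half_real : 2^-1 = 2^-1%:C :> R[i].
Proof. by rewrite fmorphV rmorph_nat. Qed.

Lemma star_half (A : starAlgType R) (x : A) : star (2^-1 *: x) = 2^-1 *: star x.
Proof. by rewrite half_real star_real. Qed.

Lemma scale_halfD (V : lmodType R[i]) (x : V) : 2^-1 *: (x + x) = x.
Proof.
by rewrite -mulr2n -[x *+ 2]scaler_nat scalerA mulVf ?scale1r// pnatr_eq0.
Qed.

Lemma cnorm_sum A I (r : seq I) (P : pred I) (F : I -> A) :
  cnorm (\sum_(i <- r | P i) F i) <= \sum_(i <- r | P i) cnorm (F i).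
Proof.
elim/big_ind2: _ => //; first by rewrite cnorm0.
by move=> x a y b xa yb; apply: le_trans (cnormD _ _) _; exact: lerD.
Qed.

Lemma star_sum (A : starAlgType R) I (r : seq I) (P : pred I) (F : I -> A) :
  star (\sum_(i <- r | P i) F i) = \sum_(i <- r | P i) star (F i).
Proof. by elim/big_ind2: _ => //; [exact: star0 | move=> x a y b; rewrite starD => -> ->]. Qed.

Lemma cnormM_le A (x y : A) (r s : R) :
  cnorm x <= r -> cnorm y <= s -> cnorm (x * y) <= r * s.
Proof.
by move=> *; apply: le_trans (cnormM _ _) _; apply: ler_pM => //; exact: cnorm_ge0.
Qed.

Lemma cnorm_eq0_le A (x : A) : cnorm x <= 0 -> x = 0.
Proof. by move=> x0; apply: cnorm_eq0; apply/eqP; rewrite eq_le x0 cnorm_ge0. Qed.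

Lemma cnorm_le_eps A (x : A) (c : R) :
  (forall e, 0 < e -> cnorm x <= c + e) -> cnorm x <= c.
Proof. by move=> h; apply/ler_addgt0Pr. Qed.

Lemma selfadjoint_sqr0 A (x : A) : star x = x -> x * x = 0 -> x = 0.
Proof.
move=> xs xx; apply: cnorm_eq0; apply/eqP; rewrite -sqrf_eq0 -cnormE xs xx.
by rewrite cnorm0.
Qed.

Lemma cnorm_sqr A (x : A) : star x = x -> cnorm (x * x) = cnorm x ^+ 2.
Proof. by move=> xs; rewrite -cnormE xs. Qed.

End RealScalars.

Section Positivity.
Context {R : realType}.
Implicit Types A : cstarAlgType R.

(* Positivity phrased through the norm alone; for self-adjoint elements it says
   that the spectrum lies in the disc of centre and radius t. *)
Definition pos A (h : A) : Prop :=
  star h = h /\ exists2 t : R, 0 <= t & cnorm (t%:C%:A - h) <= t.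

Section SqrtOneSub.
Variables (A : cstarAlgType R) (k : A).
Hypotheses (ks : star k = k) (k1 : cnorm k <= 1).

(** A fixed point l = (k + l^2) / 2 satisfies (1 - l)^2 = 1 - k. At norm one the iteration need not
    contract geometrically; convergence is inherited from the increasing bounded scalar iteration
    [v]. *)
Let f (x : A) := 2^-1 *: (k + x * x).
Let u n := iter n f 0.
Let v n : R := iter n (fun x => 2^-1 * (1 + x ^+ 2)) 0.

Let uS n : u n.+1 = f (u n). Proof. by []. Qed.
Let vS n : v n.+1 = 2^-1 * (1 + v n ^+ 2). Proof. by []. Qed.

Let v01 n : 0 <= v n <= 1.
Proof.
elim: n => [|n /andP[v0 v1]]; first by rewrite /v /= lexx ler01.
rewrite vS; apply/andP; split; nra.
Qed.

Let vincr n : v n <= v n.+1.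
Proof. by rewrite vS; have := sqr_ge0 (1 - v n); nra. Qed.

Let vhomo n m : (n <= m)%N -> v n <= v m.
Proof. exact: (homo_leq (@lexx _ _) le_trans vincr). Qed.

Let u_le n : cnorm (u n) <= v n.
Proof.
elim: n => [|n ih]; first by rewrite /u /v /= cnorm0.
rewrite uS vS /f cnorm_half ler_pM2l ?invr_gt0//.
have := cnormD k (u n * u n); have := cnormM (u n) (u n).
have : cnorm (u n) * cnorm (u n) <= v n * v n.
  by apply: ler_pM => //; exact: cnorm_ge0.
by move: k1; lra.
Qed.

(* The iterates are dominated by those of the scalar case k = 1. *)
Let uB_le n m : cnorm (u (n + m)%N - u n) <= v (n + m)%N - v n.
Proof.
elim: n => [|n ih].
  by rewrite /u/v /= !subr0; exact: u_le.
rewrite addSn !uS !vS.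
have -> : f (u (n + m)%N) - f (u n) =
    2^-1 *: (u (n + m)%N * u (n + m)%N - u n * u n).
  by rewrite /f -scalerBr; congr (_ *: _); ncring.
apply: le_trans (cnorm_sqr_sub _ _) _.
have : (cnorm (u (n + m)%N) + cnorm (u n)) * cnorm (u (n + m)%N - u n) <=
    (v (n + m)%N + v n) * (v (n + m)%N - v n).
  apply: ler_pM => //; last exact: lerD (u_le _) (u_le _).
    exact: addr_ge0 (cnorm_ge0 _) (cnorm_ge0 _).
  exact: cnorm_ge0.
set a := cnorm _; set b := cnorm _; set c := cnorm _; lra.
Qed.

Lemma sqrt_one_sub_contraction : exists l : A,
  [/\ star l = l, cnorm l <= 1, (1 - l) * (1 - l) = 1 - k
    & forall z, z * k = k * z -> z * l = l * z].
Proof.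
have ucau e : 0 < e -> exists N, forall n m, (N <= n)%N -> (N <= m)%N ->
    cnorm (u n - u m) < e.
  move=> e0.
  have sv : has_sup (range v).
    split; first by exists (v 0), 0.
    by exists 1 => _ [n _ <-]; case/andP: (v01 n).
  have [_ [N _ <-] vN] := sup_adherent e0 sv.
  exists N; suff H n m : (n <= m)%N -> (N <= n)%N -> cnorm (u m - u n) < e.
    move=> n m Nn Nm; have [nm|mn] := leqP n m; first by rewrite cnormB H.
    by rewrite H// ltnW.
  move=> nm Nn; rewrite -(subnKC nm); apply: le_lt_trans (uB_le _ _) _.
  rewrite subnKC//.
  have : v m <= sup (range v) by apply: sup_upper_bound => //; exists m.
  by have := vhomo Nn; lra.
have [l ul] := cnorm_cauchy ucau.
have ulim e : 0 < e -> exists n, cnorm (l - u n) < e /\ cnorm (l - u n.+1) < e.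
  by move=> /ul[N hN]; exists N; split; apply: hN.
have u1 n : cnorm (u n) <= 1.
  by apply: le_trans (u_le n) _; case/andP: (v01 n).
have l1 : cnorm l <= 1.
  apply: cnorm_le_eps => e /ulim[n [ln _]].
  by have := cnormD (l - u n) (u n); rewrite subrK; have := u1 n; lra.
have lfix : l = f l.
  apply/eqP; rewrite -subr_eq0; apply/eqP/(@cnorm_small _ _ _ 3) => e e0 e1.
  have [n [ln lSn]] := ulim e e0.
  have := cnorm_tri (u n.+1) l (f l); rewrite uS.
  have -> : f (u n) - f l = 2^-1 *: (u n * u n - l * l).
    by rewrite /f -scalerBr; congr (_ *: _); ncring.
  have := cnorm_sqr_sub (u n) l; rewrite (cnormB (u n)) -uS.
  have := u1 n; have d0 := cnorm_ge0 (l - u n); have := cnorm_ge0 (u n).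
  set d := cnorm (l - u n) in ln d0 *; have := cnorm_ge0 l.
  set a := cnorm (u n); set b := cnorm l in l1 *; nra.
have ustar n : star (u n) = u n.
  elim: n => [|n ih]; first exact: star0.
  by rewrite uS /f star_half starD starM ks ih.
exists l; split => //.
- apply/eqP; rewrite -subr_eq0; apply/eqP/(@cnorm_small _ _ _ 2) => e e0 _.
  have [n [ln _]] := ulim e e0.
  have := cnorm_tri (u n) (star l) l.
  by rewrite -{1}(ustar n) -starB cnorm_star (cnormB (u n)); lra.
- have e : l + l = k + l * l.
    by rewrite {1 2}lfix /f -scalerDr scale_halfD.
  by rewrite (_ : (1 - l) * (1 - l) = 1 - (l + l) + l * l); [rewrite e|]; ncring.
- move=> z zk.
  have zu n : z * u n = u n * z.
    elim: n => [|n ih]; first by rewrite mulr0 mul0r.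
    rewrite uS /f -scalerAr -scalerAl mulrDr mulrDl zk; congr (_ *: (_ + _)).
    by rewrite mulrA ih -!mulrA ih.
  apply/eqP; rewrite -subr_eq0; apply/eqP.
  apply: (@cnorm_small _ _ _ (2 * cnorm z)) => e e0 _.
  have [n [ln _]] := ulim e e0.
  have -> : z * l - l * z = z * (l - u n) - (l - u n) * z.
    by rewrite mulrBr mulrBl zu; ncring.
  apply: le_trans (cnormD _ _) _; rewrite cnormN.
  have := cnormM z (l - u n); have := cnormM (l - u n) z.
  by have := cnorm_ge0 (l - u n); have := cnorm_ge0 z; nra.
Qed.

End SqrtOneSub.

Lemma const_comm A (c : R[i]) (x : A) : c%:A * x = x * c%:A.
Proof. by rewrite mulr_algl mulr_algr. Qed.

Lemma posS A (h : A) : pos h -> star h = h. Proof. by case. Qed.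

Lemma pos0 A : pos (0 : A).
Proof. by split; [exact: star0|exists 0 => //; rewrite scale0r subr0 cnorm0]. Qed.

Lemma posD A (a b : A) : pos a -> pos b -> pos (a + b).
Proof.
move=> [sa [t t0 ta]] [sb [s s0 bs]]; split; first by rewrite starD sa sb.
exists (t + s); first exact: addr_ge0.
have -> : (t + s)%:C%:A - (a + b) = (t%:C%:A - a) + (s%:C%:A - b).
  by rewrite realD scalerDl; ncring.
exact: le_trans (cnormD _ _) (lerD ta bs).
Qed.

Lemma posZ A (r : R) (a : A) : 0 <= r -> pos a -> pos (r%:C *: a).
Proof.
move=> r0 [sa [t t0 ta]]; split; first by rewrite star_real sa.
exists (r * t); first exact: mulr_ge0.
rewrite realM -scalerA -scalerBr cnorm_real ger0_norm//.
exact: ler_wpM2l.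
Qed.

Lemma pos_norm_sub A (h : A) (M : R) :
  star h = h -> cnorm h <= M -> pos (M%:C%:A - h).
Proof.
move=> sh hM; split; first by rewrite starB star_const sh.
exists M; first exact: le_trans (cnorm_ge0 _) hM.
by rewrite opprB addrC subrK.
Qed.

Lemma pos_sum A I (r : seq I) (P : pred I) (F : I -> A) :
  (forall i, P i -> pos (F i)) -> pos (\sum_(i <- r | P i) F i).
Proof. by move=> h; elim/big_ind: _ => //; [exact: pos0|exact: posD]. Qed.

(** The witness [t] says that k = 1 - h / t is a contraction, and h = t (1 - k). That the root
    commutes with whatever commutes with [h] is the only trace of functional calculus used later. *)
Lemma pos_sqrt A (h : A) : pos h -> exists q : A,
  [/\ pos q, q * q = h & forall z, z * h = h * z -> z * q = q * z].
Proof.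
move=> [sh [t t0 th]]; have [t0'|tn0] := eqVneq t 0.
  have -> : h = 0.
    by apply: cnorm_eq0_le; move: th; rewrite t0' scale0r sub0r cnormN.
  by exists 0; split; [exact: pos0|rewrite mulr0|].
pose k := 1 - t^-1%:C *: h.
have tk : t%:C *: (1 - k) = h.
  rewrite /k opprB addrC subrK scalerA -realM mulfV//.
  by rewrite rmorph1 scale1r.
have ks : star k = k by rewrite /k starB star1 star_real sh.
have k1 : cnorm k <= 1.
  have -> : k = t^-1%:C *: (t%:C%:A - h).
    by rewrite scalerBr scalerA -realM mulVf// rmorph1 scale1r.
  rewrite cnorm_real ger0_norm ?invr_ge0// mulrC ler_pdivrMr ?mul1r//.
  by rewrite lt_neqAle eq_sym tn0.
have [l [ls l1 ll lz]] := sqrt_one_sub_contraction ks k1.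
exists ((Num.sqrt t)%:C *: (1 - l)); split.
- apply: posZ; first exact: sqrtr_ge0.
  by have := pos_norm_sub ls l1; rewrite rmorph1 scale1r.
- rewrite -scalerAl -scalerAr scalerA -realM -expr2 sqr_sqrtr// ll.
  by rewrite tk.
- move=> z zh; rewrite -scalerAl -scalerAr; congr (_ *: _).
  rewrite mulrBr mulrBl mulr1 mul1r lz// /k mulrBr mulrBl mulr1 mul1r.
  by rewrite -scalerAl -scalerAr zh.
Qed.

(** [a] is the real part of u = a + i b, and commutation gives u^* u = a^2 + b^2, whose norm is
    |u|^2. *)
Lemma cnorm_re A (a b : A) : star a = a -> star b = b ->
  a * b = b * a -> cnorm a ^+ 2 <= cnorm (a * a + b * b).
Proof.
move=> sa sb ab; pose u := a + 'i *: b.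
have us : star u = a - 'i *: b by rewrite starD starZ sa sb conjCi scaleNr.
have uu : star u * u = a * a + b * b.
  rewrite us mulrBl !mulrDr -!scalerAl -!scalerAr scalerA -(expr2 'i) sqrCi.
  by rewrite scaleN1r ab; ncring.
have ae : a = 2^-1 *: (u + star u).
  by rewrite us (_ : _ + _ = a + a) ?scale_halfD// /u; ncring.
rewrite -uu cnormE {1}ae cnorm_half.
have := cnormD u (star u); rewrite cnorm_star.
by have := cnorm_ge0 u; have := cnorm_ge0 (u + star u); nra.
Qed.

(** After division by M = |h| + 1 there is a complementary root s with (h / M)^2 + s^2 = 1. Hence
    M^2 - h^2 = M^2 s^2, and |s^2| <= 1 by [cnorm_re]. *)
Lemma pos_sqr A (h : A) : star h = h -> pos (h * h).
Proof.
move=> sh; have h0 := cnorm_ge0 h; pose M := cnorm h + 1.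
have M0 : 0 < M by rewrite /M; lra.
have sh' : star (M^-1%:C *: h) = M^-1%:C *: h by rewrite star_real sh.
have h1 : cnorm (M^-1%:C *: h) < 1.
  rewrite cnorm_real ger0_norm ?invr_ge0 ?ltW// mulrC ltr_pdivrMr// mul1r.
  by rewrite /M; lra.
have [s [ss hs e]] := sqrt_one_sub sh' h1.
split; first by rewrite starM sh.
exists (M ^+ 2); first exact: sqr_ge0.
have -> : (M ^+ 2)%:C%:A - h * h = (M ^+ 2)%:C *: (s * s).
  rewrite -[in LHS]e scalerDr -scalerAl -scalerAr !scalerA -!realM.
  rewrite (_ : _ * M^-1 = 1); last by field; rewrite gt_eqF.
  by rewrite rmorph1 scale1r addrAC subrr add0r.
rewrite cnorm_real ger0_norm ?sqr_ge0// -[leRHS]mulr1 ler_pM2l ?exprn_gt0//.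
by rewrite cnorm_sqr// -(cnorm1 A) -e addrC; apply: cnorm_re.
Qed.

Lemma pos_mul A (a b : A) : pos a -> pos b -> a * b = b * a -> pos (a * b).
Proof.
move=> pa pb ab; have [q [[sq _] qq qz]] := pos_sqrt pa.
have [r [[sr _] rr rz]] := pos_sqrt pb.
have qr : q * r = r * q by apply: rz; apply: esym; exact: qz.
rewrite (_ : a * b = (q * r) * (q * r)).
  by apply: pos_sqr; rewrite starM sq sr qr.
by rewrite -qq -rr -!mulrA; congr (_ * _); rewrite !mulrA -qr.
Qed.

(** Commuting roots q of a and r of M - a satisfy q^2 + r^2 = M, so [cnorm_re] bounds |q|^2 =
    |a|. *)
Lemma pos_le A (a : A) (M : R) :
  pos a -> pos (M%:C%:A - a) -> cnorm a <= M.
Proof.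
move=> pa pb; have [q [[sq _] qq qz]] := pos_sqrt pa.
have [r [[sr _] rr rz]] := pos_sqrt pb.
have qr : q * r = r * q.
  apply: rz; rewrite mulrBr mulrBl const_comm; congr (_ - _).
  by apply: esym; apply: qz.
(* The sum of t - a and s - (M - a) is the scalar t + s - M, of norm at most t + s; a negative [M]
   would exceed this. *)
have M0 : 0 <= M.
  have := pb.2; have := pa.2 => -[t t0 ta] [s s0 sa].
  rewrite leNgt; apply/negP => M0.
  have := cnormD (t%:C%:A - a) (s%:C%:A - (M%:C%:A - a)).
  rewrite (_ : _ - _ + (_ - _) = (t + s - M)%:C%:A).
    rewrite cnorm_const ger0_norm; lra.
  by rewrite realB realD scalerBl scalerDl; ncring.
have := cnorm_re sq sr qr; rewrite -cnorm_sqr// qq rr addrC subrK.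
by rewrite cnorm_const ger0_norm.
Qed.

Lemma pos_mono A (a b : A) : pos a -> pos (b - a) -> cnorm a <= cnorm b.
Proof.
move=> pa pba; apply: pos_le => //.
have sb : star b = b by rewrite -(subrK a b) starD !posS.
by rewrite -(subrK b (_%:A)) -addrA; apply: posD => //; exact: pos_norm_sub.
Qed.

(** The factors of M^2 - x^2 = (M - x) (M + x) commute and are positive, so |x^2| <= M^2. *)
Lemma pos_bound A (x : A) (M : R) :
  pos (M%:C%:A - x) -> pos (M%:C%:A + x) -> 0 <= M -> cnorm x <= M.
Proof.
move=> p1 p2 M0.
have sx : star x = x.
  by rewrite -[x](addKr M%:C%:A) starD starN star_const (posS p2).
set m : A := M%:C%:A in p1 p2 sx *.
have mx : m * x = x * m by exact: const_comm.
have : cnorm (x * x) <= M ^+ 2.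
  apply: pos_le; first exact: pos_sqr.
  have -> : (M ^+ 2)%:C%:A - x * x = (m - x) * (m + x).
    by rewrite expr2 realM -scalerA -mulr_algl mulrDr !mulrBl mx -/m; ncring.
  by apply: pos_mul => //; rewrite !(mulrDr, mulrDl, mulrN, mulNr) mx; ncring.
by rewrite cnorm_sqr// ler_sqr ?nnegrE ?cnorm_ge0.
Qed.

(** With real part r and imaginary part j, the element x x^* + x^* x equals 2 (r^2 + j^2). *)
Lemma pos_star_mul_star A (x : A) : pos (x * star x + star x * x).
Proof.
pose d := star x - x; pose r := 2^-1 *: (x + star x).
pose j := 2^-1 *: ('i *: d).
have sr : star r = r by rewrite star_half starD starK addrC.
have sj : star j = j.
  by rewrite star_half starZ starB starK conjCi scaleNr -scalerN opprB.
have jj : j * j = (2^-1 * 2^-1) *: - (d * d).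
  rewrite /j -!scalerAl -!scalerAr !scalerA -[- (d * d)]scaleN1r scalerA.
  by congr (_ *: _); rewrite -(@sqrCi R[i]) expr2; ring.
have -> : x * star x + star x * x = 2%:C *: (r * r + j * j).
  rewrite jj /r -scalerAl -scalerAr scalerA -scalerDr scalerA.
  have -> : 2%:C * (2^-1 * 2^-1) = 2^-1 :> R[i].
    by rewrite half_real -!realM; congr (_%:C); field.
  rewrite -[LHS]scale_halfD; congr (_ *: _).
  by rewrite /d; ncring.
by apply: posZ => //; apply: posD; exact: pos_sqr.
Qed.

Lemma pos_subr_le1 A (y : A) : pos y -> cnorm y <= 1 -> cnorm (1 - y) <= 1.
Proof.
move=> py y1; have e : 1%:C%:A = 1 :> A by rewrite rmorph1 scale1r.
apply: pos_le; rewrite ?e; first by rewrite -e; apply: pos_norm_sub (posS py) _.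
by rewrite opprB addrC subrK.
Qed.

(* If x x^* >= 0 and z = - x^* x >= 0 have norm one, the polynomial identity
   x^* (1 - x x^* )^2 x = - z (1 + z)^2 bounds z (1 + z)^2 >= 2 z^2 by one. *)
Lemma neg_star_mul_eq0 A (x : A) : pos (- (star x * x)) -> x = 0.
Proof.
suff H (x' : A) : pos (- (star x' * x')) -> cnorm x' != 1.
  move=> px; apply: contrapT => xn0.
  have x0 : cnorm x != 0.
    by apply/eqP => /cnorm_eq0.
  have x0' : 0 < cnorm x by rewrite lt_neqAle eq_sym x0 cnorm_ge0.
  have /H/eqP : pos (- (star ((cnorm x)^-1%:C *: x) * ((cnorm x)^-1%:C *: x))).
    rewrite star_real -scalerAl -scalerAr scalerA -realM -scalerN.
    by apply: posZ => //; rewrite -expr2 sqr_ge0.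
  apply; rewrite cnorm_real ger0_norm ?invr_ge0 ?cnorm_ge0//.
  by rewrite mulVf.
move=> pz; apply/negP => /eqP x1.
pose y := x' * star x'; pose z := - (star x' * x').
have py : pos y.
  rewrite (_ : y = (x' * star x' + star x' * x') + z); last by rewrite /y/z; ncring.
  by apply: posD => //; exact: pos_star_mul_star.
have y1 : cnorm y <= 1.
  by rewrite /y -{1}(starK x') cnormE cnorm_star x1 expr1n.
have z1 : cnorm z = 1 by rewrite cnormN cnormE x1 expr1n.
have e : z + z * z + z * z + z * z * z = - (star x' * (1 - y) * (1 - y) * x').
  by rewrite /z /y; ncring.
have : cnorm (- (star x' * (1 - y) * (1 - y) * x')) <= 1.
  rewrite cnormN.
  have := cnormM (star x' * (1 - y) * (1 - y)) x'.
  have := cnormM (star x' * (1 - y)) (1 - y).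
  have := cnormM (star x') (1 - y).
  rewrite cnorm_star x1; have := pos_subr_le1 py y1.
  have := cnorm_ge0 (1 - y); have := cnorm_ge0 (star x' * (1 - y)); nra.
rewrite -e; apply/negP; rewrite -ltNge.
have zz : pos (z * z) by apply: pos_sqr; exact: posS pz.
have : cnorm (z * z + z * z) <= cnorm (z + z * z + z * z + z * z * z).
  apply: pos_mono; first exact: posD.
  rewrite (_ : _ - _ = z + z * z * z); last by ncring.
  by apply: posD => //; apply: pos_mul => //; rewrite mulrA.
apply: lt_le_trans.
rewrite -mulr2n -scaler_nat -(rmorph_nat (real_complex R)) cnorm_real.
by rewrite (cnorm_sqr (posS pz)) z1 ger0_norm// expr1n mulr1 ltr1n.
Qed.

(* Kaplansky: with w = |h| and d = w - h for h = b^* b, the element x = b d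
   satisfies - x^* x = d w d >= 0. *)
Theorem pos_star_mul A (b : A) : pos (star b * b).
Proof.
pose h := star b * b; rewrite -/h.
have sh : star h = h by rewrite starM starK.
have [w [pw ww wz]] := pos_sqrt (pos_sqr sh).
have wh : h * w = w * h by apply: wz; rewrite mulrA.
have [r [pr rr rz]] := pos_sqrt pw.
pose d := w - h.
have sd : star d = d by rewrite starB sh (posS pw).
have hd : h * d = - (w * d) by rewrite /d !mulrBr ww wh; ncring.
have rd : d * r = r * d by apply: rz; rewrite /d mulrBr mulrBl wh.
have bd : b * d = 0.
  apply: neg_star_mul_eq0; rewrite starM sd.
  rewrite (_ : - _ = (d * r) * (d * r)).
    by apply: pos_sqr; rewrite starM sd (posS pr).
  rewrite -!mulrA (mulrA (star b)) -/h hd -rr [in RHS]rd.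
  by ncring.
have hd0 : h * d = 0 by rewrite /h -mulrA bd mulr0.
have wd0 : w * d = 0 by apply/eqP; rewrite -oppr_eq0 -hd hd0.
have d0 : d = 0.
  apply: selfadjoint_sqr0 => //; rewrite {1}/d mulrBl wd0 hd0 subrr//.
have -> : h = w by apply/eqP; rewrite eq_sym -subr_eq0 -/d d0.
exact: pw.
Qed.

Lemma pos_conj A (c h : A) : pos h -> pos (star c * h * c).
Proof.
move=> ph; have [q [[sq _] qq _]] := pos_sqrt ph.
rewrite (_ : _ * c = star (q * c) * (q * c)); first exact: pos_star_mul.
by rewrite starM sq -qq; ncring.
Qed.

Lemma cnorm_star_mul_le_sum A (I : finType) (x : I -> A) i :
  cnorm (x i) ^+ 2 <= cnorm (\sum_j star (x j) * x j).
Proof.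
rewrite -cnormE; apply: pos_mono; first exact: pos_star_mul.
rewrite (bigD1 i)//= addrC addrK; apply: pos_sum => j _.
exact: pos_star_mul.
Qed.

(** From -M <= D_i <= M, conjugation and summation give -M S <= sum <= M S with S = sum r_i^* r_i,
    so the number of terms does not enter. *)
Lemma cnorm_sum_conj_sa A (I : finType) (r D : I -> A) (M : R) :
  (forall i, star (D i) = D i) -> (forall i, cnorm (D i) <= M) -> 0 <= M ->
  cnorm (\sum_i star (r i) * D i * r i) <=
    M * cnorm (\sum_i star (r i) * r i).
Proof.
move=> sD DM M0; set S := \sum_i star (r i) * r i.
have pS : pos S by apply: pos_sum => i _; exact: pos_star_mul.
have cS : pos ((M * cnorm S)%:C%:A - M%:C *: S).
  rewrite realM -scalerA -scalerBr; apply: posZ => //.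
  exact: pos_norm_sub (posS pS) (lexx _).
have H (E : I -> A) : (forall i, star (E i) = E i) ->
    (forall i, cnorm (E i) <= M) ->
    pos (M%:C *: S - \sum_i star (r i) * E i * r i).
  move=> sE EM; rewrite scaler_sumr -sumrB; apply: pos_sum => i _.
  rewrite (_ : _ - _ = star (r i) * (M%:C%:A - E i) * r i).
    by apply: pos_conj; exact: pos_norm_sub.
  by rewrite mulrBr mulrBl mulr_algr -scalerAl.
apply: pos_bound; last by rewrite mulr_ge0 ?cnorm_ge0.
  by rewrite -(subrK (M%:C *: S) (_%:A)) -addrA; apply: posD => //; exact: H.
rewrite -(subrK (M%:C *: S) (_%:A)) -addrA; apply: posD => //.
rewrite -[X in _ + X]opprK -sumrN.
rewrite (_ : \sum_i _ = \sum_i star (r i) * (- D i) * r i).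
  by apply: H => i; rewrite ?starN ?sD ?cnormN.
by apply: eq_bigr => i _; ncring.
Qed.

(** The factor 2 pays for splitting each D_i into its real and imaginary parts. *)
Lemma cnorm_sum_conj A (I : finType) (r D : I -> A) (M : R) :
  (forall i, cnorm (D i) <= M) -> 0 <= M ->
  cnorm (\sum_i star (r i) * D i * r i) <=
    2 * M * cnorm (\sum_i star (r i) * r i).
Proof.
move=> DM M0.
pose re (x : A) := 2^-1 *: (x + star x).
pose im (x : A) := 2^-1 *: ('i *: (star x - x)).
have sre x : star (re x) = re x by rewrite star_half starD starK addrC.
have sim x : star (im x) = im x.
  by rewrite star_half starZ starB starK conjCi scaleNr -scalerN opprB.
have ni : Normc.normc ('i : R[i]) = 1.
  by rewrite (_ : 'i = Complex 0 1) //= expr0n expr1n add0r sqrtr1.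
have nre x : cnorm (re x) <= cnorm x.
  by rewrite cnorm_half; have := cnormD x (star x); rewrite cnorm_star; lra.
have nim x : cnorm (im x) <= cnorm x.
  rewrite cnorm_half cnormZ ni mul1r.
  by have := cnormD (star x) (- x); rewrite cnormN cnorm_star; lra.
have dec x : x = re x + 'i *: im x.
  rewrite /re /im !scalerA (mulrC 'i) -[2^-1 * 'i * 'i]mulrA -(expr2 'i) sqrCi.
  rewrite mulrN1 scaleNr -scalerBr (_ : _ - _ = x + x) ?scale_halfD//.
  by ncring.
have -> : \sum_i star (r i) * D i * r i =
    \sum_i star (r i) * re (D i) * r i
    + 'i *: \sum_i star (r i) * im (D i) * r i.
  rewrite scaler_sumr -big_split /=; apply: eq_bigr => i _.
  by rewrite {1}(dec (D i)) mulrDr mulrDl -(scalerAr 'i) -(scalerAl 'i).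
apply: le_trans (cnormD _ _) _; rewrite cnormZ ni mul1r -mulrA mulr_natl mulr2n.
by apply: lerD; apply: cnorm_sum_conj_sa => // i;
  [apply: le_trans (nre _) _|apply: le_trans (nim _) _].
Qed.

End Positivity.

(** * Cuntz subequivalence of elements *)

Section MatrixNorm.
Context {R : realType}.
Implicit Types A : cstarAlgType R.

Lemma hilbert_norm_entry A n (x : 'cV[A]_n) i : cnorm (x i 0) <= hilbert_norm x.
Proof.
rewrite -[leLHS]ger0_norm ?cnorm_ge0// -sqrtr_sqr ler_wsqrtr//.
exact: (cnorm_star_mul_le_sum (fun i => x i 0)).
Qed.

Lemma hilbert_norm_le A n (x : 'cV[A]_n) :
  hilbert_norm x <= Num.sqrt (\sum_i cnorm (x i 0) ^+ 2).
Proof.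
rewrite ler_wsqrtr//; apply: le_trans (cnorm_sum _ _ _) _.
by apply: ler_sum => i _; rewrite cnormE.
Qed.

Lemma mxnorm_entry A n (a : 'M[A]_n) i j : cnorm (a i j) <= mxnorm a.
Proof.
pose x : 'cV[A]_n := delta_mx j 0.
have xn : hilbert_norm x <= 1.
  rewrite /hilbert_norm (bigD1 j)//= big1 ?addr0 => [|k kj].
    by rewrite mxE !eqxx star1 mulr1 cnorm1 sqrtr1.
  by rewrite mxE (negbTE kj) mulr0.
have axE : (a *m x) i 0 = a i j.
  rewrite mxE (bigD1 j)//= big1 ?addr0 => [|k kj].
    by rewrite mxE !eqxx mulr1.
  by rewrite mxE (negbTE kj) mulr0.
apply: le_trans (_ : hilbert_norm (a *m x) <= _).
  by rewrite -axE hilbert_norm_entry.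
(* The supremum dominates its elements only if the set is bounded, so a crude bound of the operator
   norm by the entries is supplied. *)
apply: ub_le_sup; last by exists x.
exists (Num.sqrt (\sum_i (\sum_j cnorm (a i j)) ^+ 2)) => _ [y /= y1 <-].
apply: le_trans (hilbert_norm_le _) _; rewrite ler_wsqrtr//.
apply: ler_sum => k _; rewrite ler_sqr ?nnegrE ?cnorm_ge0//; last first.
  by apply: sumr_ge0 => l _; exact: cnorm_ge0.
rewrite mxE; apply: le_trans (cnorm_sum _ _ _) _; apply: ler_sum => l _.
apply: le_trans (cnormM _ _) _; rewrite -[leRHS]mulr1 ler_wpM2l ?cnorm_ge0//.
exact: le_trans (hilbert_norm_entry _ _) y1.
Qed.

(** The value 0 outside the matrix makes entries insensitive to padding; an entry of [mxpad] unfolds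
    to exactly this expression. *)
Definition mxentry A m (a : 'M[A]_m) (i j : nat) : A :=
  if (insub i, insub j) is (Some i', Some j') then a i' j' else 0.

Lemma mxentryE A m (a : 'M[A]_m) (i j : 'I_m) : mxentry a i j = a i j.
Proof. by rewrite /mxentry !valK. Qed.

(** As [b] sits in the top left corner, the corner entry of v b v^* involves only the corner entries
    of v and v^*, and the norm of a matrix dominates each of its entries. The relation between the
    two factors is dropped because the purpose is membership in ideals. *)
Lemma cuntz_sub_approx A (a b : A) : cuntz_sub a b ->
  forall e, 0 < e -> exists v w : A, cnorm (v * b * w - a) < e.
Proof.
move=> [v vlim] e e0.
have /cvgrPdist_lt/(_ _ e0)[N _ /(_ N (leqnn _))] := vlim.
rewrite sub0r normrN => vN.
move: (v N) vN => {v vlim N} [k v] vN.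
exists (mxentry v 0 0), (mxentry (mxstar v) 0 0).
apply: le_lt_trans vN; apply: le_trans (ler_norm _).
rewrite /minf_norm /minf_sub /= /to_minf /=.
set n := maxn _ 1; have n0 : (0 < n)%N by rewrite leq_max orbT.
apply: le_trans (mxnorm_entry _ (Ordinal n0) (Ordinal n0)).
rewrite le_eqVlt; apply/orP; left; apply/eqP; congr cnorm.
rewrite [RHS]mxE [X in _ = _ + X]mxE; congr (_ - _); last first.
  rewrite mxE -/(mxentry _ 0 0) -[0%N]/(val (ord0 : 'I_1)) mxentryE.
  by rewrite mxE eqxx.
rewrite mxE -/(mxentry _ 0 0).
set m := maxn (maxn k 1) k.
have m0 : (0 < m)%N by rewrite !leq_max orbT.
have k0 : (0 < maxn k 1)%N by rewrite leq_max orbT.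
have bE l : mxentry (b%:M : 'M[A]_1) l 0 = if l == 0%N then b else 0.
  case: l => [|l]; last by rewrite /mxentry insubF.
  by rewrite -[0%N]/(val (ord0 : 'I_1)) mxentryE mxE eqxx.
have bE' l j : (0 < j)%N -> mxentry (b%:M : 'M[A]_1) l j = 0.
  by case: j => // j _; rewrite /mxentry; case: insub => // i'; rewrite insubF.
rewrite -[0%N]/(val (Ordinal m0)) mxentryE mxE (bigD1 (Ordinal m0))//=.
rewrite big1 ?addr0 => [|l l0].
  rewrite !mxE -!/(mxentry _ 0 0); congr (_ * _).
  rewrite -[0%N in RHS]/(val (Ordinal k0)) mxentryE mxE.
  rewrite (bigD1 (Ordinal k0))//= big1 ?addr0 => [|l l0].
    by rewrite !mxE -!/(mxentry _ 0 0) bE.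
  rewrite !mxE -!/(mxentry _ _ 0) bE ifF ?mulr0//.
  by apply/negbTE; move: l0; rewrite -val_eqE.
rewrite mxE -/(mxentry _ 0 l).
suff -> : mxentry (mxpad (maxn k 1) v *m mxpad (maxn k 1) (b%:M : 'M[A]_1)) 0 l = 0.
  by rewrite mul0r.
rewrite /mxentry; case: insubP => // i' _ _; case: insubP => // l' _ l'E.
rewrite mxE big1// => j _; rewrite !mxE -!/(mxentry _ _ _) bE' ?mulr0// l'E.
by rewrite lt0n; move: l0; rewrite -val_eqE.
Qed.

End MatrixNorm.

(** * Averaging over a compact group *)

(** The near-covering form of compactness is applied to the filter of finite lists ordered by
    inclusion: a point is covered by every list that contains it and lies near one of its
    members. *)
Lemma compact_net (T : topologicalType) (V : T -> set T) :
  compact [set: T] -> (forall h, nbhs h (V h)) ->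
  exists s : seq T, forall g, exists2 h, h \in s & V h g.
Proof.
move=> /compact_near_coveringP cT nV.
pose F : set_system (seq T) :=
  [set U | exists s0 : seq T, forall s : seq T, {subset s0 <= s} -> U s].
have FF : Filter F.
  split=> [|P Q [s sP] [t tQ]|P Q PQ [s sP]].
  - by exists [::].
  - exists (s ++ t) => u su; split; [apply: sP|apply: tQ] => h hs; apply: su.
      by rewrite mem_cat hs.
    by rewrite mem_cat hs orbT.
  - by exists s => u /sP /PQ.
have [|s0 /(_ s0 (fun _ => id)) s0V] :=
  cT (seq T) F (fun s g => exists2 h, h \in s & V h g) FF.
  move=> x _; exists (V x, [set s : seq T | {subset [:: x] <= s}]) => /=.
    by split; [exact: nV|exists [:: x]].
  by move=> [g s] [/= Vg xs]; exists x => //; apply: xs; rewrite mem_head.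
by exists s0 => g; exact: s0V.
Qed.

Section ActionContinuity.
Context {R : realType} {G : topGroupType} {A : cstarAlgType R}.
Variable alpha : cstar_action G A.

Lemma cnorm_act g a : cnorm (alpha g a) = cnorm a.
Proof.
have le h b : cnorm (alpha h b) <= cnorm b.
  by apply: star_hom_contract => x; rewrite act_star.
apply/eqP; rewrite eq_le le /=.
by rewrite -{1}(act1 alpha a) -(mulVg g) actM le.
Qed.

Lemma act_near a g e : 0 < e ->
  \forall h \near g, cnorm (alpha h a - alpha g a) < e.
Proof.
move=> e0.
apply: (@act_continuous _ _ _ alpha a g [set y | cnorm (y - alpha g a) < e]).
by apply/cnorm_nbhs; exists e => // y; rewrite cnormB.
Qed.

Hypothesis cG : compact [set: G].

(** The tube lemma; it makes continuity estimates uniform over the group. *)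
Lemma compact_tube (P : G -> G -> Prop) (h : G) :
  (forall k : G, \forall k' \near k & g \near h, P g k') ->
  \forall g \near h, forall k, P g k.
Proof.
move=> hP; have /compact_near_coveringP cov := cG.
have := cov G (nbhs (h : G)) P (nbhs_filter h) (fun k _ => hP k).
by apply: filterS => g Pg k; exact: Pg.
Qed.

Lemma mulg_near (g k : G) (U : set G) : nbhs (g * k)%g U ->
  \forall k' \near k & g' \near g, U (g' * k')%g.
Proof.
move=> nU; have /(_ _ nU)[[U1 U2] /= [n1 n2] U12] := @mulg_continuous G (g, k).
exists (U2, U1); first by split.
by move=> [k' g'] [/= u2 u1]; exact: (U12 (g', k')).
Qed.

(** Uniformity in [k] is what averages inherit: moving [alpha i a] by [g * k] is moving [a] by
    [g * (k * i)]. *)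
Lemma act_net a e : 0 < e -> exists s : seq G, forall g,
  exists2 h, h \in s & forall k, cnorm (alpha (g * k)%g a - alpha (h * k)%g a) < e.
Proof.
move=> e0; have e2 : 0 < e / 2 by rewrite divr_gt0.
apply: (compact_net (V := fun h => [set g | forall k,
   cnorm (alpha (g * k)%g a - alpha (h * k)%g a) < e]) cG) => h.
apply: compact_tube => k.
have [[U1 U2] /= [n1 n2] U12] := mulg_near (act_near a (h * k)%g e2).
exists (U1, U2) => // -[k' g'] [/= u1 u2].
have h1 := U12 (k', g') (conj u1 u2).
have h2 := U12 (k', h) (conj u1 (nbhs_singleton n2)).
have := cnorm_tri (alpha (h * k)%g a) (alpha (g' * k')%g a) (alpha (h * k')%g a).
by rewrite [cnorm (alpha (h * k)%g _ - _)]cnormB /= in h1 h2 *; lra.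
Qed.

(* An element moved at most d by the group is averaged over a finite net of
   the group; each average moves less, by a factor depending on the net only. *)
Section Averaging.
Variables (x : A) (d : R).
Hypotheses (d0 : 0 < d) (xd : forall g, cnorm (alpha g x - x) <= d).

(** Stands for the convex hull of the orbit of [x], through two properties that survive averaging:
    closeness to [x], and every net estimate valid for [x]. *)
Let hull (y : A) : Prop :=
  (forall k, cnorm (alpha k y - x) <= d) /\
  forall e g h, (forall k, cnorm (alpha (g * k)%g x - alpha (h * k)%g x) < e) ->
    forall k, cnorm (alpha (g * k)%g y - alpha (h * k)%g y) <= e.

Let average (s : seq G) (y : A) : A :=
  ((size s)%:R^-1)%:C *: \sum_(i <- s) alpha i y.

Let averageE s g (y : A) : alpha g (average s y) =
  ((size s)%:R^-1)%:C *: \sum_(i <- s) alpha (g * i)%g y.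
Proof.
rewrite /average linearZ /= linear_sum /=; congr (_ *: _).
by apply: eq_bigr => i _; rewrite actM.
Qed.

Let average_cst (s : seq G) (z : A) : (0 < size s)%N ->
  z = ((size s)%:R^-1)%:C *: \sum_(i <- s) z.
Proof.
move=> s0; rewrite big_const_seq count_predT iter_addr addr0.
rewrite -[z *+ _]scaler_nat scalerA -(rmorph_nat (real_complex R)) -realM.
by rewrite mulVf ?rmorph1 ?scale1r// pnatr_eq0 -lt0n.
Qed.

Let average_le (s : seq G) (f : G -> A) (c : R) : (0 < size s)%N ->
  \sum_(i <- s) cnorm (f i) <= (size s)%:R * c ->
  cnorm (((size s)%:R^-1)%:C *: \sum_(i <- s) f i) <= c.
Proof.
move=> s0 hc; rewrite cnorm_real ger0_norm ?invr_ge0 ?ler0n// mulrC.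
rewrite ler_pdivrMr ?ltr0n// mulrC; apply: le_trans hc; exact: cnorm_sum.
Qed.

Let sum_le_const (s : seq G) (f : G -> R) (c : R) : (forall i, f i <= c) ->
  \sum_(i <- s) f i <= (size s)%:R * c.
Proof.
move=> fc; apply: le_trans (ler_sum _ (fun i _ => fc i)) _.
by rewrite big_const_seq count_predT iter_addr addr0 mulr_natl.
Qed.

Let hull_self : hull x.
Proof. by split=> // e g h hk k; exact/ltW. Qed.

Let hull_average s y : (0 < size s)%N -> hull y -> hull (average s y).
Proof.
move=> s0 [yx yy]; split=> [k|e g h /yy hk k].
  rewrite averageE {1}(average_cst x s0) -scalerBr -sumrB.
  by apply: average_le => //; exact: sum_le_const.
rewrite !averageE -scalerBr -sumrB; apply: average_le => //.
by apply: sum_le_const => i; rewrite -!mulgA.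
Qed.

(** Compare the average moved by [g] with any [alpha h y]. A net point i near g^-1 h yields a term
    within e, while the other terms cost at most e + D each; whence the factor 1 - 1 / size s. *)
Let average_osc s y (e D : R) : (0 < size s)%N -> hull y ->
  (forall g, exists2 h, h \in s &
     forall k, cnorm (alpha (g * k)%g x - alpha (h * k)%g x) < e) ->
  (forall g, cnorm (alpha g y - y) <= e + D) ->
  forall g, cnorm (alpha g (average s y) - average s y) <=
    e + (1 - (size s)%:R^-1) * D.
Proof.
move=> s0 [yx yy] net osc g.
have n0 : 0 < (size s)%:R :> R by rewrite ltr0n.
set w := alpha g (average s y).
have yw h : cnorm (w - alpha h y) <= e + (1 - (size s)%:R^-1) * D.
  rewrite /w averageE {1}(average_cst (alpha h y) s0) -scalerBr -sumrB.
  apply: average_le => //.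
  have [i is_ /yy/(_ 1%g)] := net (g^-1 * h)%g; rewrite !mulg1 => hi.
  rewrite (big_rem _ is_) /=.
  have -> : (size s)%:R * (e + (1 - (size s)%:R^-1) * D) =
      e + (size (rem i s))%:R * (e + D).
    rewrite size_rem// -subn1 natrB//; field; exact: lt0r_neq0.
  apply: lerD.
    by rewrite actM -(mulVKg g h) actM -linearB cnorm_act cnormB.
  apply: sum_le_const => j.
  rewrite -[(g * j)%g](mulVKg h) actM -linearB cnorm_act; exact: osc.
rewrite cnormB {1}/average {1}(average_cst w s0) -scalerBr -sumrB.
by apply: average_le => //; apply: sum_le_const => h; rewrite cnormB.
Qed.

Lemma halve_oscillation : exists u : A,
  cnorm (u - x) <= d /\ forall g, cnorm (alpha g u - u) <= d / 2.
Proof.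
(* A net of fineness d / 4 leaves the other quarter of d to the geometric term r^m d. *)
have d4 : 0 < d / 4 by rewrite divr_gt0.
have [s net] := act_net x d4.
have s0 : (0 < size s)%N by have [h] := net 1%g; case: (s).
pose r : R := 1 - (size s)%:R^-1.
have r0 : 0 <= r by rewrite subr_ge0 invf_le1 ?ltr0n// ler1n.
have r1 : r < 1 by rewrite gtrBl invr_gt0 ltr0n.
have iter_osc m : exists2 u, hull u &
    forall g, cnorm (alpha g u - u) <= d / 4 + r ^+ m * d.
  elim: m => [|m [u hu ou]].
    exists x => // g; rewrite expr0 mul1r; have := xd g; lra.
  exists (average s u); first exact: hull_average.
  by move=> g; rewrite exprS -mulrA; exact: average_osc.
have q0 : 0 < 1 / 4 :> R by lra.
have [m /(_ m (leqnn _)) rm] := expr_small r0 r1 q0.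
have [u [ux _] ou] := iter_osc m; exists u; split.
  by have := ux 1%g; rewrite act1.
move=> g; apply: le_trans (ou g) _.
have : r ^+ m * d <= 1 / 4 * d by rewrite ler_wpM2r// ltW.
by lra.
Qed.

End Averaging.

(** Successive halvings move the element by at most d, d / 2, d / 4 and so on; the total 2 d
    explains the bound, and the limit no longer oscillates. *)
Lemma fixed_near x d : 0 < d -> (forall g, cnorm (alpha g x - x) <= d) ->
  exists y : fixalg alpha, cnorm (x - fixval y) <= 2 * d.
Proof.
move=> d0 xd.
have /choice[f fP] : forall yc : A * R, exists u : A,
    0 < yc.2 -> (forall g, cnorm (alpha g yc.1 - yc.1) <= yc.2) ->
    cnorm (u - yc.1) <= yc.2 /\ forall g, cnorm (alpha g u - u) <= yc.2 / 2.
  move=> [y c]; have [[/= c0 yc]|no] :=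
      pselect (0 < c /\ forall g, cnorm (alpha g y - y) <= c).
    by have [u ?] := halve_oscillation c0 yc; exists u.
  by exists 0 => c0 yc; case: no.
pose t n : R := 2^-1 ^+ n * d.
have t0 n : 0 < t n by rewrite mulr_gt0// exprn_gt0// invr_gt0.
have tS n : t n.+1 = t n / 2 by rewrite /t exprS; lra.
pose u := fix u n := if n is m.+1 then f (u m, t m) else x.
have uosc n : forall g, cnorm (alpha g (u n) - u n) <= t n.
  elim: n => [|n ih]; first by rewrite /t expr0 mul1r.
  by rewrite tS; have [_] := fP (u n, t n) (t0 n) ih.
have ustep n : cnorm (u n.+1 - u n) <= t n.
  by have [] := fP (u n, t n) (t0 n) (uosc n).
have udist n m : cnorm (u (n + m)%N - u n) <= 2 * t n.
  suff : cnorm (u (n + m)%N - u n) <= 2 * t n - 2 * t (n + m)%N.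
    by have := t0 (n + m)%N; lra.
  elim: m => [|m ih]; first by rewrite addn0 subrr cnorm0 subrr.
  have := cnorm_tri (u (n + m)%N) (u (n + m.+1)%N) (u n).
  rewrite !addnS; have := ustep (n + m)%N; rewrite tS; lra.
have tsmall e : 0 < e -> exists N, forall n, (N <= n)%N -> 2 * t n < e.
  move=> e0; have h0 : 0 <= 2^-1 :> R by rewrite invr_ge0.
  have h1 : 2^-1 < 1 :> R by rewrite invf_lt1// ltr1n.
  have e0' : 0 < e / (2 * d) by rewrite divr_gt0// mulr_gt0.
  have [N hN] := expr_small h0 h1 e0'; exists N => n /hN.
  by rewrite ltr_pdivlMr ?mulr_gt0// /t; lra.
have [|l ul] := @cnorm_cauchy _ A u.
  move=> e e0; have [N hN] := tsmall e e0; exists N.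
  suff H n m : (n <= m)%N -> (N <= n)%N -> cnorm (u m - u n) < e.
    move=> n m Nn Nm; have [nm|mn] := leqP n m; first by rewrite cnormB H.
    by rewrite H// ltnW.
  move=> nm Nn; rewrite -(subnKC nm).
  by apply: le_lt_trans (udist _ _) _; exact: hN.
have lfix : l \in fixed_pred alpha.
  apply/asboolP => g; apply/eqP; rewrite -subr_eq0; apply/eqP.
  apply: (@cnorm_small _ _ _ 3) => e e0 _.
  have [N1 h1] := ul e e0; have [N2 h2] := tsmall e e0.
  have /h1 := leq_maxl N1 N2; have /h2 := leq_maxr N1 N2.
  set n := maxn _ _ => tn un.
  have := cnorm_tri (alpha g (u n)) (alpha g l) l.
  rewrite -linearB cnorm_act; have := cnorm_tri (u n) (alpha g (u n)) l.
  by have := uosc n g; rewrite [cnorm (u n - l)]cnormB; have := t0 n; lra.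
exists (Fixalg lfix) => /=; apply: cnorm_le_eps => e /ul[n /(_ n (leqnn _)) un].
have := cnorm_tri (u n) x l; rewrite [cnorm (u n - l)]cnormB.
have := udist 0 n; rewrite add0n [u 0%N]/= /t expr0 mul1r.
by rewrite [cnorm (x - u n)]cnormB; lra.
Qed.

End ActionContinuity.

(** * Completely positive maps and partitions of unity on the group *)

Section ContinuousFunctions.
Context {R : realType} {G : topGroupType}.

Lemma real_complex_continuous : continuous (fun r : R => r%:C : R[i]^o).
Proof.
move=> x U /= [e e0 eU].
have eE : (complex.Re e)%:C = e by apply: RRe_real; exact: gtr0_real.
apply/nbhs_normP; exists (complex.Re e) => /=; first by rewrite -ltcR eE.
move=> y /= xy; apply: eU => /=.
by rewrite -realB normc_def /= expr0n addr0 sqrtr_sqr -eE ltcR.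
Qed.

Lemma Re_continuous : continuous (fun z : R[i]^o => complex.Re z : R).
Proof.
move=> z U /nbhs_normP[e /= e0 eU]; exists e%:C => /=; first by rewrite ltcR.
move=> y /= zy; apply: eU; rewrite /= -ltcR; apply: le_lt_trans zy.
have -> : complex.Re z - complex.Re y = complex.Re (z - y) :> R.
  by case: z y => [? ?] [? ?].
exact: normc_ge_Re.
Qed.

Definition realC (r : G -> R) (cr : continuous r) : contC R G :=
  @mkcontC R G (fun g => (r g)%:C)
    (fun g => continuous_comp (cr g) (@real_complex_continuous (r g))).

Lemma continuous_sum I (s : seq I) (F : I -> G -> R) :
  (forall i, continuous (F i)) -> continuous (fun g => \sum_(i <- s) F i g).
Proof.
move=> cF; elim: s => [|i s ih].
  by under eq_fun do rewrite big_nil; move=> g; exact: cvg_cst.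
under eq_fun do rewrite big_cons; move=> g.
by apply: (@cvgD _ R); [exact: cF|exact: ih].
Qed.

Lemma contC_ge0 (f : contC R G) : (forall g, 0 <= f g) ->
  exists b : contC R G, f = star b * b.
Proof.
move=> f0; pose r g := Num.sqrt (complex.Re (f g)).
have cr : continuous r.
  move=> g; apply: (@continuous_comp _ _ _ (fun g => complex.Re (f g))).
    apply: (@continuous_comp G R[i]^o R (f : G -> R[i]^o)).
      exact: contC_cts.
    exact: Re_continuous.
  exact: sqrt_continuous.
exists (realC cr); apply: contCP => g.
have fE : (complex.Re (f g))%:C = f g by apply: RRe_real; exact: ger0_real.
rewrite -[LHS]fE -[RHS]/(((r g)%:C)^* * (r g)%:C) conj_Creal; last first.
  by apply/complex_realP; exists (r g).
by rewrite -realM -expr2 sqr_sqrtr// -lecR fE.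
Qed.

End ContinuousFunctions.

Section Projections.
Context {R : realType}.
Implicit Types A : cstarAlgType R.

Lemma projection_pos A (p : A) : is_projection p -> pos p.
Proof. by move=> [pp ps]; rewrite -pp; exact: pos_sqr. Qed.

Lemma projection_compl A (p : A) : is_projection p -> is_projection (1 - p).
Proof.
move=> [pp ps]; split; last by rewrite starB star1 ps.
by rewrite mulrBl mul1r mulrBr mulr1 pp subrr subr0.
Qed.

Lemma projection_le1 A (p : A) : is_projection p -> cnorm p <= 1.
Proof.
move=> pP; apply: pos_le; first exact: projection_pos.
by rewrite rmorph1 scale1r; exact/projection_pos/projection_compl.
Qed.

End Projections.

Section CompletelyPositiveMaps.
Context {R : realType} {G : topGroupType} {A : cstarAlgType R}.
Variables (p : A) (phi : {linear contC R G -> A}).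
Hypotheses (pP : is_projection p) (cp : ucp_to_corner p phi).

Lemma ucp_pos (f : contC R G) : (forall g, 0 <= f g) -> pos (phi f).
Proof.
move=> /contC_ge0[b ->]; case: cp => _ _ /(_ 1%N (const_mx b))[c [_ cE]].
move/matrixP: cE => /(_ 0 0); rewrite !mxE !big_ord1 !mxE => ->.
exact: pos_star_mul.
Qed.

(** In the order of [R[i]] these inequalities also force [f g] to be real. *)
Definition bounded_by (M : R) (f : contC R G) : Prop :=
  forall g, - M%:C <= f g <= M%:C.

Lemma ucp_const_sub M (f : contC R G) : bounded_by M f -> pos (M%:C *: p - phi f).
Proof.
case: (cp) => _ <- _ fM; rewrite -linearZ -linearB; apply: ucp_pos => g.
change (0 <= M%:C * 1 - f g); rewrite mulr1 subr_ge0.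
by case/andP: (fM g).
Qed.

Lemma ucp_star M (f : contC R G) : bounded_by M f -> star (phi f) = phi f.
Proof.
move=> /ucp_const_sub/posS; rewrite starB star_real pP.2.
by move/(congr1 (fun x => M%:C *: p - x)); rewrite !opprB !addrA !(addrC (_ *: p)) !addrK.
Qed.

(** Positivity gives -M p <= phi f <= M p, because phi 1 is [p], and p <= 1 turns this into a scalar
    bound. *)
Lemma ucp_norm M (f : contC R G) : bounded_by M f -> 0 <= M -> cnorm (phi f) <= M.
Proof.
move=> fM M0.
have pM : pos (M%:C%:A - M%:C *: p).
  by rewrite -scalerBr; apply: posZ => //; exact/projection_pos/projection_compl.
apply: pos_bound => //.
  by rewrite -(subrK (M%:C *: p) (_%:A)) -addrA; apply: posD => //; exact: ucp_const_sub.
rewrite -(subrK (M%:C *: p) (_%:A)) -addrA; apply: posD => //.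
rewrite -[X in _ + X]opprK -(linearN phi); apply: ucp_const_sub => g.
change (- M%:C <= - f g <= M%:C); rewrite lerN2 lerNl andbC; exact: fM.
Qed.

Lemma ucp_cornerl f : p * phi f = phi f.
Proof. by case: cp => /(_ f)[a _ <-] _ _; rewrite !mulrA pP.1. Qed.

End CompletelyPositiveMaps.

Section PartitionOfUnity.
Context {R : realType} {G : topGroupType} {A : cstarAlgType R}.
Variable alpha : cstar_action G A.

Lemma cnorm_act_sub_continuous a c : continuous (fun g => cnorm (alpha g a - c)).
Proof.
move=> g; apply/cvgrPdist_lt => e e0; apply: filterS (act_near alpha a g e0) => h.
apply: le_lt_trans; rewrite ler_norml.
have := cnorm_tri (alpha h a) (alpha g a) c.
have := cnorm_tri (alpha g a) (alpha h a) c.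
by rewrite [cnorm (alpha g a - alpha h a)]cnormB; lra.
Qed.

(** Hat functions max (0, d - D) around the points of a finite net, divided by the root of the sum
    of their squares. The squares add up to 1 because Psi carries [E k] on both sides. *)
Lemma partition_of_unity (L : seq A) (d : R) :
  compact [set: G] -> 0 < d ->
  exists (m : nat) (gs : 'I_m -> G) (E : 'I_m -> contC R G),
  [/\ forall k g, 0 <= E k g <= 1, \sum_k E k * E k = 1
    & forall k g a, E k g != 0 -> a \in L ->
        cnorm (alpha g a - alpha (gs k) a) < d].
Proof.
move=> cG d0; pose D g h := \sum_(a <- L) cnorm (alpha g a - alpha h a).
have cD h : continuous (D ^~ h).
  by apply: continuous_sum => a; exact: cnorm_act_sub_continuous.
have D0 g h : 0 <= D g h by apply: sumr_ge0 => a _; exact: cnorm_ge0.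
have [|s cover] := @compact_net _ (fun h => [set g | D g h < d]) cG.
  move=> h; have /cvgrPdist_lt/(_ _ d0) := cD h h.
  apply: filterS => g /=; rewrite {1}/D big1 => [|a _].
    by rewrite sub0r normrN ger0_norm.
  by rewrite subrr cnorm0.
pose m := size s; pose gs (k : 'I_m) := nth 1%g s k.
pose b (k : 'I_m) g := Num.max 0 (d - D g (gs k)).
have cb k : continuous (b k).
  move=> g; apply: (@continuous_max R G (fun=> 0) (fun g => d - D g (gs k))).
    exact: cvg_cst.
  by apply: (@cvgB _ R); [exact: cvg_cst|exact: cD].
have b0 k g : 0 <= b k g by rewrite le_max lexx.
pose S g := \sum_k b k g ^+ 2.
have cS : continuous S.
  apply: continuous_sum => k g; under eq_fun do rewrite expr2.
  by apply: (@cvgM R); exact: cb.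
have S0 g : 0 < S g.
  have [h hs Dgh] := cover g.
  have hi : (index h s < m)%N by rewrite index_mem.
  rewrite /S (bigD1 (Ordinal hi))//= ltr_pwDl//; last first.
    by apply: sumr_ge0 => k _; exact: sqr_ge0.
  rewrite exprn_gt0// lt_max /gs /= nth_index//; apply/orP; right.
  by rewrite subr_gt0.
have bS k g : b k g <= Num.sqrt (S g).
  rewrite -[leLHS]ger0_norm// -sqrtr_sqr ler_wsqrtr// /S (bigD1 k)//= lerDl.
  by apply: sumr_ge0 => j _; exact: sqr_ge0.
have sS0 g : 0 < Num.sqrt (S g) by rewrite sqrtr_gt0.
pose e k g := b k g / Num.sqrt (S g).
have ce k : continuous (e k).
  move=> g; apply: (@cvgM R); first exact: cb.
  apply: (@cvgV R); first exact: lt0r_neq0.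
  by apply: (@continuous_comp _ _ _ S); [exact: cS|exact: sqrt_continuous].
exists m, gs, (fun k => realC (ce k)); split=> [k g||k g a].
- change (0 <= (e k g)%:C <= 1); rewrite ler0c; apply/andP; split.
    by rewrite divr_ge0// ltW.
  by rewrite lecR ler_pdivrMr// mul1r.
- apply: contCP => g.
  have sumE (F : 'I_m -> contC R G) : (\sum_k F k) g = \sum_k F k g.
    by elim/big_ind2: _ => // f1 f2 f3 f4 <- <-.
  rewrite [LHS](sumE (fun k => realC (ce k) * realC (ce k))).
  rewrite (eq_bigr (fun k => (e k g * e k g)%:C)) => [|k _]; last first.
    by rewrite realM.
  rewrite -rmorph_sum /= (_ : \sum_k _ = 1) ?rmorph1//.
  under eq_bigr do rewrite -expr2 expr_div_n sqr_sqrtr ?ltW//.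
  by rewrite -mulr_suml -/(S g) mulfV// lt0r_neq0.
- move=> ek aL; have [dD|Dd] := leP d (D g (gs k)).
    case/eqP: ek; rewrite -[LHS]/((e k g)%:C) /e /b max_l ?mul0r//.
    by rewrite subr_le0.
  apply: le_lt_trans Dd; rewrite /D (big_rem _ aL) /= lerDl.
  by apply: sumr_ge0 => c _; exact: cnorm_ge0.
Qed.

End PartitionOfUnity.

(** * Localized sums along an asymptotically multiplicative map *)

Section AsymptoticEquality.
Context {R : realType} {A : cstarAlgType R}.
Implicit Types u v w x y : nat -> A.

Definition bdd u := exists M, forall n, cnorm (u n) <= M.

Definition asy u v :=
  forall e, 0 < e -> \forall n \near \oo, cnorm (u n - v n) < e.

Lemma asyxx u : asy u u.
Proof. by move=> e e0; near=> n; rewrite subrr cnorm0. Unshelve. all: by end_near. Qed.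

Lemma asy_sym u v : asy u v -> asy v u.
Proof. by move=> uv e /uv; apply: filterS => n; rewrite cnormB. Qed.

Lemma asy_trans v u w : asy u v -> asy v w -> asy u w.
Proof.
move=> uv vw e e0; have e2 : 0 < e / 2 by rewrite divr_gt0.
apply: filterS2 (uv _ e2) (vw _ e2) => n un vn.
by have := cnorm_tri (v n) (u n) (w n); lra.
Qed.

Lemma asyD u v x y : asy u x -> asy v y -> asy (u + v) (x + y).
Proof.
move=> ux vy e e0; have e2 : 0 < e / 2 by rewrite divr_gt0.
apply: filterS2 (ux _ e2) (vy _ e2) => n un vn.
have -> : (u + v) n - (x + y) n = (u n - x n) + (v n - y n).
  by change (u n + v n - (x n + y n) = u n - x n + (v n - y n)); ncring.
by have := cnormD (u n - x n) (v n - y n); lra.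
Qed.

Lemma asyN u v : asy u v -> asy (- u) (- v).
Proof.
move=> uv e /uv; apply: filterS => n.
change (cnorm (u n - v n) < e -> cnorm (- u n - - v n) < e).
by rewrite -opprD cnormN.
Qed.

Lemma asy_sum I (r : seq I) (P : pred I) (F H : I -> nat -> A) :
  (forall i, asy (F i) (H i)) ->
  asy (\sum_(i <- r | P i) F i) (\sum_(i <- r | P i) H i).
Proof.
by move=> FH; elim/big_ind2: _ => //; [exact: asyxx|move=> *; exact: asyD].
Qed.

Lemma bdd_cst a : bdd (cst a). Proof. by exists (cnorm a). Qed.

Lemma bddM u v : bdd u -> bdd v -> bdd (u * v).
Proof.
move=> [M uM] [N vN]; exists (M * N) => n.
by apply: le_trans (cnormM _ _) _; apply: ler_pM => //; exact: cnorm_ge0.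
Qed.

Lemma asyMl w u v : bdd w -> asy u v -> asy (w * u) (w * v).
Proof.
move=> [M wM] uv e e0; have M0 : 0 <= M by exact: le_trans (cnorm_ge0 _) (wM 0%N).
have M1 : 0 < M + 1 by lra.
have := uv _ (divr_gt0 e0 M1); apply: filterS => n; rewrite ltr_pdivlMr//.
change (cnorm (u n - v n) * (M + 1) < e -> cnorm (w n * u n - w n * v n) < e).
rewrite -mulrBr; have := cnormM (w n) (u n - v n); have := wM n.
by have := cnorm_ge0 (u n - v n); have := cnorm_ge0 (w n); nra.
Qed.

Lemma asyMr w u v : bdd w -> asy u v -> asy (u * w) (v * w).
Proof.
move=> [M wM] uv e e0; have M0 : 0 <= M by exact: le_trans (cnorm_ge0 _) (wM 0%N).
have M1 : 0 < M + 1 by lra.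
have := uv _ (divr_gt0 e0 M1); apply: filterS => n; rewrite ltr_pdivlMr//.
change (cnorm (u n - v n) * (M + 1) < e -> cnorm (u n * w n - v n * w n) < e).
rewrite -mulrBl; have := cnormM (u n - v n) (w n); have := wM n.
by have := cnorm_ge0 (u n - v n); have := cnorm_ge0 (w n); nra.
Qed.

Lemma asyM u v x y : bdd x -> bdd v -> asy u x -> asy v y -> asy (u * v) (x * y).
Proof.
by move=> bx bv ux vy; apply: asy_trans (asyMr bv ux) (asyMl bx vy).
Qed.

Lemma asyMlr w w' u v : bdd w -> bdd w' -> asy u v ->
  asy (w * u * w') (w * v * w').
Proof. by move=> bw bw' uv; apply: asyMr => //; exact: asyMl. Qed.

Lemma asy_norm_le u v (c e : R) : asy u v -> 0 < e ->
  (forall n, cnorm (v n) <= c) -> \forall n \near \oo, cnorm (u n) <= c + e.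
Proof.
move=> uv /uv h vc; apply: filterS h => n un.
by have := cnormD (u n - v n) (v n); rewrite subrK; have := vc n; lra.
Qed.

Lemma asy_cst_inj (a b : A) : asy (cst a) (cst b) -> a = b.
Proof.
move=> ab; apply/eqP; rewrite -subr_eq0; apply/eqP/(@cnorm_small _ _ _ 1) => e e0 _.
by have [n /= /ltW] := filter_ex (ab e e0); rewrite mul1r.
Qed.

End AsymptoticEquality.

Section Localization.
Context {R : realType} {G : topGroupType} {A : cstarAlgType R}.
Variables (p : nat -> A) (phi : nat -> {linear contC R G -> A}).
Hypothesis pP : forall n, is_projection (p n).
Hypothesis cp : forall n, ucp_to_corner (p n) (phi n).

Let Phi f : nat -> A := fun n => phi n f.

Definition unit_valued (f : contC R G) : Prop := forall g, 0 <= f g <= 1.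

Definition asy_mult f h := asy (Phi f * Phi h) (Phi (f * h)).
Definition asy_comm f c := asy (Phi f * cst c) (cst c * Phi f).

Lemma contCC (f h : contC R G) : f * h = h * f.
Proof. by apply: contCP => g; exact: mulrC. Qed.

Lemma unit_valued_bounded f : unit_valued f -> bounded_by 1 f.
Proof.
move=> fu g; have /andP[f0 f1] := fu g; rewrite rmorph1 f1 andbT.
by apply: le_trans f0; rewrite oppr_le0.
Qed.

Lemma unit_valuedM f h : unit_valued f -> unit_valued h -> unit_valued (f * h).
Proof.
move=> fu hu g; change (0 <= f g * h g <= 1).
have /andP[f0 f1] := fu g; have /andP[h0 h1] := hu g.
by rewrite mulr_ge0//= -[1]mulr1 ler_pM.
Qed.

Let Phi_le1 f n : unit_valued f -> cnorm (phi n f) <= 1.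
Proof. by move=> /unit_valued_bounded fb; exact: (ucp_norm (pP n) (cp n)). Qed.

Let Phi_star f n : unit_valued f -> star (phi n f) = phi n f.
Proof. by move=> /unit_valued_bounded; exact: (ucp_star (pP n) (cp n)). Qed.

Let bddPhi f : unit_valued f -> bdd (Phi f).
Proof. by move=> fu; exists 1 => n; exact: Phi_le1. Qed.

Let PhiE : Phi 1 = p.
Proof. by apply/funext => n; case: (cp n). Qed.

Let p_Phi f : p * Phi f = Phi f.
Proof. by apply/funext => n; exact: ucp_cornerl (pP n) (cp n) f. Qed.

Let Phi_sum I (r : seq I) (F : I -> contC R G) :
  Phi (\sum_(i <- r) F i) = \sum_(i <- r) Phi (F i).
Proof. by apply/funext => n; rewrite /Phi linear_sum fct_sumE. Qed.

(** The sequence of maps Psi with free coefficients: [c k] will be [alpha (gs k) a], but also a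
    coefficient belonging to a translated partition or to a product. *)
Definition theta m (E : 'I_m -> contC R G) (c : 'I_m -> A) : nat -> A :=
  \sum_k Phi (E k) * cst (c k) * Phi (E k).

Section Refinement.
Variables (m m' : nat) (E : 'I_m -> contC R G) (E' : 'I_m' -> contC R G).
Hypotheses (Eu : forall k, unit_valued (E k)) (Eu' : forall l, unit_valued (E' l)).
Hypothesis sumE' : \sum_l E' l * E' l = 1.
Hypothesis mEE' : forall k l, asy_mult (E k) (E' l).
Hypothesis mE'E : forall k l, asy_mult (E' l) (E k).
Hypothesis mE' : forall l, asy_mult (E' l) (E' l).

(** Since phi (E k) = p phi (E k) and p is the sum of the phi (E' l * E' l), a factor phi (E' l)^2
    can be inserted on the right; one of its halves is then carried to the left across [c k]. On the
    common refinement, coefficients of different partitions become comparable. *)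
Lemma theta_refine c : (forall k l, asy_comm (E' l) (c k)) ->
  asy (theta E c)
      (\sum_k \sum_l Phi (E k * E' l) * cst (c k) * Phi (E k * E' l)).
Proof.
move=> com; apply: asy_sum => k.
rewrite -{2}p_Phi -PhiE -sumE' Phi_sum mulr_suml mulr_sumr.
apply: asy_sum => l; rewrite mulrA.
have bk := bddPhi (Eu k); have bl := bddPhi (Eu' l).
have bc := bdd_cst (c k); have bkl := bddPhi (unit_valuedM (Eu k) (Eu' l)).
apply: (asy_trans (v := Phi (E k) * cst (c k) * (Phi (E' l) * Phi (E' l)) * Phi (E k))).
  by apply: asyMlr => //; [exact: bddM|exact/asy_sym/mE'].
rewrite (_ : _ * Phi (E k) =
  Phi (E k) * (cst (c k) * Phi (E' l)) * (Phi (E' l) * Phi (E k))); last by ncring.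
apply: asy_trans (asyMlr _ _ (asy_sym (com k l))) _ => //; first exact: bddM.
rewrite (_ : _ * (Phi (E' l) * Phi (E k)) =
  (Phi (E k) * Phi (E' l)) * cst (c k) * (Phi (E' l) * Phi (E k))); last by ncring.
apply: asyM; [exact: bddM|exact: bddM| |].
  by apply: asyMr => //; exact: mEE'.
by rewrite contCC; exact: mE'E.
Qed.

Lemma theta_square_sum : \sum_k E k * E k = 1 ->
  (forall k, asy_mult (E k) (E k)) ->
  asy (\sum_k \sum_l Phi (E k * E' l) * Phi (E k * E' l)) p.
Proof.
move=> sumE mE.
have /(_ (fun=> 1)) := theta_refine; rewrite /theta.
have -> : \sum_k Phi (E k) * cst 1 * Phi (E k) = \sum_k Phi (E k) * Phi (E k).
  by apply: eq_bigr => k _; rewrite mulr1.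
have -> : \sum_k \sum_l Phi (E k * E' l) * cst 1 * Phi (E k * E' l) =
    \sum_k \sum_l Phi (E k * E' l) * Phi (E k * E' l).
  by apply: eq_bigr => k _; apply: eq_bigr => l _; rewrite mulr1.
move=> ref; apply: asy_trans (asy_sym (ref _)) _.
  by move=> k l; rewrite /asy_comm mulr1 mul1r; exact: asyxx.
by rewrite -PhiE -sumE Phi_sum; apply: asy_sum => k; exact: mE.
Qed.

(** Pairs with disjoint supports have E k * E' l = 0, so their coefficients may be replaced by 0.
    The rest is [cnorm_sum_conj], whose quadratic sum tends to a projection by
    [theta_square_sum]. *)
Lemma localized_sum_le (D : 'I_m -> 'I_m' -> A) (eta e : R) :
  \sum_k E k * E k = 1 -> (forall k, asy_mult (E k) (E k)) ->
  0 <= eta -> 0 < e ->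
  (forall k l g, E k g != 0 -> E' l g != 0 -> cnorm (D k l) <= eta) ->
  \forall n \near \oo, cnorm
    ((\sum_k \sum_l Phi (E k * E' l) * cst (D k l) * Phi (E k * E' l)) n)
      <= 2 * eta + e.
Proof.
move=> sumE mE eta0 e0 Deta.
pose active k l := `[< exists g, E k g != 0 /\ E' l g != 0 >].
pose D' (kl : 'I_m * 'I_m') := if active kl.1 kl.2 then D kl.1 kl.2 else 0.
have D'eta kl : cnorm (D' kl) <= eta.
  rewrite /D' /active; case: asboolP => [[g [Ek El]]|_]; last by rewrite cnorm0.
  exact: Deta Ek El.
have inactive k l : ~~ active k l -> E k * E' l = 0.
  move=> /asboolPn na; apply: contCP => g; change (E k g * E' l g = 0).
  apply/eqP; rewrite mulf_eq0; apply/negPn/negP; rewrite negb_or => /andP[Ek El].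
  by apply: na; exists g.
(* Chosen so that 2 eta (1 + e / (2 eta + 1)) <= 2 eta + e. *)
have d0 : 0 < e / (2 * eta + 1) by rewrite divr_gt0//; lra.
have := asy_norm_le (theta_square_sum sumE mE) d0
  (fun n => projection_le1 (pP n)).
apply: filterS => n.
rewrite !fct_sumE; under eq_bigr do rewrite fct_sumE.
under [X in _ -> cnorm X <= _]eq_bigr do rewrite fct_sumE.
rewrite !pair_big /=; set S := (X in cnorm X <= _ -> _) => hS.
pose r (kl : 'I_m * 'I_m') := phi n (E kl.1 * E' kl.2).
have sr kl : star (r kl) = r kl by apply/Phi_star/unit_valuedM.
have -> : \sum_(kl : 'I_m * 'I_m') (Phi (E kl.1 * E' kl.2) * cst (D kl.1 kl.2) *
      Phi (E kl.1 * E' kl.2)) n = \sum_kl star (r kl) * D' kl * r kl.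
  apply: eq_bigr => -[k l] _; rewrite sr /r /D' /=.
  case: ifPn => [//|/inactive ->].
  by change (phi n 0 * D k l * phi n 0 = phi n 0 * 0 * phi n 0); rewrite !linear0 !mulr0.
apply: le_trans (cnorm_sum_conj _ D'eta eta0) _.
have -> : \sum_kl star (r kl) * r kl = S.
  by apply: eq_bigr => -[k l] _; rewrite sr.
have : 2 * eta * cnorm S <= 2 * eta * (1 + e / (2 * eta + 1)).
  by rewrite ler_wpM2l// mulr_ge0.
move=> /le_trans; apply; rewrite mulrDr mulr1 lerD2l mulrCA.
rewrite -[leRHS]mulr1 ler_pM2l// ler_pdivrMr; lra.
Qed.

End Refinement.

(** Independence of the partition, up to the mismatch of coefficients on overlaps. Applied to a
    partition and its translate it gives almost invariance. *)
Lemma theta_compare m m' (E : 'I_m -> contC R G) (E' : 'I_m' -> contC R G)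
    (c : 'I_m -> A) (c' : 'I_m' -> A) (eta e : R) :
  (forall k, unit_valued (E k)) -> (forall l, unit_valued (E' l)) ->
  \sum_k E k * E k = 1 -> \sum_l E' l * E' l = 1 ->
  (forall k, asy_mult (E k) (E k)) -> (forall l, asy_mult (E' l) (E' l)) ->
  (forall k l, asy_mult (E k) (E' l)) -> (forall k l, asy_mult (E' l) (E k)) ->
  (forall k l, asy_comm (E' l) (c k)) -> (forall k l, asy_comm (E k) (c' l)) ->
  0 <= eta -> 0 < e ->
  (forall k l g, E k g != 0 -> E' l g != 0 -> cnorm (c k - c' l) <= eta) ->
  \forall n \near \oo, cnorm (theta E c n - theta E' c' n) <= 2 * eta + e.
Proof.
move=> Eu Eu' sE sE' mE mE' mEE' mE'E cc cc' eta0 e0 ceta.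
have e2 : 0 < e / 2 by rewrite divr_gt0.
have r1 := theta_refine Eu Eu' sE' mEE' mE'E mE' cc.
have r2 := theta_refine Eu' Eu sE (fun l k => mE'E k l) (fun l k => mEE' k l) mE
  (fun l k => cc' k l).
have := asyD r1 (asyN r2).
have -> : \sum_l \sum_k Phi (E' l * E k) * cst (c' l) * Phi (E' l * E k) =
    \sum_k \sum_l Phi (E k * E' l) * cst (c' l) * Phi (E k * E' l).
  rewrite exchange_big; apply: eq_bigr => k _; apply: eq_bigr => l _.
  by rewrite contCC.
rewrite -sumrB.
have -> : \sum_k (\sum_l Phi (E k * E' l) * cst (c k) * Phi (E k * E' l) -
      \sum_l Phi (E k * E' l) * cst (c' l) * Phi (E k * E' l)) =
    \sum_k \sum_l Phi (E k * E' l) * cst (c k - c' l) * Phi (E k * E' l).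
  apply: eq_bigr => k _; rewrite -sumrB; apply: eq_bigr => l _.
  have -> : cst (c k - c' l) = cst (c k) - cst (c' l) :> (nat -> A) by [].
  by ncring.
move=> /(_ _ e2) h1.
have := localized_sum_le Eu Eu' sE' mEE' mE'E mE' sE mE eta0 e2 ceta.
apply: filterS2 h1 => n; set y := (\sum_k _) n.
change (cnorm (theta E c n - theta E' c' n - y) < e / 2 -> cnorm y <= 2 * eta + e / 2 ->
  cnorm (theta E c n - theta E' c' n) <= 2 * eta + e).
by have := cnormD (theta E c n - theta E' c' n - y) y; rewrite subrK; lra.
Qed.

(** The product of two localized sums is localized on E k * E l with coefficient a k * b l, and the
    sum with coefficients [ab] can be refined along the same products. *)
Lemma theta_mul m (E : 'I_m -> contC R G) (a b ab : 'I_m -> A) (eta e : R) :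
  (forall k, unit_valued (E k)) -> \sum_k E k * E k = 1 ->
  (forall k l, asy_mult (E k) (E l)) ->
  (forall k l, asy_comm (E k) (a l)) -> (forall k l, asy_comm (E k) (b l)) ->
  (forall k l, asy_comm (E k) (ab l)) ->
  0 <= eta -> 0 < e ->
  (forall k l g, E k g != 0 -> E l g != 0 -> cnorm (a k * b l - ab k) <= eta) ->
  \forall n \near \oo, cnorm (theta E a n * theta E b n - theta E ab n) <= 2 * eta + e.
Proof.
move=> Eu sE mE ca cb cab eta0 e0 heta.
have e2 : 0 < e / 2 by rewrite divr_gt0.
have r1 := theta_refine Eu Eu sE mE (fun k l => mE l k) (fun l => mE l l)
  (fun k l => cab l k).
have r2 : asy (theta E a * theta E b)
    (\sum_k \sum_l Phi (E k * E l) * cst (a k * b l) * Phi (E k * E l)).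
  rewrite /theta mulr_suml; apply: asy_sum => k.
  rewrite mulr_sumr; apply: asy_sum => l.
  have bk := bddPhi (Eu k); have bl := bddPhi (Eu l).
  have ba := bdd_cst (a k); have bb := bdd_cst (b l).
  have bkl := bddPhi (unit_valuedM (Eu k) (Eu l)).
  set x := Phi (E k) in bk *; set y := Phi (E l) in bl *.
  set z := Phi (E k * E l) in bkl *.
  set s := cst (a k) in ba *; set t := cst (b l) in bb *.
  have xs : asy (s * x) (x * s) by apply/asy_sym/ca.
  have ys : asy (s * y) (y * s) by apply/asy_sym/ca.
  have yt : asy (y * t) (t * y) by exact: cb.
  have xt : asy (x * t) (t * x) by exact: cb.
  have xy : asy (x * y) z by exact: mE.
  have yx : asy (y * x) z by rewrite /z contCC; exact: mE.
  have -> : cst (a k * b l) = s * t by [].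
  (* The word x s x y t y becomes x y s t x y by exchanging the middle x and y, then commuting s
     past y and x past t. *)
  have -> : x * s * x * (y * t * y) = (x * s) * (x * y) * (t * y) by ncring.
  apply: (asy_trans (v := (x * s) * (y * x) * (t * y))).
    apply: asyMlr; [exact: bddM|exact: bddM|].
    exact: asy_trans xy (asy_sym yx).
  have -> : (x * s) * (y * x) * (t * y) = x * ((s * y) * (x * t)) * y by ncring.
  apply: (asy_trans (v := x * ((y * s) * (t * x)) * y)).
    by apply: asyMlr => //; apply: asyM => //; exact: bddM.
  have -> : x * ((y * s) * (t * x)) * y = (x * y) * (s * t) * (x * y) by ncring.
  apply: asyM; [by apply: bddM => //; exact: bddM|exact: bddM| |by []].
  by apply: asyMr => //; exact: bddM.
have := asyD r2 (asyN r1); rewrite -sumrB.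
have -> : \sum_k (\sum_l Phi (E k * E l) * cst (a k * b l) * Phi (E k * E l) -
      \sum_l Phi (E k * E l) * cst (ab k) * Phi (E k * E l)) =
    \sum_k \sum_l Phi (E k * E l) * cst (a k * b l - ab k) * Phi (E k * E l).
  apply: eq_bigr => k _; rewrite -sumrB; apply: eq_bigr => l _.
  have -> : cst (a k * b l - ab k) = cst (a k * b l) - cst (ab k) :> (nat -> A) by [].
  by ncring.
move=> /(_ _ e2) h1.
have := localized_sum_le Eu Eu sE mE (fun k l => mE l k) (fun l => mE l l) sE
  (fun l => mE l l) eta0 e2 heta.
apply: filterS2 h1 => n; set y := (\sum_k _) n.
change (cnorm (theta E a n * theta E b n - theta E ab n - y) < e / 2 ->
  cnorm y <= 2 * eta + e / 2 ->
  cnorm (theta E a n * theta E b n - theta E ab n) <= 2 * eta + e).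
by have := cnormD (theta E a n * theta E b n - theta E ab n - y) y; rewrite subrK; lra.
Qed.

End Localization.

(** * Approximate homomorphisms into the fixed point algebra *)

Lemma near_seq (T : eqType) (I : Type) (F : set_system I) (FF : Filter F)
    (s : seq T) (P : T -> I -> Prop) :
  (forall x, x \in s -> \forall i \near F, P x i) ->
  \forall i \near F, forall x, x \in s -> P x i.
Proof.
elim: s => [|x s ih] h; first by apply: filterE => i x.
apply: filterS2 (h x (mem_head _ _)) (ih _) => [i Px Ps y|y ys].
  by rewrite inE => /predU1P[->//|]; exact: Ps.
by apply: h; rewrite inE ys orbT.
Qed.

Section Approximation.
Context {R : realType} {G : topGroupType} {A : cstarAlgType R}.
Variable alpha : cstar_action G A.
Hypothesis cG : compact [set: G].

Lemma translate_near (f : contC R G) (h : G) (e : R) :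
  unit_valued f -> 0 < e ->
  \forall g \near h, bounded_by e (translate g f - translate h f).
Proof.
move=> fu e0; have e2 : 0 < e / 2 by rewrite divr_gt0.
have inv_near : \forall g \near h^-1%g, forall k,
    `|f (g * k)%g - f (h^-1 * k)%g| <= e%:C.
  apply: compact_tube => // k.
  have nU : nbhs (h^-1 * k)%g [set y | `|f (h^-1 * k)%g - f y| < (e / 2)%:C].
    apply: (@contC_cts R G f _ [set z | `|f (h^-1 * k)%g - z| < (e / 2)%:C]).
    by exists (e / 2)%:C => //=; rewrite ltcR.
  have [[U1 U2] /= [n1 n2] U12] := mulg_near nU.
  exists (U1, U2) => // -[k' g'] [/= u1 u2].
  have h1 := U12 (k', g') (conj u1 u2).
  have h2 := U12 (k', h^-1%g) (conj u1 (nbhs_singleton n2)).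
  rewrite (_ : e = e / 2 + e / 2); last by lra.
  rewrite realD; apply: le_trans (ler_distD (f (h^-1 * k)%g) _ _) _.
  by apply: lerD; apply: ltW => //; rewrite distrC.
have : \forall g \near h, forall k, `|f (g^-1 * k)%g - f (h^-1 * k)%g| <= e%:C.
  exact: (@invg_continuous G h _ inv_near).
apply: filterS => g /= hg k; have := hg k.
change (`|f (g^-1 * k)%g - f (h^-1 * k)%g| <= e%:C ->
  - e%:C <= f (g^-1 * k)%g - f (h^-1 * k)%g <= e%:C).
have fr y : f y \is Num.real by apply: ger0_real; case/andP: (fu y).
by rewrite real_ler_norml// rpredB.
Qed.

(** Multiplicativity and commutation of phi are available for finitely many functions and elements,
    whereas invariance is wanted for all [g]. The net reduces every [g] to one of finitely many
    translates. *)
Lemma translate_act_net m (gs : 'I_m -> G) (E : 'I_m -> contC R G) (L : seq A)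
    (e : R) : (forall k, unit_valued (E k)) -> 0 < e ->
  exists s : seq G, forall g, exists2 h, h \in s & forall k,
    bounded_by e (translate g (E k) - translate h (E k)) /\
    forall a, a \in L ->
      cnorm (alpha (g * gs k)%g a - alpha (h * gs k)%g a) < e.
Proof.
move=> Eu e0.
pose Q h k := [set g | bounded_by e (translate g (E k) - translate h (E k)) /\
    forall a, a \in L ->
      cnorm (alpha (g * gs k)%g a - alpha (h * gs k)%g a) < e].
apply: (compact_net (V := fun h => [set g | forall k, Q h k g]) cG) => h.
apply: (@filter_forall _ _ (Q h) (nbhs h) _) => k.
apply: filterS2 (translate_near h (Eu k) e0) _.
  by move=> g hb ha; split; [exact: hb|exact: ha].
apply: near_seq => a _.
have [[U1 U2] /= [n1 n2] U12] := mulg_near (act_near alpha a (h * gs k)%g e0).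
apply: filterS n2 => g Ug.
exact: (U12 (gs k, g) (conj (nbhs_singleton n1) Ug)).
Qed.

Lemma unit_valued_translate g (f : contC R G) :
  unit_valued f -> unit_valued (translate g f).
Proof. by move=> fu h; exact: fu. Qed.

Lemma projection_fixval (p : fixalg alpha) :
  is_projection p -> is_projection (fixval p).
Proof.
by move=> [pp ps]; split; [exact: (congr1 val pp)|exact: (congr1 val ps)].
Qed.

(** The Rokhlin property with tolerance 1 / (n + 1) and with x and y both equal to 1. Then the last
    condition reads |p| > 1 - 1 / (n + 1) >= 0, which makes p nonzero. *)
Lemma rokhlin_sequence (F : seq A) (S : seq (contC R G)) :
  tracial_rokhlin_with_comparison alpha -> (forall f, f \in S -> unit_valued f) ->
  exists (p : nat -> fixalg alpha) (phi : nat -> {linear contC R G -> A}),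
  [/\ forall n, [/\ is_projection (p n), p n != 0 & cuntz_sub (1 - p n) (p n)],
      forall n, ucp_to_corner (fixval (p n)) (phi n),
      forall f h, f \in S -> h \in S -> asy_mult phi f h,
      forall f a, f \in S -> a \in F -> asy_comm phi f a
    & forall f e, f \in S -> 0 < e -> \forall n \near \oo, forall g,
        cnorm (phi n (translate g f) - alpha g (phi n f)) < e].
Proof.
move=> trp Su.
have pos1 (B : cstarAlgType R) : is_positive (1 : B).
  by exists 1; rewrite star1 mulr1.
have e0 n : 0 < n.+1%:R^-1 :> R by rewrite invr_gt0 ltr0n.
have /choice[pphi H] : forall n : nat,
    exists pphi : fixalg alpha * {linear contC R G -> A},
    [/\ is_projection pphi.1, ucp_to_corner (fixval pphi.1) pphi.2,
        [/\ forall f1 f2, f1 \in S -> f2 \in S ->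
              cnorm (pphi.2 (f1 * f2) - pphi.2 f1 * pphi.2 f2) < n.+1%:R^-1,
            forall f a, f \in S -> a \in F ->
              cnorm (pphi.2 f * a - a * pphi.2 f) < n.+1%:R^-1
          & forall f, f \in S ->
              sup [set cnorm (pphi.2 (translate g f) - alpha g (pphi.2 f))
                    | g in [set: G]] < n.+1%:R^-1]
      & [/\ cuntz_sub (1 - fixval pphi.1) 1, cuntz_sub (1 - pphi.1) 1,
            cuntz_sub (1 - pphi.1) pphi.1
          & 1 - n.+1%:R^-1 < cnorm (fixval pphi.1 * 1 * fixval pphi.1)]].
  move=> n; have [p [phi h]] := trp F S _ 1 1 (e0 n) (pos1 A) (cnorm1 A)
    (pos1 (fixalg alpha)) (oner_neq0 _).
  by exists (p, phi).
have small e : 0 < e -> \forall n \near \oo, n.+1%:R^-1 < e :> R.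
  by move=> ep; exact: (near_infty_natSinv_lt (PosNum ep)).
exists (fun n => (pphi n).1), (fun n => (pphi n).2); split.
- move=> n; have [pp _ _ [_ _ c pn]] := H n; split => //.
  apply/eqP => p0; move: pn; rewrite p0 /= mulr0 cnorm0 subr_lt0.
  by rewrite ltNge invf_le1 ?ltr0n// ler1n.
- by move=> n; case: (H n).
- move=> f h fS hS e /small; apply: filterS => n; have [_ _ [+ _ _] _] := H n.
  by move=> /(_ f h fS hS); rewrite cnormB; exact: lt_trans.
- move=> f a fS aF e /small; apply: filterS => n; have [_ _ [_ + _] _] := H n.
  by move=> /(_ f a fS aF); exact: lt_trans.
- move=> f e fS /small; apply: filterS => n ne g; have [pp cp [_ _ +] _] := H n.
  move=> /(_ f fS); move: (pphi n) pp cp => [p phi] /= pp cp supe.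
  apply: le_lt_trans (lt_trans supe ne); apply: ub_le_sup; last by exists g.
  have pp' := projection_fixval pp.
  have phi1 h : unit_valued h -> cnorm (phi h) <= 1.
    by move=> /unit_valued_bounded hb; exact: (ucp_norm pp' cp hb).
  (* The supremum dominates the single [g] because the set is bounded: both terms of each difference
     have norm at most 1. *)
  exists 2 => _ [h _ <-]; have := cnormD (phi (translate h f)) (- alpha h (phi f)).
  rewrite cnormN cnorm_act; have := phi1 _ (Su f fS).
  by have := phi1 _ (unit_valued_translate h (Su f fS)); lra.
Qed.

Theorem rokhlin_approximation (L : seq A) (F : seq (fixalg alpha)) (e : R) :
  tracial_rokhlin_with_comparison alpha -> 0 < e ->
  exists (p : fixalg alpha) (Psi : {linear A -> A}),
  [/\ [/\ is_projection p, p != 0 & cuntz_sub (1 - p) p],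
      [/\ forall a, Psi (star a) = star (Psi a),
          forall a, cnorm (Psi a) <= 3 * cnorm a
        & cnorm (Psi 1 - fixval p) <= e],
      forall a b, a \in L -> b \in L -> cnorm (Psi a * Psi b - Psi (a * b)) <= e,
      forall a, a \in L -> exists b : fixalg alpha, cnorm (Psi a - fixval b) <= e
    & forall a c, a \in L -> c \in F ->
        cnorm (Psi a * fixval c - Psi (a * fixval c)) <= e].
Proof.
move=> trp e0.
pose M : R := 1 + \sum_(a <- L) cnorm a.
have sL0 : 0 <= \sum_(a <- L) cnorm a by apply: sumr_ge0 => a _; exact: cnorm_ge0.
have M1 : 1 <= M by rewrite /M; lra.
have LM a : a \in L -> cnorm a <= M.
  move=> aL; rewrite /M (big_rem a aL) /=.
  have : 0 <= \sum_(b <- rem a L) cnorm b.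
    by apply: sumr_ge0 => b _; exact: cnorm_ge0.
  lra.
have M0 : 0 < M by lra.
(* [d] is the oscillation allowed on each support; against elements of norm at most [M] it costs e /
   32. *)
pose d := e / (32 * M).
have dE : d * M = e / 32 by rewrite /d; field; exact: lt0r_neq0.
have d0 : 0 < d by rewrite divr_gt0// mulr_gt0.
have de : d <= e / 32 by nra.
have [m [gs [E [Eu sE Eloc]]]] := partition_of_unity alpha L cG d0.
pose m1 : R := m%:R + 1.
have mR0 : 0 <= m%:R :> R by exact: ler0n.
have m10 : 0 < m1 by rewrite /m1; lra.
(* Errors of size [t] are incurred in each of the [m] terms of Psi; the [+ 1] in [m1] avoids a
   division by zero. *)
pose t := d / m1.
have tE : t * m1 = d by rewrite /t divfK// gt_eqF.
have t0 : 0 < t by rewrite divr_gt0.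
have [s net] := translate_act_net gs L Eu t0.
pose S := [seq E k | k <- enum 'I_m] ++
  [seq translate h (E k) | h <- s, k <- enum 'I_m].
have ES k : E k \in S by rewrite mem_cat map_f ?mem_enum.
have TS h k : h \in s -> translate h (E k) \in S.
  by move=> hs; rewrite mem_cat orbC (allpairs_f (fun h k => translate h (E k)))// mem_enum.
have Su f : f \in S -> unit_valued f.
  rewrite mem_cat => /orP[/mapP[k _ ->]|/allpairsP[[h k] /= [_ _ ->]]] //.
  exact: unit_valued_translate.
pose LL := L ++ [seq a * b | a <- L, b <- L] ++
  [seq a * fixval c | a <- L, c <- F] ++ [seq fixval c | c <- F] ++ [:: 1].
(* All coefficients that phi must almost commute with: those of Psi, and those of its translates by
   the net. *)
pose FF := [seq alpha (gs k) a | k <- enum 'I_m, a <- LL] ++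
  flatten [seq [seq alpha (h * gs k)%g a | k <- enum 'I_m, a <- L] | h <- s].
have LF k a : a \in LL -> alpha (gs k) a \in FF.
  move=> aL; rewrite mem_cat (allpairs_f (fun k a => alpha (gs k) a))//.
  by rewrite mem_enum.
have TF h k a : h \in s -> a \in L -> alpha (h * gs k)%g a \in FF.
  move=> hs aL; rewrite mem_cat; apply/orP; right.
  apply/flattenP; exists [seq alpha (h * gs k)%g a | k <- enum 'I_m, a <- L].
    by apply/mapP; exists h.
  by rewrite (allpairs_f (fun k a => alpha (h * gs k)%g a))// mem_enum.
have LLL a : a \in L -> a \in LL by rewrite mem_cat => ->.
have LL2 a b : a \in L -> b \in L -> a * b \in LL.
  by move=> aL bL; rewrite !mem_cat (allpairs_f (fun a b => a * b))// orbT.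
have LF1 c : c \in F -> fixval c \in LL.
  by move=> cF; rewrite !mem_cat map_f// !orbT.
have [p [phi [pP cp mS cS tr]]] := rokhlin_sequence FF trp Su.
have pP' n : is_projection (fixval (p n)).
  by case: (pP n) => /projection_fixval.
pose c a k := alpha (gs k) a.
have mE k l : asy_mult phi (E k) (E l) by exact: mS.
have cE k l a : a \in LL -> asy_comm phi (E k) (c a l).
  by move=> aL; apply: cS => //; exact: LF.
have e32 : 0 < e / 32 by rewrite divr_gt0.
have near_eq k g a : E k g != 0 -> a \in L -> cnorm (alpha g a - c a k) <= d.
  by move=> Ek aL; apply/ltW/Eloc.
have near_eq2 k l g a : E k g != 0 -> E l g != 0 -> a \in L ->
    cnorm (c a k - c a l) <= 2 * d.
  move=> Ek El aL; have := cnorm_tri (alpha g a) (c a k) (c a l).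
  have := near_eq k g a Ek aL; have := near_eq l g a El aL.
  by rewrite [cnorm (c a k - alpha g a)]cnormB; lra.
have cM a b k : c (a * b) k = c a k * c b k by rewrite /c rmorphM.
have mul_near : \forall n \near \oo, forall a, a \in L -> forall b, b \in L ->
    cnorm (theta phi E (c a) n * theta phi E (c b) n - theta phi E (c (a * b)) n) <= e.
  apply: near_seq => a aL; apply: near_seq => b bL.
  have := theta_mul (a := c a) (b := c b) (ab := c (a * b)) (eta := 2 * (e / 32))
    pP' cp Eu sE mE (fun k l => cE k l a (LLL a aL))
    (fun k l => cE k l b (LLL b bL)) (fun k l => cE k l _ (LL2 a b aL bL)).
  move=> /(_ (e / 32)) h.
  have h0 : 0 <= 2 * (e / 32) by lra.
  have := h h0 e32; move=> {}h.
  apply: filterS (h _) => [n|k l g Ek El]; first lra.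
  rewrite cM -mulrBr; apply: le_trans (cnormM _ _) _.
  have := near_eq2 l k g b El Ek bL; rewrite cnorm_act.
  have := LM a aL; have := cnorm_ge0 a; have := cnorm_ge0 (c b l - c b k).
  by move: dE; nra.
have fix_near : \forall n \near \oo, forall a, a \in L -> forall x, x \in F ->
    cnorm (theta phi E (c a) n * fixval x - theta phi E (c (a * fixval x)) n) <= e.
  apply: near_seq => a aL; apply: near_seq => x xF.
  (* A fixed element has constant coefficients, so the module property only needs commutation with
     phi. *)
  have cx k : c (fixval x) k = fixval x.
    by case: x {xF} => x /= /asboolP; exact.
  have : asy (theta phi E (c a) * cst (fixval x)) (theta phi E (c (a * fixval x))).
    rewrite /theta mulr_suml; apply: asy_sum => k; rewrite cM cx.
    have -> : cst (c a k * fixval x) = cst (c a k) * cst (fixval x) :> (nat -> A) by [].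
    rewrite -!mulrA; apply: asyMl.
      by exists 1 => n; apply: (ucp_norm (pP' n) (cp n)) => //; exact: unit_valued_bounded.
    apply: asyMl; first exact: bdd_cst.
    by have := cE k k (fixval x) (LF1 x xF); rewrite /asy_comm cx.
  by move=> /(_ _ e0); apply: filterS => n; exact: ltW.
(* The bound 1 / 2 gives |sum phi (E k)^2| <= 3 / 2; with the factor 2 of [cnorm_sum_conj] this is
   the constant 3 in the norm of Psi. *)
have unit_near : \forall n \near \oo,
    cnorm (\sum_k phi n (E k) * phi n (E k) - fixval (p n)) <= Num.min e (1 / 2).
  have e2 : 0 < Num.min e (1 / 2) by rewrite lt_min e0 divr_gt0.
  have : asy (\sum_k (fun n => phi n (E k)) * (fun n => phi n (E k)))
      (\sum_k (fun n => phi n (E k * E k))).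
    by apply: asy_sum => k; exact: mE.
  move=> /(_ _ e2); apply: filterS => n; rewrite !fct_sumE => /ltW.
  by rewrite -linear_sum sE; case: (cp n) => _ ->.
have inv_near : \forall n \near \oo, forall a, a \in L -> forall h, h \in s ->
    cnorm (theta phi E (c a) n - theta phi (fun k => translate h (E k))
      (fun k => alpha (h * gs k)%g a) n) <= 5 * (e / 32).
  apply: near_seq => a aL; apply: near_seq => h hs.
  have sT : \sum_k translate h (E k) * translate h (E k) = 1.
    have := congr1 (translate h) sE.
    have trD : {morph @translate R G h : x y / x + y}.
      by move=> x y; apply: contCP.
    have tr0 : translate h (0 : contC R G) = 0 by apply: contCP.
    have tr1 : translate h (1 : contC R G) = 1 by apply: contCP.
    rewrite (big_morph _ trD tr0) tr1 => <-.
    by apply: eq_bigr => k _; apply: contCP.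
  have := @theta_compare R G A (fun n => fixval (p n)) phi pP' cp m m E
    (fun k => translate h (E k)) (c a) (fun k => alpha (h * gs k)%g a) (2 * d) (e / 32)
    Eu (fun k => unit_valued_translate h (Eu k)) sE sT.
  move=> H; have {}H := H (fun k => mE k k) (fun k => mS _ _ (TS h k hs) (TS h k hs)).
  have {}H := H (fun k l => mS _ _ (ES k) (TS h l hs)) (fun k l => mS _ _ (TS h l hs) (ES k)).
  have {}H := H (fun k l => cS _ _ (TS h l hs) (LF k a (LLL a aL))).
  have {}H := H (fun k l => cS _ _ (ES k) (TF h l a hs aL)).
  have h0 : 0 <= 2 * d by lra.
  have {}H := H h0 e32.
  apply: filterS (H _) => [n|k l g Ek El]; first by move: de; lra.
  (* Where the translate of [E l] is nonzero, [alpha (h^-1 * g) a] is near [alpha (gs l) a];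
     applying [alpha h] brings both coefficients close to [alpha g a]. *)
  have h1 := near_eq l (h^-1 * g)%g a El aL; move: h1; rewrite /c.
  rewrite -(cnorm_act alpha h) linearB /= -!actM mulVKg => h1.
  have := near_eq k g a Ek aL.
  have := cnorm_tri (alpha g a) (c a k) (alpha (h * gs l)%g a).
  rewrite [cnorm (c a k - alpha g a)]cnormB /c; lra.
have tr_near : \forall n \near \oo, forall k, forall g,
    cnorm (phi n (translate g (E k)) - alpha g (phi n (E k))) < t.
  apply: (@filter_forall _ _ (fun k => [set n | forall g,
    cnorm (phi n (translate g (E k)) - alpha g (phi n (E k))) < t]) \oo _) => k.
  exact: tr.
have [n [[nmul nfix] [[nunit ninv] ntr]]] := filter_ex (filterI
  (filterI mul_near fix_near) (filterI (filterI unit_near inv_near) tr_near)).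
have cpn := cp n; have pPn := pP' n.
pose psi a := \sum_k phi n (E k) * c a k * phi n (E k).
have psiE a : theta phi E (c a) n = psi a by rewrite /theta fct_sumE.
have lin : linear psi.
  move=> z a b; rewrite /psi scaler_sumr -big_split; apply: eq_bigr => k _ /=.
  by rewrite /c linearP mulrDr mulrDl -scalerAr -scalerAl.
pose Psi : {linear A -> A} := HB.pack psi (GRing.isLinear.Build R[i] A A *:%R psi lin).
have Eb k : bounded_by 1 (E k) by exact: unit_valued_bounded.
have Es k : star (phi n (E k)) = phi n (E k) by exact: (ucp_star pPn cpn (Eb k)).
have E1 k : cnorm (phi n (E k)) <= 1 by exact: (ucp_norm pPn cpn (Eb k)).
exists (p n), Psi; split.
- exact: pP.
- split=> [a|a|].
  + change (psi (star a) = star (psi a)).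
    rewrite /psi star_sum; apply: eq_bigr => k _.
    by rewrite !starM Es /c act_star mulrA.
  + change (cnorm (psi a) <= 3 * cnorm a).
    rewrite /psi -(eq_bigr _ (fun k _ => congr1 (fun x => x * _ * _) (Es k))).
    apply: le_trans (cnorm_sum_conj (M := cnorm a) _ _ (cnorm_ge0 a)) _.
      by move=> k; rewrite cnorm_act.
    rewrite (eq_bigr (fun k => phi n (E k) * phi n (E k))) => [|k _]; last by rewrite Es.
    move: nunit; rewrite le_min => /andP[_].
    have := projection_le1 pPn; set y := \sum_k _.
    have := cnormD (y - fixval (p n)) (fixval (p n)); rewrite subrK.
    have := cnorm_ge0 a; nra.
  + change (cnorm (psi 1 - fixval (p n)) <= e).
    rewrite /psi (eq_bigr (fun k => phi n (E k) * phi n (E k))) => [|k _]; last first.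
      by rewrite /c rmorph1 mulr1.
    by move: nunit; rewrite le_min => /andP[].
- move=> a b aL bL; change (cnorm (psi a * psi b - psi (a * b)) <= e).
  by rewrite -!psiE; exact: nmul.
- move=> a aL; have e2 : 0 < e / 2 by rewrite divr_gt0.
  (* Two errors of 5 e / 32 stay below e / 2, and [fixed_near] doubles the bound. *)
  suff inv g : cnorm (alpha g (psi a) - psi a) <= e / 2.
    have [b ab] := fixed_near cG e2 inv; exists b.
    by apply: le_trans ab _; lra.
  have [h hs gh] := net g.
  have h1 := ninv a aL h hs; rewrite psiE in h1.
  set y := theta _ _ _ n in h1.
  have := cnorm_tri y (alpha g (psi a)) (psi a); rewrite [cnorm (y - _)]cnormB.
  suff : cnorm (alpha g (psi a) - y) <= 5 * (e / 32) by move: h1; lra.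
  rewrite /y /theta fct_sumE /psi linear_sum -sumrB.
  apply: le_trans (cnorm_sum _ _ _) _.
  have bound k : cnorm (alpha g (phi n (E k) * c a k * phi n (E k)) -
      phi n (translate h (E k)) * alpha (h * gs k)%g a * phi n (translate h (E k)))
      <= 5 * (M * t).
    have actM3 u v w : alpha g (u * v * w) = alpha g u * alpha g v * alpha g w.
      by rewrite !rmorphM.
    rewrite actM3 /c -actM; have [gh1 gh2] := gh k.
    set x := alpha g (phi n (E k)); set x' := phi n (translate h (E k)).
    set z := alpha (g * gs k)%g a; set z' := alpha (h * gs k)%g a.
    (* One [t] is the defect of equivariance of phi, the other the distance between the translates
       by [g] and by the net point [h]. *)
    have xx : cnorm (x - x') <= 2 * t.
      have := cnorm_tri (phi n (translate g (E k))) x x'.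
      rewrite [cnorm (x - phi n (translate g (E k)))]cnormB.
      have := ntr k g; rewrite -/x.
      have := ucp_norm pPn cpn gh1 (ltW t0); rewrite linearB -/x'; lra.
    have x1 : cnorm x <= 1 by rewrite cnorm_act.
    have x1' : cnorm x' <= 1.
      by apply: (ucp_norm pPn cpn) => //; exact/unit_valued_bounded/unit_valued_translate.
    have zM : cnorm z <= M by rewrite cnorm_act LM.
    have zM' : cnorm z' <= M by rewrite cnorm_act LM.
    have zz : cnorm (z - z') <= t by apply/ltW/gh2.
    rewrite (_ : x * z * x - _ = (x - x') * z * x + x' * (z - z') * x + x' * z' * (x - x'));
      last by ncring.
    have := cnormD ((x - x') * z * x + x' * (z - z') * x) (x' * z' * (x - x')).
    have := cnormD ((x - x') * z * x) (x' * (z - z') * x).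
    have := cnormM_le (cnormM_le xx zM) x1; have := cnormM_le (cnormM_le x1' zz) x1.
    have := cnormM_le (cnormM_le x1' zM') xx.
    have : t <= M * t by rewrite ler_peMl// ltW.
    lra.
  apply: le_trans (ler_sum _ (fun k _ => bound k)) _.
  rewrite sumr_const card_ord -mulr_natr.
  have : M * t * m%:R <= d * M.
    have mt0 : 0 <= M * t by rewrite mulr_ge0// ltW.
    by rewrite -tE /m1; lra.
  rewrite dE; lra.
- move=> a x aL xF.
  change (cnorm (psi a * fixval x - psi (a * fixval x)) <= e).
  by rewrite -!psiE; exact: nfix.
Qed.

End Approximation.

(** * Simplicity and separability of the fixed point algebra *)

Section ClosedIdeals.
Context {R : realType}.
Implicit Types A : cstarAlgType R.

Lemma cnorm_closedP A (S : set A) :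
  closed S <-> forall x, (forall e, 0 < e -> exists2 y, S y & cnorm (x - y) < e) -> S x.
Proof.
split=> [cS x xS|h x xS].
  apply: cS => U /cnorm_nbhs[e e0 eU]; have [y Sy xy] := xS e e0.
  by exists y; split => //; exact: eU.
apply: h => e e0; have [|y [Sy xy]] := xS [set y | cnorm (x - y) < e].
  by apply/cnorm_nbhs; exists e.
by exists y.
Qed.

Lemma simple_full A (y : A) (e : R) : is_simple A -> y != 0 -> 0 < e ->
  exists s : seq (A * A), cnorm (1 - \sum_(ab <- s) ab.1 * y * ab.2) < e.
Proof.
move=> simA y0 e0.
pose I : set A := [set x | forall e, 0 < e ->
  exists s : seq (A * A), cnorm (x - \sum_(ab <- s) ab.1 * y * ab.2) < e].
have IM a b x : I x -> I (a * x * b).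
  move=> Ix d d0; have M0 : 0 < cnorm a * cnorm b + 1.
    have := mulr_ge0 (cnorm_ge0 a) (cnorm_ge0 b); lra.
  have [s hs] := Ix _ (divr_gt0 d0 M0).
  exists [seq (a * ab.1, ab.2 * b) | ab <- s]; rewrite big_map /=.
  have -> : \sum_(j <- s) a * j.1 * y * (j.2 * b) =
      a * (\sum_(ab <- s) ab.1 * y * ab.2) * b.
    by rewrite mulr_sumr mulr_suml; apply: eq_bigr => j _; ncring.
  rewrite -mulrBl -mulrBr; apply: le_lt_trans (cnormM _ _) _.
  have := cnormM a (x - \sum_(ab <- s) ab.1 * y * ab.2).
  move: hs; rewrite ltr_pdivlMr//.
  set u := cnorm (x - _); have u0 : 0 <= u by exact: cnorm_ge0.
  have := cnorm_ge0 a; have := cnorm_ge0 b; nra.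
have clI : closed_ideal I.
  split.
  - apply/cnorm_closedP => x h d d0; have d2 : 0 < d / 2 by rewrite divr_gt0.
    have [z Iz xz] := h _ d2; have [s zs] := Iz _ d2; exists s.
    by have := cnorm_tri z x (\sum_(ab <- s) ab.1 * y * ab.2); lra.
  - by move=> d d0; exists [::]; rewrite big_nil subrr cnorm0.
  - move=> x z Ix Iz d d0; have d2 : 0 < d / 2 by rewrite divr_gt0.
    have [s xs] := Ix _ d2; have [t zt] := Iz _ d2; exists (s ++ t).
    rewrite big_cat /=; set u := \sum_(i <- s) _; set v := \sum_(i <- t) _.
    rewrite (_ : x + z - _ = (x - u) + (z - v)); last by ncring.
    by have := cnormD (x - u) (z - v); lra.
  - move=> c x Ix; have -> : c *: x = c%:A * x * 1 by rewrite mulr1 mulr_algl.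
    exact: IM.
  - by move=> a x Ix; split; [rewrite -[a * x]mulr1|rewrite -[x]mul1r]; exact: IM.
have Iy : I y.
  by move=> d d0; exists [:: (1, 1)]; rewrite big_seq1 /= mul1r mulr1 subrr cnorm0.
case: (simA I clI) => IE; last first.
  have I1 : I 1 by rewrite IE.
  exact: I1.
by move: Iy y0; rewrite IE /= => ->; rewrite eqxx.
Qed.

(** A Neumann series inside the corner of p: x = p - p z p has norm less than one, each p - x^(n+1)
    lies in [I], and these tend to p. *)
Lemma projection_in_ideal A (I : set A) (p z : A) : closed_ideal I ->
  is_projection p -> I z -> cnorm (p - z) < 1 -> I p.
Proof.
move=> [clI I0 ID IZ IM] [pp ps] Iz pz1.
have IN x : I x -> I (- x) by move=> Ix; rewrite -scaleN1r; exact: IZ.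
pose x := p - p * z * p.
have px : p * x = x by rewrite /x mulrBr !mulrA pp.
have Ipx : I (p - x).
  by rewrite /x opprB addrC subrK; apply: (IM _ _ _).2; apply: (IM _ _ _).1.
have Ipow n : I (p - x ^+ n.+1).
  elim: n => [|n ih]; first by rewrite expr1.
  have -> : p - x ^+ n.+2 = (p - x ^+ n.+1) * x + (p - x).
    by rewrite mulrBl px -exprSr; ncring.
  by apply: ID => //; exact: (IM _ _ ih).2.
have xn n : cnorm (x ^+ n.+1) <= cnorm (p - z) ^+ n.+1.
  have x1 : cnorm x <= cnorm (p - z).
    have -> : x = p * (p - z) * p by rewrite /x mulrBr mulrBl pp pp.
    have := projection_le1 (conj pp ps); have := cnormM (p * (p - z)) p.
    have := cnormM p (p - z); have := cnorm_ge0 p; have := cnorm_ge0 (p - z).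
    have := cnorm_ge0 (p * (p - z)); nra.
  elim: n => [|n ih]; first by rewrite !expr1.
  rewrite exprS [leRHS]exprS; apply: le_trans (cnormM _ _) _.
  by apply: ler_pM => //; exact: cnorm_ge0.
move/cnorm_closedP: clI; apply => e e0.
have [N hN] := expr_small (cnorm_ge0 _) pz1 e0.
exists (p - x ^+ N.+1) => //; rewrite opprB addrC subrK.
by apply: le_lt_trans (xn N) _; exact: hN.
Qed.

Lemma cuntz_sub_in_ideal A (I : set A) (a b : A) : closed_ideal I ->
  cuntz_sub a b -> I b -> I a.
Proof.
move=> [clI I0 ID IZ IM] ab Ib; move/cnorm_closedP: clI; apply => e e0.
have [v [w vw]] := cuntz_sub_approx ab e0.
exists (v * b * w); last by rewrite cnormB.
by apply: (IM _ _ _).2; apply: (IM _ _ _).1.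
Qed.

End ClosedIdeals.

Section FixedPointAlgebra.
Context {R : realType} {G : topGroupType} {A : cstarAlgType R}.
Variable alpha : cstar_action G A.
Hypothesis cG : compact [set: G].

Lemma cnorm_fixval (x : fixalg alpha) : cnorm x = cnorm (fixval x).
Proof. by []. Qed.

Lemma fixalg_simple : is_simple A -> tracial_rokhlin_with_comparison alpha ->
  is_simple (fixalg alpha).
Proof.
move=> simA trp I cI; have [clI I0 ID IZ IM] := cI.
have [[y Iy y0]|no] := pselect (exists2 y, I y & y != 0); last first.
  left; apply/seteqP; split=> [x Ix|x /= ->//].
  by apply: contrapT => /eqP x0; apply: no; exists x.
right.
have y0' : fixval y != 0.
  by apply: contra_neq y0 => yE; apply: val_inj.
(* Since |Psi| <= 3 this costs 1 / 2 after applying Psi; the two other errors will be at most 1 / 8,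
   so that p is within less than 1 of the ideal. *)
have [|s sE] := simple_full (e := 1 / 6) simA y0'; first by rewrite divr_gt0.
pose K : R := 1 + cnorm (fixval y) + \sum_(ab <- s) (cnorm ab.1 + cnorm ab.2).
have s0 : 0 <= \sum_(ab <- s) (cnorm ab.1 + cnorm ab.2).
  by apply: sumr_ge0 => ab _; rewrite addr_ge0 ?cnorm_ge0.
have K1 : 1 <= K by rewrite /K; have := cnorm_ge0 (fixval y); lra.
have yK : cnorm (fixval y) <= K by rewrite /K; lra.
have sK ab : ab \in s -> cnorm ab.1 <= K /\ cnorm ab.2 <= K.
  move=> abs; rewrite /K (big_rem ab abs) /=.
  have : 0 <= \sum_(ab <- rem ab s) (cnorm ab.1 + cnorm ab.2).
    by apply: sumr_ge0 => i _; rewrite addr_ge0 ?cnorm_ge0.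
  have := cnorm_ge0 ab.1; have := cnorm_ge0 ab.2.
  have := cnorm_ge0 (fixval y); split; lra.
pose N : R := (size s)%:R; have N0 : 0 <= N by exact: ler0n.
(* Each of the N terms costs at most 11 K^2 e, and 88 = 8 * 11 brings their total below 1 / 8. *)
pose e : R := (88 * K ^+ 2 * (N + 1))^-1.
have K2 : 1 <= K ^+ 2 by rewrite expr2; nra.
have den0 : 0 < 88 * K ^+ 2 * (N + 1) by rewrite !mulr_gt0//; lra.
have e0 : 0 < e by rewrite invr_gt0.
have eE : e * (88 * K ^+ 2 * (N + 1)) = 1 by rewrite mulVf// gt_eqF.
have e8 : e <= 1 / 8.
  suff : 8 * 1 <= 88 * K ^+ 2 * (N + 1) by nra.
  nra.
pose L := [seq ab.1 | ab <- s] ++ [seq ab.2 | ab <- s] ++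
  [seq ab.1 * fixval y | ab <- s].
have [p [Psi [[pP _ cp] [_ Psi3 Psi1] PsiM PsiL PsiF]]] :=
  rokhlin_approximation cG L [:: y] trp e0.
have /choice[r rE] : forall a, exists b : fixalg alpha,
    a \in L -> cnorm (Psi a - fixval b) <= e.
  move=> a; have [aL|aL] := boolP (a \in L); last by exists 0.
  by have [b ab] := PsiL a aL; exists b.
pose z : fixalg alpha := \sum_(ab <- s) r ab.1 * y * r ab.2.
have Iz : I z.
  rewrite /z; elim/big_ind: _ => // ab _.
  by apply: (IM _ _ _).2; apply: (IM _ _ _).1.
have fixD : {morph (@fixval _ _ _ alpha) : x y / x + y} by [].
have zE : fixval z = \sum_(ab <- s) fixval (r ab.1) * fixval y * fixval (r ab.2).
  by rewrite /z (big_morph _ fixD erefl).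
have term ab : ab \in s ->
    cnorm (Psi (ab.1 * fixval y * ab.2) -
      fixval (r ab.1) * fixval y * fixval (r ab.2)) <= 11 * K ^+ 2 * e.
  move=> abs; have [a1 b1] := sK ab abs; case: ab abs a1 b1 => a b /= abs aK bK.
  have aL : a \in L by rewrite mem_cat; apply/orP; left; apply/mapP; exists (a, b).
  have bL : b \in L.
    by rewrite !mem_cat; apply/orP; right; apply/orP; left; apply/mapP; exists (a, b).
  have ayL : a * fixval y \in L.
    by rewrite !mem_cat; apply/orP; right; apply/orP; right; apply/mapP; exists (a, b).
  have h1 := PsiM _ _ ayL bL.
  have h2 := PsiF a y aL (mem_head _ _).
  have h3 := rE a aL; have h4 := rE b bL.
  set u := Psi a in h2 h3; set v := Psi b in h1 h4; set w := Psi (a * fixval y) in h1 h2.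
  set f := fixval y in yK h1 h2 *; set u' := fixval (r a) in h3 *; set v' := fixval (r b) in h4 *.
  set q := Psi (a * f * b) in h1 *.
  (* The four differences cost e, 3 K e, 3 K^2 e and 4 K^2 e, at most 11 K^2 e together. *)
  have -> : q - u' * f * v' = - (w * v - q) - (u * f - w) * v + (u - u') * f * v + u' * f * (v - v').
    by ncring.
  have vK : cnorm v <= 3 * K by have := Psi3 b; rewrite -/v; lra.
  have uK : cnorm u' <= 4 * K.
    have := cnormD (u' - u) u; rewrite subrK cnormB; have := Psi3 a; rewrite -/u; lra.
  have := cnormD (- (w * v - q) - (u * f - w) * v + (u - u') * f * v) (u' * f * (v - v')).
  have := cnormD (- (w * v - q) - (u * f - w) * v) ((u - u') * f * v).
  have := cnormD (- (w * v - q)) (- ((u * f - w) * v)); rewrite !cnormN.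
  have := cnormM_le h2 vK.
  have := cnormM_le (cnormM_le h3 yK) vK.
  have := cnormM_le (cnormM_le uK yK) h4.
  have : e <= K * e by rewrite ler_peMl// ltW.
  have : K * e <= K ^+ 2 * e by rewrite expr2 -mulrA ler_peMl// mulr_ge0; lra.
  move: h1; lra.
have Ip : I p.
  apply: (projection_in_ideal cI pP Iz); rewrite cnorm_fixval.
  change (cnorm (fixval p - fixval z) < 1).
  set t := \sum_(ab <- s) ab.1 * fixval y * ab.2 in sE.
  have h1 : cnorm (Psi 1 - Psi t) <= 3 * (1 / 6).
    by rewrite -linearB; apply: le_trans (Psi3 _) _; lra.
  have h2 : cnorm (Psi t - fixval z) <= N * (11 * K ^+ 2 * e).
    rewrite zE /t linear_sum -sumrB; apply: le_trans (cnorm_sum _ _ _) _.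
    rewrite big_seq_cond; apply: le_trans (ler_sum _ (_ : forall ab, _ -> _ <= 11 * K ^+ 2 * e)) _.
      by move=> ab; rewrite andbT; exact: term.
    rewrite -big_seq_cond big_const_seq (_ : count _ s = size s); last exact: count_predT.
    by rewrite iter_addr addr0 -[leLHS]mulr_natl.
  have h3 : N * (11 * K ^+ 2 * e) <= 1 / 8.
    have : 0 <= K ^+ 2 * e by rewrite mulr_ge0//; lra.
    by move: eE; lra.
  have := cnorm_tri (Psi 1) (fixval p) (fixval z).
  have := cnorm_tri (Psi t) (Psi 1) (fixval z).
  by rewrite [cnorm (fixval p - Psi 1)]cnormB; lra.
have I1 : I 1 by rewrite -[1](subrK p); apply: ID => //; exact: cuntz_sub_in_ideal cp Ip.
apply/seteqP; split=> // x _; rewrite -[x]mulr1; exact: (IM _ _ I1).1.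
Qed.

(** A dense sequence need not meet the subalgebra: for every s in the dense set and every n, a fixed
    element within 1 / (n + 1) of s is chosen whenever there is one. *)
Lemma fixalg_separable : separable A -> separable (fixalg alpha).
Proof.
move=> [S cS dS].
have close (x : A) e : 0 < e -> exists2 s, S s & cnorm (x - s) < e.
  move=> e0; pose U := [set y | cnorm (x - y) < e].
  have nU : nbhs x U by apply/cnorm_nbhs; exists e.
  have [|y [Uy Sy]] := dS (U^°)%classic _ (@open_interior _ U).
    by exists x; exact: nU.
  by exists y => //; exact: (interior_subset Uy).
have /choice[f fE] : forall sn : A * nat, exists y : fixalg alpha,
    (exists z : fixalg alpha, cnorm (fixval z - sn.1) < sn.2.+1%:R^-1) ->
    cnorm (fixval y - sn.1) < sn.2.+1%:R^-1.
  move=> [s n]; have [[z zs]|no] :=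
    pselect (exists z : fixalg alpha, cnorm (fixval z - s) < n.+1%:R^-1).
    by exists z.
  by exists 0 => zs; case: no.
exists (f @` (S `*` [set: nat])).
  apply: (@sub_countable _ _ _ (S `*` [set: nat])); first exact: card_image_le.
  exact: countableX.
move=> O [x Ox] oO.
have /cnorm_nbhs[e e0 eO] : nbhs x O by exact: open_nbhs_nbhs.
have e2 : 0 < e / 2 by rewrite divr_gt0.
have [N _ /(_ N (leqnn _)) /= Ne] := near_infty_natSinv_lt (PosNum e2).
have [s Ss xs] : exists2 s, S s & cnorm (fixval x - s) < N.+1%:R^-1.
  by apply: close; rewrite invr_gt0 ltr0n.
exists (f (s, N)); split; last by exists (s, N).
apply: eO; rewrite cnorm_fixval; change (cnorm (fixval x - fixval (f (s, N))) < e).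
have fs : cnorm (fixval (f (s, N)) - s) < N.+1%:R^-1.
  exact: (fE (s, N) (ex_intro _ x xs)).
have {}Ne : N.+1%:R^-1 < e / 2 := Ne.
have := cnorm_tri s (fixval x) (fixval (f (s, N))).
rewrite [cnorm (s - _)]cnormB => /le_lt_trans; apply.
rewrite [ltRHS](_ : _ = e / 2 + e / 2); last by lra.
by apply: ltrD; [exact: lt_trans xs Ne|exact: lt_trans fs Ne].
Qed.

End FixedPointAlgebra.

(** * The separability idempotent of a finite dimensional C*-algebra *)

Lemma linear_comb (K : pzRingType) (U V : lmodType K) (f : U -> V) : linear f ->
  forall I (r : seq I) (c : I -> K) (x : I -> U),
    f (\sum_(i <- r) c i *: x i) = \sum_(i <- r) c i *: f (x i).
Proof.
move=> lf I r c x; pose F : {linear U -> V} :=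
  HB.pack f (GRing.isLinear.Build K U V *:%R f lf).
change (F (\sum_(i <- r) c i *: x i) = \sum_(i <- r) c i *: F (x i)).
by rewrite linear_sum; apply: eq_bigr => i _; rewrite linearZ.
Qed.

(** In a rank factorization A = C B, idempotence forces B C to be the identity of size rank A, and B
    C has the trace of A. *)
Lemma mxtrace_idempotent (K : fieldType) n (A : 'M[K]_n) :
  A *m A = A -> \tr A = (\rank A)%:R.
Proof.
move=> AA; pose C := col_base A; pose B := row_base A.
have CB : C *m B = A := mulmx_base A.
have BC : B *m C = 1%:M.
  have e : C *m (B *m C) *m B = C *m B.
    by rewrite (mulmxA C B C) -(mulmxA (C *m B) C B) CB.
  have /row_full_inj := col_base_full A; apply.
  have /row_free_inj := row_base_free A; apply.
  by rewrite e mulmx1.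
have <- : \tr (B *m C) = (\rank A)%:R by rewrite BC mxtrace1.
by rewrite mxtrace_mulC CB.
Qed.

Section FiniteDimensional.
Context {R : realType}.
Variable B : cstarAlgType R.
Local Notation K := R[i].

(** Raise the exponent to 2^n, then halve it repeatedly: powers of [u] are self-adjoint, and a
    self-adjoint element of square zero vanishes. *)
Lemma selfadjoint_nilpotent (u : B) n : star u = u -> u ^+ n = 0 -> u = 0.
Proof.
move=> su un; have : u ^+ (2 ^ n) = 0.
  by rewrite -(subnK (ltnW (ltn_expl n (ltnSn 1)))) exprD un mulr0.
elim: n {un} => [|n ih]; first by rewrite expr1.
rewrite expnS mulnC exprM expr2 => /selfadjoint_sqr0 h; apply/ih/h.
by elim: (2 ^ n)%N => [|m ihm]; rewrite ?expr0 ?star1// {1}exprS starM ihm su -exprSr.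
Qed.

Definition basis n (b : 'I_n -> B) (coord : 'I_n -> B -> K) : Prop :=
  (forall x, x = \sum_i coord i x *: b i) /\
  (forall c : 'I_n -> K, forall i, coord i (\sum_j c j *: b j) = c i).

(** A spanning family of least length is free, since a linear relation would allow one member to be
    discarded. *)
Lemma finite_dimensional_basis : finite_dimensional B ->
  exists n (b : 'I_n -> B) (coord : 'I_n -> B -> K), basis b coord.
Proof.
pose span n (b : 'I_n -> B) := forall a : B, exists c : 'I_n -> K, a = \sum_i c i *: b i.
move=> [n0 [e0 e0P]].
have ex : exists n, `[< exists b : 'I_n -> B, span n b >].
  by exists n0; apply/asboolP; exists e0.
case: (ex_minnP ex) => n /asboolP[b bP] nmin.
have free (c : 'I_n -> K) : \sum_i c i *: b i = 0 -> forall i, c i = 0.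
  move=> c0 i; apply: contrapT => /eqP ci.
  case: n b bP nmin c c0 i ci => [|n] b bP nmin c c0 i ci; first by case: i ci.
  suff : (n.+1 <= n)%N by rewrite ltnn.
  apply: nmin; apply/asboolP; exists (fun j => b (lift i j)) => a.
  have [d ->] := bP a; exists (fun j => d (lift i j) - d i / c i * c (lift i j)).
  have bi : b i = - \sum_(j < n) (c (lift i j) / c i) *: b (lift i j).
    have := c0; rewrite (bigD1_ord i)//= => /eqP; rewrite addr_eq0 => /eqP bi.
    rewrite -[LHS]scale1r -(mulVf ci) -scalerA bi scalerN scaler_sumr.
    by congr (- _); apply: eq_bigr => j _; rewrite scalerA mulrC.
  rewrite (bigD1_ord i)//= bi scalerN scaler_sumr -sumrN -big_split /=.
  apply: eq_bigr => j _; rewrite scalerA scalerBl addrC; congr (_ - _ *: _).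
  by rewrite mulrA mulrAC.
have /choice[coord cE] := bP.
exists n, b, (fun i x => coord x i); split=> [x|c i]; first exact: cE.
apply/eqP; rewrite -subr_eq0; apply/eqP.
apply: (free (fun i => coord (\sum_j c j *: b j) i - c i)).
by under eq_bigr do rewrite scalerBl; rewrite sumrB -cE subrr.
Qed.

Section TraceForm.
Variables (n : nat) (b : 'I_n -> B) (coord : 'I_n -> B -> K).
Hypothesis bP : basis b coord.

Lemma coord_linear i : linear (coord i).
Proof.
move=> c x y; rewrite [in LHS](bP.1 x) [in LHS](bP.1 y) scaler_sumr -big_split /=.
under eq_bigr do rewrite scalerA -scalerDl.
exact: (bP.2 (fun k => c * coord k x + coord k y)).
Qed.

Lemma coord0 i : coord i 0 = 0.
Proof.
by have := bP.2 (fun=> 0) i; under eq_bigr do rewrite scale0r; rewrite big1.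
Qed.

Lemma coord_inj x y : (forall i, coord i x = coord i y) -> x = y.
Proof. by move=> xy; rewrite (bP.1 x) (bP.1 y); apply: eq_bigr => i _; rewrite xy. Qed.

(** Left multiplication by x acting on row vectors, which reverses products ([regmxM]). *)
Definition regmx (x : B) : 'M[K]_n := \matrix_(i, j) coord j (x * b i).
Definition coordrow (x : B) : 'rV[K]_n := \row_j coord j x.

Lemma coordrowM x y : coordrow (x * y) = coordrow y *m regmx x.
Proof.
apply/rowP => j; rewrite !mxE [in LHS](bP.1 y) mulr_sumr.
under eq_bigr do rewrite -scalerAr.
rewrite (linear_comb (coord_linear j)); apply: eq_bigr => k _.
by rewrite !mxE.
Qed.

Lemma coordrow_eq0 x : coordrow x = 0 -> x = 0.
Proof.
move=> x0; rewrite (bP.1 x) big1// => i _.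
by move/rowP: x0 => /(_ i); rewrite !mxE => ->; rewrite scale0r.
Qed.

Lemma regmxM x y : regmx (x * y) = regmx y *m regmx x.
Proof.
apply/row_matrixP => i; rewrite row_mul.
have rowE z : row i (regmx z) = coordrow (z * b i).
  by apply/rowP => j; rewrite !mxE.
by rewrite !rowE -mulrA coordrowM.
Qed.

Lemma regmx_eq0 x : regmx x = 0 -> x = 0.
Proof.
by move=> x0; apply: coordrow_eq0; rewrite -[x]mulr1 coordrowM x0 mulmx0.
Qed.

Definition tau (x : B) : K := \tr (regmx x).

Lemma tauE x : tau x = \sum_i coord i (x * b i).
Proof. by apply: eq_bigr => i _; rewrite mxE. Qed.

Lemma tau_linear : linear (tau : B -> K^o).
Proof.
move=> c x y; rewrite !tauE scaler_sumr -big_split /=; apply: eq_bigr => i _.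
by rewrite mulrDl -scalerAl coord_linear.
Qed.

Lemma tauB x y : tau (x - y) = tau x - tau y.
Proof.
have h := tau_linear (-1) y x; rewrite !scaleN1r in h.
by rewrite addrC h addrC.
Qed.

Lemma tauC x y : tau (x * y) = tau (y * x).
Proof. by rewrite /tau !regmxM mxtrace_mulC. Qed.

(* h ^ k = h ^ (k + 1) r with r commuting with h, by linear dependence of the
   powers of h; as h is self-adjoint this forces h = h^2 r, so that h r is an
   idempotent. *)
Lemma regular_selfadjoint (h : B) : star h = h ->
  exists r, [/\ star r = r, r * h = h * r & h = h * h * r].
Proof.
move=> sh.
pose P : 'M[K]_(n.+1, n) := \matrix_(i, j) coord j (h ^+ i).
have : kermx P != 0.
  apply/eqP => k0; have : row_free P by rewrite -kermx_eq0 k0.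
  by rewrite /row_free => /eqP rP; have := rank_leq_col P; rewrite rP ltnn.
move=> /rowV0Pn[v /sub_kermxP vP v0].
have dep : \sum_i v 0 i *: h ^+ i = 0.
  apply: coord_inj => j; rewrite (linear_comb (coord_linear j)).
  rewrite coord0; move/rowP: vP => /(_ j); rewrite !mxE => vPj.
  rewrite -[RHS]vPj; apply: eq_bigr => i _.
  by rewrite mxE.
have [i0 vi0] : exists i, v 0 i != 0.
  apply: contrapT => nv; case/eqP: v0; apply/rowP => i; rewrite mxE.
  by apply: contrapT => /eqP vi; apply: nv; exists i.
(* [k] is the lowest power that occurs in the dependence; dividing by its coefficient expresses h^k
   through higher powers. *)
have [k vk kmin] := @arg_minnP _ i0 (fun i => v 0 i != 0) (fun i : 'I_n.+1 => i : nat) vi0.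
pose r0 := - \sum_(i < n.+1 | (k < i)%N) (v 0 i / v 0 k) *: h ^+ (i - k.+1).
have hr0 : r0 * h = h * r0.
  rewrite /r0 mulNr mulrN mulr_suml mulr_sumr; congr (- _); apply: eq_bigr => i _.
  by rewrite -scalerAl -scalerAr -exprS -exprSr.
have hk : h ^+ k = h ^+ k.+1 * r0.
  have := dep; rewrite (bigID (fun i : 'I_n.+1 => (k < i)%N)) /=.
  rewrite [X in _ + X](bigD1 k) ?ltnn//= [X in _ + (_ + X)]big1 => [|i].
    rewrite addr0 addrC => /eqP; rewrite addr_eq0 => /eqP vkE.
    rewrite -[LHS]scale1r -(mulVf vk) -scalerA vkE /r0 scalerN mulrN mulr_sumr.
    rewrite scaler_sumr; congr (- _); apply: eq_bigr => i ki.
    by rewrite scalerA -scalerAr -exprD subnKC// mulrC.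
  move=> /andP[]; rewrite -leqNgt => ik ink.
  suff -> : v 0 i = 0 by rewrite scale0r.
  apply: contrapT => /eqP vi; have := kmin i vi => ki.
  by case/eqP: ink; apply/val_inj/eqP; rewrite eqn_leq ik.
(* Both [r0] and its adjoint solve h^k = h^(k+1) r, hence so does their self-adjoint mean. *)
pose r := 2^-1 *: (r0 + star r0).
have hr0s : star r0 * h = h * star r0.
  by rewrite -[in LHS]sh -starM -hr0 starM sh.
have sp m : star (h ^+ m) = h ^+ m.
  by elim: m => [|m ih]; rewrite ?star1// {1}exprS starM ih sh -exprSr.
have hrm x m : x * h = h * x -> x * h ^+ m = h ^+ m * x.
  by move=> xh; elim: m => [|m ih]; rewrite ?mulr1 ?mul1r// exprS mulrA xh -mulrA ih mulrA.
have hks : h ^+ k = h ^+ k.+1 * star r0.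
  by rewrite -(hrm _ _ hr0s) -(sp k.+1) -starM -hk sp.
have rh : r * h = h * r.
  by rewrite /r -scalerAl -scalerAr mulrDl mulrDr hr0 hr0s.
have sr : star r = r by rewrite star_half starD starK addrC.
have hkr : h ^+ k = h ^+ k.+1 * r.
  by rewrite /r -scalerAr mulrDr -hk -hks scale_halfD.
exists r; split => //.
pose w := 1 - h * r; pose u := h * w.
have wh : w * h = h * w by rewrite /w mulrBl mulrBr -mulrA rh mul1r mulr1.
(* u = h - h^2 r is self-adjoint, and nilpotent because h^k annihilates w; so it vanishes. *)
have su : star u = u by rewrite starM /w starB star1 starM sr sh rh -/w wh.
have hkw : h ^+ k * w = 0 by rewrite /w mulrBr mulr1 mulrA -exprSr -hkr subrr.
have uk : u ^+ k.+1 = 0.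
  rewrite exprMn_comm; last by rewrite /GRing.comm wh.
  by rewrite exprSr (exprS w) -mulrA (mulrA h) -wh -!mulrA mulrA hkw mul0r.
have := selfadjoint_nilpotent su uk; rewrite /u /w mulrBr mulr1 mulrA => /eqP.
by rewrite subr_eq0 => /eqP.
Qed.

(** With h = x^* x also in the radical, the idempotent e = h r has trace tau e = 0, which is its
    rank in characteristic zero. So e = 0, h = h e = 0 and x = 0. *)
Lemma tau_nondegenerate x : (forall y, tau (x * y) = 0) -> x = 0.
Proof.
move=> tx; pose h := star x * x.
have th y : tau (h * y) = 0 by rewrite /h -mulrA tauC -mulrA.
have sh : star h = h by rewrite starM starK.
have [r [sr rh hE]] := regular_selfadjoint sh.
pose e := h * r.
have ee : e * e = e by rewrite /e -(mulrA h r) (mulrA r h r) rh (mulrA h (h * r)) (mulrA h h r) -hE.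
have e0 : e = 0.
  apply: regmx_eq0; apply/eqP; rewrite -mxrank_eq0 -(pnatr_eq0 K).
  by rewrite -mxtrace_idempotent -?regmxM ?ee// -/(tau e) th.
have h0 : h = 0 by rewrite hE -(mulrA h h r) -/e e0 mulr0.
apply: cnorm_eq0; apply/eqP; rewrite -sqrf_eq0 -cnormE -/h h0.
by rewrite cnorm0.
Qed.

Definition gram : 'M[K]_n := \matrix_(i, j) tau (b i * b j).
(** The dual family of [b] for the form tau (x y). By [dual_unit] and [dual_balanced], the sum of
    b_i (x) dual_i is a separability idempotent. *)
Definition dual (j : 'I_n) : B := \sum_k invmx gram k j *: b k.

Lemma gram_unit : gram \in unitmx.
Proof.
rewrite -row_free_unit -kermx_eq0; apply/rowV0P => v /sub_kermxP vg.
pose x := \sum_i v 0 i *: b i.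
have x0 : x = 0.
  apply: tau_nondegenerate => y; rewrite (bP.1 y) mulr_sumr.
  under eq_bigr do rewrite -scalerAr.
  rewrite (linear_comb tau_linear) big1// => j _.
  rewrite /x mulr_suml; under eq_bigr do rewrite -scalerAl.
  rewrite (linear_comb tau_linear).
  move/rowP: vg => /(_ j); rewrite !mxE => vg.
  rewrite (_ : \sum_(i <- _) _ = 0) ?scaler0// -[RHS]vg.
  by apply: eq_bigr => i _; rewrite mxE.
by apply/rowP => i; rewrite mxE -(bP.2 (fun i => v 0 i) i) -/x x0 coord0.
Qed.

Lemma tau_dual i j : tau (b i * dual j) = (i == j)%:R.
Proof.
rewrite /dual mulr_sumr; under eq_bigr do rewrite -scalerAr.
rewrite (linear_comb tau_linear).
have /matrixP/(_ i j) := mulmxV gram_unit; rewrite !mxE => <-.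
by apply: eq_bigr => k _; rewrite !mxE mulrC.
Qed.

Lemma coord_tau i x : coord i x = tau (x * dual i).
Proof.
rewrite [in RHS](bP.1 x) mulr_suml; under eq_bigr do rewrite -scalerAl.
rewrite (linear_comb tau_linear) (bigD1 i)//= big1 => [|j ji].
  by rewrite tau_dual eqxx addr0 /GRing.scale /= mulr1.
by rewrite tau_dual (negbTE ji) scaler0.
Qed.

Lemma dual_expansion y : y = \sum_i tau (b i * y) *: dual i.
Proof.
apply/eqP; rewrite -subr_eq0; apply/eqP; apply: tau_nondegenerate => w.
rewrite tauC (bP.1 w) mulr_suml; under eq_bigr do rewrite -scalerAl.
rewrite (linear_comb tau_linear) big1// => j _.
have -> : tau (b j * (y - \sum_i tau (b i * y) *: dual i)) = 0; last by rewrite scaler0.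
rewrite mulrBr tauB mulr_sumr; under eq_bigr do rewrite -scalerAr.
rewrite (linear_comb tau_linear) (bigD1 j)//= big1 => [|i ij].
  by rewrite tau_dual eqxx addr0 /GRing.scale /= mulr1 subrr.
by rewrite tau_dual eq_sym (negbTE ij) scaler0.
Qed.

(** Paired with x under tau, the left side is the sum of the i-th coordinates of x b_i, which is the
    trace tau x. *)
Lemma dual_unit : \sum_i b i * dual i = 1.
Proof.
apply/eqP; rewrite -subr_eq0; apply/eqP; apply: tau_nondegenerate => x.
rewrite tauC mulrBr mulr1.
rewrite tauB [tau x]tauE mulr_sumr.
have := linear_comb tau_linear (index_enum 'I_n) (fun=> 1) (fun i => x * (b i * dual i)).
under eq_bigr do rewrite scale1r; under [in RHS]eq_bigr do rewrite scale1r.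
move=> ->; apply/eqP; rewrite subr_eq0; apply/eqP; apply: eq_bigr => i _.
by rewrite mulrA coord_tau.
Qed.

(** Bilinear maps stand for the tensor product. In the bases [b] and [dual] both sides have the
    coefficients tau (x b_k dual_j), equal up to the trace property. *)
Lemma dual_balanced (V : lmodType K) (beta : B -> B -> V) x :
  (forall y, linear (beta^~ y)) -> (forall y, linear (beta y)) ->
  \sum_k beta (x * b k) (dual k) = \sum_k beta (b k) (dual k * x).
Proof.
move=> l1 l2.
under eq_bigr => k _ do rewrite [x * b k](bP.1 (x * b k)) (linear_comb (l1 _)).
under [in RHS]eq_bigr => k _ do
  rewrite [dual k * x](dual_expansion (dual k * x)) (linear_comb (l2 _)).
rewrite exchange_big; apply: eq_bigr => j _; apply: eq_bigr => i _.
by rewrite coord_tau -mulrA tauC mulrA.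
Qed.

End TraceForm.

End FiniteDimensional.

(** * Correcting almost multiplicative maps *)

Section AlmostMultiplicativeMaps.
Context {R : realType}.
Variables (B D : cstarAlgType R) (nr : B -> R).
Hypothesis nr0 : forall x, 0 <= nr x.
Hypothesis nrS : forall x, nr (star x) = nr x.
Variables (n : nat) (a b : 'I_n -> B).
Hypothesis ab1 : \sum_k a k * b k = 1.
Hypothesis balanced : forall (beta : B -> B -> D) x,
  (forall y, linear (beta^~ y)) -> (forall y, linear (beta y)) ->
  \sum_k beta (x * a k) (b k) = \sum_k beta (a k) (b k * x).

Definition defect (T : B -> D) x y := T (x * y) - T x * T y.

Definition nr_bounded (T : B -> D) (M : R) := forall x, cnorm (T x) <= M * nr x.

Definition almost_hom (T : B -> D) (e : R) : Prop :=
  [/\ linear T, forall x, T (star x) = star (T x)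
    & forall x y, cnorm (defect T x y) <= e * (nr x * nr y)].

Let N : R := \sum_k nr (a k) * nr (b k).
Let N0 : 0 <= N. Proof. by apply: sumr_ge0 => k _; exact: mulr_ge0. Qed.

Section NewtonStep.
Variables (T : B -> D) (M e : R).
Hypotheses (TM : nr_bounded T M) (Te : almost_hom T e).

Let lT : linear T. Proof. by case: Te. Qed.
Let sT x : T (star x) = star (T x). Proof. by case: Te. Qed.
Let dT x y : cnorm (defect T x y) <= e * (nr x * nr y). Proof. by case: Te. Qed.
Let d := defect T.

(** The Hochschild 2-cocycle identity, exact although [T] is not multiplicative. *)
Let cocycle x y z : d (x * y) z + d x y * T z = d x (y * z) + T x * d y z.
Proof. by rewrite /d /defect !mulrA; ncring. Qed.

Let d_linl y : linear (d^~ y).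
Proof.
move=> c u v; rewrite /d /defect mulrDl -scalerAl !lT mulrDl -scalerAl scalerBr.
by ncring.
Qed.

Let d_linr x : linear (d x).
Proof.
move=> c u v; rewrite /d /defect mulrDr -scalerAr !lT mulrDr -scalerAr scalerBr.
by ncring.
Qed.

(** The contracting homotopy given by the separability idempotent: the coboundary of [G] is -d up to
    second order, except that [T 1] appears in place of 1. The term with E = 1 - T 1 in [H] repairs
    this. *)
Let G x := \sum_k T (a k) * d (b k) x.
Let E : D := 1 - T 1.
Let H x := G x - E * d 1 x.

Let G_deriv x y : G (x * y) - T x * G y - G x * T y =
  - (T 1 * d x y) + \sum_k d x (a k) * d (b k) y + (\sum_k d (a k) (b k)) * d x y.
Proof.
(* T x T (a k) is T (x a k) minus a defect, and x then crosses the idempotent by [balanced]. *)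
have TG : T x * G y = \sum_k T (a k) * d (b k * x) y - \sum_k d x (a k) * d (b k) y.
  have -> : \sum_k T (a k) * d (b k * x) y = \sum_k T (x * a k) * d (b k) y.
    apply: esym; apply: (balanced (beta := fun u v => T u * d v y)).
      by move=> v c u w; rewrite lT mulrDl -scalerAl.
    by move=> u c v w; rewrite d_linl mulrDr -scalerAr.
  rewrite /G mulr_sumr -sumrB; apply: eq_bigr => k _.
  by rewrite /d /defect; ncring.
have Gxy : \sum_k T (a k) * d (b k * x) y =
    G (x * y) + (\sum_k T (a k) * T (b k)) * d x y - G x * T y.
  rewrite /G !mulr_suml -big_split -sumrB; apply: eq_bigr => k _ /=.
  have -> : d (b k * x) y = d (b k) (x * y) + T (b k) * d x y - d (b k) x * T y.
    by rewrite -cocycle addrK.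
  by ncring.
have TT : \sum_k T (a k) * T (b k) = T 1 - \sum_k d (a k) (b k).
  have T1 : T 1 = \sum_k T (a k * b k).
    rewrite -ab1 -(eq_bigr _ (fun k _ => scale1r (a k * b k))) (linear_comb lT).
    by apply: eq_bigr => k _; rewrite scale1r.
  by rewrite T1 -sumrB; apply: eq_bigr => k _; rewrite /d /defect; ncring.
by rewrite TG Gxy TT; ncring.
Qed.

(** Each term on the right is a product of two defects: the correction [H] cancels [d] to first
    order. *)
Let H_deriv x y : d x y + (H (x * y) - T x * H y - H x * T y) =
  \sum_k d x (a k) * d (b k) y + (\sum_k d (a k) (b k)) * d x y
  + d 1 1 * d x y + d x 1 * d 1 y.
Proof.
have -> : H (x * y) - T x * H y - H x * T y = (G (x * y) - T x * G y - G x * T y)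
    - E * (d 1 (x * y) - d 1 x * T y) + T x * E * d 1 y.
  by rewrite /H; ncring.
have -> : d 1 (x * y) - d 1 x * T y = E * d x y.
  have := cocycle 1 x y; rewrite mul1r => c1.
  have -> : d 1 (x * y) = d x y + d 1 x * T y - T 1 * d x y by rewrite c1 addrK.
  by rewrite /E; ncring.
have -> : T x * E = d x 1 by rewrite /d /defect /E mulr1; ncring.
have EE : E * (E * d x y) = E * d x y - d 1 1 * d x y.
  have d11 : d 1 1 = T 1 - T 1 * T 1 by rewrite /d /defect mulr1.
  by rewrite d11 /E; ncring.
by rewrite G_deriv EE /E; ncring.
Qed.

Let C1 : R := M * N + (1 + M * nr 1) * nr 1.
Let C2 : R := 2 * N + 2 * nr 1 ^+ 2.

Let H_le x : cnorm (H x) <= C1 * e * nr x.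
Proof.
have GM : cnorm (G x) <= M * N * e * nr x.
  apply: le_trans (cnorm_sum _ _ _) _.
  rewrite (_ : _ * nr x = \sum_k M * nr (a k) * (e * (nr (b k) * nr x))).
    by apply: ler_sum => k _; exact: cnormM_le.
  by rewrite /N mulr_sumr !mulr_suml; apply: eq_bigr => k _; ring.
have EM : cnorm E <= 1 + M * nr 1.
  by rewrite /E; have := cnormD (1 : D) (- T 1); rewrite cnormN cnorm1; have := TM 1; lra.
have := cnormD (G x) (- (E * d 1 x)); rewrite cnormN -/(H x).
have := cnormM_le EM (dT 1 x); rewrite -/d /C1; lra.
Qed.

Let Q_le x y : cnorm (d x y + (H (x * y) - T x * H y - H x * T y)) <=
  C2 * e ^+ 2 * (nr x * nr y).
Proof.
rewrite H_deriv.
set u := \sum_k _; set v := _ * d x y; set w := d 1 1 * _; set z := d x 1 * _.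
have hu : cnorm u <= N * e ^+ 2 * (nr x * nr y).
  apply: le_trans (cnorm_sum _ _ _) _.
  rewrite (_ : _ * (nr x * nr y) =
    \sum_k e * (nr x * nr (a k)) * (e * (nr (b k) * nr y))).
    by apply: ler_sum => k _; exact: cnormM_le.
  by rewrite /N !mulr_suml; apply: eq_bigr => k _; ring.
have hv : cnorm v <= N * e ^+ 2 * (nr x * nr y).
  rewrite /v; have sN : cnorm (\sum_k d (a k) (b k)) <= e * N.
    apply: le_trans (cnorm_sum _ _ _) _; rewrite /N mulr_sumr.
    by apply: ler_sum => k _.
  by apply: le_trans (cnormM_le sN (dT x y)) _; rewrite le_eqVlt; apply/orP; left; apply/eqP; ring.
have hw : cnorm w <= e ^+ 2 * nr 1 ^+ 2 * (nr x * nr y).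
  apply: le_trans (cnormM_le (dT 1 1) (dT x y)) _.
  by rewrite le_eqVlt; apply/orP; left; apply/eqP; ring.
have hz : cnorm z <= e ^+ 2 * nr 1 ^+ 2 * (nr x * nr y).
  apply: le_trans (cnormM_le (dT x 1) (dT 1 y)) _.
  by rewrite le_eqVlt; apply/orP; left; apply/eqP; ring.
have := cnormD (u + v + w) z; have := cnormD (u + v) w; have := cnormD u v.
rewrite /C2; lra.
Qed.

(** Averaging the correction with its adjoint keeps [T'] compatible with [star]. *)
Let T' x := T x + 2^-1 *: (H x + star (H (star x))).

Let T'_lin : linear T'.
Proof.
have lH : linear H.
  have lG : linear G.
    move=> c u v; rewrite /G scaler_sumr -big_split; apply: eq_bigr => k _ /=.
    by rewrite d_linr mulrDr -scalerAr.
  move=> c u v; rewrite /H lG d_linr mulrDr -scalerAr scalerBr; ncring.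
move=> c u v; rewrite /T' (starD (c *: u)) starZ !lH.
rewrite (starD (c^* *: H (star u)) (H (star v))) starZ conjCK lT.
set p := H u; set q := H v; set p' := star _; set q' := star _.
rewrite (_ : c *: p + q + (c *: p' + q') = c *: (p + p') + (q + q')); last first.
  by rewrite (scalerDr c p); ncring.
rewrite (scalerDr c (T u)) (scalerDr 2^-1 (c *: _)) !scalerA [2^-1 * c]mulrC.
by ncring.
Qed.

Let T'_star x : T' (star x) = star (T' x).
Proof.
rewrite /T' starK sT (starD (T x)) star_half (starD (H x)) starK.
by rewrite [H (star x) + _]addrC.
Qed.

Let T'_dist x : cnorm (T' x - T x) <= C1 * e * nr x.
Proof.
rewrite /T' addrC addKr cnorm_half.
have := cnormD (H x) (star (H (star x))); rewrite cnorm_star.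
by have := H_le x; have := H_le (star x); rewrite nrS; lra.
Qed.

Let half_expand (u w s t p q : D) : 2^-1 *: (u + u + w - s * q - p * t) =
  u + 2^-1 *: w - s * (2^-1 *: q) - (2^-1 *: p) * t.
Proof. by rewrite -scalerAr -scalerAl !scalerBr scalerDr scale_halfD. Qed.

(** The adjoint correction obeys the adjoint of the estimate [Q_le]; the remaining term is the
    product of the corrections at x and y, which contributes C1^2. *)
Let T'_defect x y :
  cnorm (defect T' x y) <= (C2 + C1 ^+ 2) * e ^+ 2 * (nr x * nr y).
Proof.
pose Q u v := d u v + (H (u * v) - T u * H v - H u * T v).
pose H' u := star (H (star u)).
have dS u v : d u v = star (d (star v) (star u)).
  by rewrite /d /defect starB starM -!sT -starM !starK.
have QS u v : d u v + (H' (u * v) - T u * H' v - H' u * T v) =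
    star (Q (star v) (star u)).
  rewrite /Q /H' -starM !sT.
  move: (H (star (u * v))) (H (star u)) (H (star v)) => p q r.
  by rewrite starD -dS !starB !starM !starK; ncring.
have -> : defect T' x y = 2^-1 *: (Q x y + star (Q (star y) (star x)))
    - (2^-1 *: (H x + H' x)) * (2^-1 *: (H y + H' y)).
  rewrite -QS /Q /defect /T' -/(H' (x * y)) -/(H' x) -/(H' y).
  set p := H x + H' x; set q := H y + H' y.
  have -> : d x y + (H (x * y) - T x * H y - H x * T y) +
      (d x y + (H' (x * y) - T x * H' y - H' x * T y)) =
      (d x y + d x y) + (H (x * y) + H' (x * y)) - T x * q - p * T y.
    by rewrite /p /q; ncring.
  by rewrite half_expand /d /defect; ncring.
have h1 : cnorm (2^-1 *: (Q x y + star (Q (star y) (star x)))) <=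
    C2 * e ^+ 2 * (nr x * nr y).
  rewrite cnorm_half; have := cnormD (Q x y) (star (Q (star y) (star x))).
  rewrite cnorm_star; have := Q_le x y; have := Q_le (star y) (star x).
  by rewrite !nrS [nr y * _]mulrC -/(Q _ _) -/(Q _ _); lra.
have H'_le u : cnorm (2^-1 *: (H u + H' u)) <= C1 * e * nr u.
  by have := T'_dist u; rewrite /T' addrC addKr.
have h2 := cnormM_le (H'_le x) (H'_le y).
apply: le_trans (cnormD _ _) _; rewrite cnormN.
rewrite (_ : (C2 + _) * _ * _ = C2 * e ^+ 2 * (nr x * nr y) +
  C1 * e * nr x * (C1 * e * nr y)); last by ring.
exact: lerD.
Qed.

Lemma newton_step : exists S : B -> D,
  almost_hom S ((C2 + C1 ^+ 2) * e ^+ 2) /\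
  forall x, cnorm (S x - T x) <= C1 * e * nr x.
Proof. by exists T'. Qed.

End NewtonStep.

(* Dominates both constants of [newton_step]. *)
Definition newton_const (M : R) : R :=
  let C1 := M * N + (1 + M * nr 1) * nr 1 in
  1 + C1 + (2 * N + 2 * nr 1 ^+ 2 + C1 ^+ 2).

Lemma newton_const_gt0 M : 0 <= M -> 0 < newton_const M.
Proof.
move=> M0; rewrite /newton_const.
have C0 : 0 <= M * N + (1 + M * nr 1) * nr 1.
  by rewrite addr_ge0 ?mulr_ge0 ?addr_ge0 ?mulr_ge0.
have := sqr_ge0 (M * N + (1 + M * nr 1) * nr 1); have := sqr_ge0 (nr 1).
have := N0; lra.
Qed.

(** The smallness condition makes each step at least halve the defect, so the moves add up to at
    most 2 C e nr x. This total is at most nr x, so all iterates obey the bound M + 1 for which the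
    constant C is taken. *)
Lemma newton (T : B -> D) (M e : R) : 0 <= M -> 0 < e ->
  nr_bounded T M -> almost_hom T e -> 2 * newton_const (M + 1) * e <= 1 ->
  exists S : B -> D, [/\ linear S, forall x, S (star x) = star (S x),
    forall x y, S (x * y) = S x * S y
    & forall x, cnorm (S x - T x) <= 2 * newton_const (M + 1) * e * nr x].
Proof.
move=> M0 e0 TM Te; set C := newton_const (M + 1) => Ce.
have C0 : 0 < C by apply: newton_const_gt0; lra.
pose h j : R := 2^-1 ^+ j.
have h0 j : 0 < h j by rewrite exprn_gt0// invr_gt0.
have hS j : h j.+1 = h j / 2 by rewrite /h exprS mulrC.
have h1 j : h j <= 1 by rewrite exprn_ile1// invf_le1 ?ler1n.
pose P j (S : B -> D) := almost_hom S (e * h j) /\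
  forall x, cnorm (S x - T x) <= 2 * C * e * (1 - h j) * nr x.
have step j S : P j S -> exists S', P j.+1 S' /\
    forall x, cnorm (S' x - S x) <= C * e * h j * nr x.
  move=> [Sh SC]; have SM : nr_bounded S (M + 1).
    move=> x; have := cnormD (S x - T x) (T x); rewrite subrK.
    have := TM x; have := SC x; have := nr0 x.
    have : 2 * C * e * (1 - h j) * nr x <= 1 * nr x.
      rewrite ler_wpM2r//; have := h0 j; have := h1 j; nra.
    lra.
  have M1 : 0 <= M + 1 by lra.
  have eh : 0 <= e * h j by rewrite mulr_ge0// ltW.
  have [S' [S'h S'S]] := newton_step SM Sh; exists S'.
  have CC : (M + 1) * N + (1 + (M + 1) * nr 1) * nr 1 <= C.
    rewrite /C /newton_const; set c := _ + _ * nr 1.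
    have := sqr_ge0 c; have := sqr_ge0 (nr 1); have := N0; lra.
  have S'S' x : cnorm (S' x - S x) <= C * e * h j * nr x.
    apply: le_trans (S'S x) _; rewrite -(mulrA C) ler_wpM2r// ler_wpM2r//.
  split => //; split.
    case: S'h => l s dd; split=> // x y; apply: le_trans (dd x y) _.
    rewrite ler_wpM2r ?mulr_ge0// hS.
    apply: le_trans (_ : C * (e * h j) ^+ 2 <= _).
      rewrite ler_wpM2r ?sqr_ge0// /C /newton_const.
      have : 0 <= (M + 1) * N + (1 + (M + 1) * nr 1) * nr 1.
        by rewrite addr_ge0 ?mulr_ge0 ?addr_ge0 ?mulr_ge0.
      lra.
    have : C * e * h j <= 1 / 2 by have := h0 j; have := h1 j; nra.
    by move: eh; nra.
  move=> x; have := cnorm_tri (S x) (S' x) (T x); have := S'S' x; have := SC x.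
  rewrite hS; lra.
have /choice[f fE] : forall jS : nat * (B -> D), exists S', P jS.1 jS.2 ->
    P jS.1.+1 S' /\ forall x, cnorm (S' x - jS.2 x) <= C * e * h jS.1 * nr x.
  move=> [j S]; have [PS|no] := pselect (P j S).
    by have [S' ?] := step j S PS; exists S'.
  by exists S => /no.
pose u := fix u j := if j is i.+1 then f (i, u i) else T.
have Pu j : P j (u j).
  elim: j => [|j ih]; last by have [] := fE (j, u j) ih.
  split; first by rewrite /h expr0 mulr1.
  by move=> x; rewrite subrr cnorm0 /h expr0 subrr mulr0 mul0r.
have ustep j x : cnorm (u j.+1 x - u j x) <= C * e * h j * nr x.
  by have [_ /(_ x)] := fE (j, u j) (Pu j).
have udist j m x : cnorm (u (j + m)%N x - u j x) <= 2 * C * e * (h j - h (j + m)%N) * nr x.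
  elim: m => [|m ih]; first by rewrite addn0 subrr cnorm0 subrr mulr0 mul0r.
  have := cnorm_tri (u (j + m)%N x) (u (j + m.+1)%N x) (u j x).
  rewrite !addnS; have := ustep (j + m)%N x; rewrite hS; lra.
have Ce0 : 0 < 2 * C * e by rewrite !mulr_gt0.
have hsmall r : 0 < r -> exists K, forall j, (K <= j)%N -> h j < r.
  by apply: expr_small; rewrite ?invr_ge0// invf_lt1 ?ltr1n.
have /choice[S Slim] : forall x, exists l, asy (u^~ x) (cst l).
  move=> x; have [|l ul] := @cnorm_cauchy _ D (u^~ x).
    move=> r r0; have nx : 0 < 2 * C * e * (nr x + 1).
      by rewrite mulr_gt0//; have := nr0 x; lra.
    have [K hK] := hsmall _ (divr_gt0 r0 nx); exists K.
    suff W i j : (i <= j)%N -> (K <= i)%N -> cnorm (u j x - u i x) < r.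
      move=> i j Ki Kj; have [ij|ji] := leqP i j; first by rewrite cnormB W.
      by rewrite W// ltnW.
    move=> ij Ki; rewrite -(subnKC ij); apply: le_lt_trans (udist _ _ _) _.
    have := hK i Ki; rewrite ltr_pdivlMr//; have := h0 (i + (j - i))%N.
    set h' := h (i + _)%N; have := h0 i; have := nr0 x => nx0 hi h'0.
    apply: le_lt_trans.
    have : 2 * C * e * (h i - h') * nr x <= 2 * C * e * h i * nr x.
      by rewrite ler_wpM2r// ler_wpM2l ?ltW//; lra.
    move/le_trans; apply; have : 0 <= 2 * C * e * h i by rewrite mulr_ge0// ltW.
    lra.
  exists l => r /ul[K hK]; exists K => // j /= Kj; rewrite cnormB; exact: hK.
have bu x : bdd (u^~ x).
  exists (cnorm (T x) + 2 * C * e * nr x) => j.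
  have := cnormD (u j x - T x) (T x); rewrite subrK; have := (Pu j).2 x.
  have : 2 * C * e * (1 - h j) * nr x <= 2 * C * e * nr x.
    by rewrite ler_wpM2r// ler_piMr ?ltW//; have := h0 j; lra.
  lra.
exists S; split.
- move=> c x y; apply: asy_cst_inj.
  apply: asy_trans (asy_sym (Slim _)) _.
  have -> : u^~ (c *: x + y) = cst c%:A * u^~ x + u^~ y.
    apply/funext => j; have [[lu _ _] _] := Pu j.
    change (u j (c *: x + y) = c%:A * u j x + u j y).
    by rewrite lu mulr_algl.
  have -> : cst (c *: S x + S y) = cst c%:A * cst (S x) + cst (S y) :> (nat -> D).
    by apply/funext => j; change (c *: S x + S y = c%:A * S x + S y); rewrite mulr_algl.
  by apply: asyD => //; apply: asyMl => //; exact: bdd_cst.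
- move=> x; apply: asy_cst_inj; apply: asy_trans (asy_sym (Slim _)) _ => r r0.
  apply: filterS (Slim x r r0) => j.
  change (cnorm (u j x - S x) < r -> cnorm (u j (star x) - star (S x)) < r).
  by have [[_ -> _] _] := Pu j; rewrite -starB cnorm_star.
- move=> x y; apply: asy_cst_inj; apply: asy_trans (asy_sym (Slim _)) _.
  apply: asy_trans (_ : asy _ (u^~ x * u^~ y)) _.
    move=> r r0; have nxy : 0 < e * (nr x * nr y + 1).
      by rewrite mulr_gt0// ltr_wpDl// mulr_ge0.
    have [K hK] := hsmall _ (divr_gt0 r0 nxy); exists K => // j /= /hK.
    change (h j < r / (e * (nr x * nr y + 1)) -> cnorm (defect (u j) x y) < r).
    rewrite ltr_pdivlMr// => hj; have [[_ _ /(_ x y) ud] _] := Pu j.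
    apply: le_lt_trans ud _; apply: le_lt_trans hj.
    rewrite (_ : e * h j * (nr x * nr y) = h j * (e * (nr x * nr y))); last by ring.
    by rewrite ler_wpM2l ?ltW// ltr_pM2l// ltrDl.
  by apply: asyM => //; exact: bdd_cst.
- move=> x; apply: cnorm_le_eps => r r0.
  have [j /= uj] := filter_ex (Slim x r r0).
  have := cnorm_tri (u j x) (S x) (T x); rewrite [cnorm (S x - u j x)]cnormB.
  have := (Pu j).2 x.
  have : 2 * C * e * (1 - h j) * nr x <= 2 * C * e * nr x.
    by rewrite ler_wpM2r// ler_piMr ?ltW//; have := h0 j; lra.
  move: uj; rewrite /cst; lra.
Qed.

End AlmostMultiplicativeMaps.

Section FiniteDimensionalNorm.
Context {R : realType} {B : cstarAlgType R}.
Variables (n : nat) (b : 'I_n -> B) (coord : 'I_n -> B -> R[i]).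
Hypothesis bP : basis b coord.

Lemma coord_basis i j : coord j (b i) = (j == i)%:R.
Proof.
have <- : \sum_k (k == i)%:R *: b k = b i.
  rewrite (bigD1 i)//= eqxx scale1r big1 ?addr0// => k /negbTE ->.
  by rewrite scale0r.
exact: (bP.2 (fun k => (k == i)%:R)).
Qed.

Let l1 (x : B) : R := \sum_i Normc.normc (coord i x).

Let normc_ge0 (z : R[i]) : 0 <= Normc.normc z.
Proof. by case: z => u v; exact: sqrtr_ge0. Qed.

Let l1_ge0 x : 0 <= l1 x. Proof. by apply: sumr_ge0 => i _. Qed.

Let l1_sum I (r : seq I) (c : I -> R[i]) (x : I -> B) :
  l1 (\sum_(i <- r) c i *: x i) <= \sum_(i <- r) Normc.normc (c i) * l1 (x i).
Proof.
rewrite /l1; under [leRHS]eq_bigr do rewrite mulr_sumr.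
rewrite exchange_big; apply: ler_sum => j _.
rewrite (linear_comb (coord_linear bP j)).
elim: r => [|i r ih]; first by rewrite !big_nil Normc.normc0.
rewrite !big_cons; apply: le_trans (le_normcD _ _) _.
by rewrite /GRing.scale /= Normc.normcM lerD2l.
Qed.

Let kappa : R := 1 + \sum_i \sum_j l1 (b i * b j).
Let kappa1 : 1 <= kappa.
Proof. by rewrite lerDl; apply: sumr_ge0 => i _; apply: sumr_ge0. Qed.

Let l1M x y : l1 (x * y) <= kappa * (l1 x * l1 y).
Proof.
have lb i j : l1 (b i * b j) <= kappa.
  rewrite /kappa (bigD1 i)//= (bigD1 j)//=.
  have := sumr_ge0 (index_enum 'I_n) (fun k (_ : k != j) => l1_ge0 (b i * b k)).
  have : 0 <= \sum_(k | k != i) \sum_j l1 (b k * b j).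
    by apply: sumr_ge0 => k _; apply: sumr_ge0.
  lra.
rewrite {1}(bP.1 x) mulr_suml; under eq_bigr do rewrite -scalerAl.
apply: le_trans (l1_sum _ _ _) _.
rewrite mulrCA {3}/l1 mulr_suml; apply: ler_sum => i _.
rewrite ler_wpM2l// {1}(bP.1 y) mulr_sumr; under eq_bigr do rewrite -scalerAr.
apply: le_trans (l1_sum _ _ _) _; rewrite mulr_sumr; apply: ler_sum => j _.
by rewrite mulrC ler_wpM2r.
Qed.

(* The second summand makes the gauge invariant under [star], the factor kappa
   makes it submultiplicative. *)
Definition gauge (x : B) : R := kappa * (l1 x + l1 (star x)).

Lemma gauge_ge0 x : 0 <= gauge x.
Proof.
by apply: mulr_ge0; [have := kappa1; lra|exact: addr_ge0].
Qed.

Lemma gauge_star x : gauge (star x) = gauge x.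
Proof. by rewrite /gauge starK addrC. Qed.

Lemma gaugeM x y : gauge (x * y) <= gauge x * gauge y.
Proof.
have k1 := kappa1; rewrite /gauge starM.
rewrite -mulrA ler_wpM2l//; first lra.
have := l1M x y; have := l1M (star y) (star x).
have h1 := mulr_ge0 (l1_ge0 x) (l1_ge0 (star y)).
have h2 := mulr_ge0 (l1_ge0 (star x)) (l1_ge0 y).
rewrite (_ : _ * (kappa * _) = kappa * (l1 x * l1 y) + kappa * (l1 (star y) * l1 (star x)) +
  kappa * (l1 x * l1 (star y)) + kappa * (l1 (star x) * l1 y)); last by ring.
have k0 : 0 <= kappa by lra.
have := mulr_ge0 k0 h1; have := mulr_ge0 k0 h2; lra.
Qed.

(** The reason for using the gauge: values on the basis control the whole map, without comparison
    with the norm of [B]. *)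
Lemma gauge_linear (A : cstarAlgType R) (T : B -> A) (M : R) : linear T ->
  0 <= M -> (forall i, cnorm (T (b i)) <= M) -> forall x, cnorm (T x) <= M * gauge x.
Proof.
move=> lT M0 TM x; rewrite {1}(bP.1 x) (linear_comb lT).
apply: le_trans (cnorm_sum _ _ _) _; apply: le_trans (_ : M * l1 x <= _).
  rewrite /l1 mulr_sumr; apply: ler_sum => i _.
  by rewrite cnormZ mulrC ler_wpM2r.
rewrite ler_wpM2l// /gauge; have := kappa1; have := l1_ge0 x.
have := l1_ge0 (star x); nra.
Qed.

Lemma gauge_bilinear (A : cstarAlgType R) (beta : B -> B -> A) (M : R) :
  (forall y, linear (beta^~ y)) -> (forall y, linear (beta y)) -> 0 <= M ->
  (forall i j, cnorm (beta (b i) (b j)) <= M) ->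
  forall x y, cnorm (beta x y) <= M * (gauge x * gauge y).
Proof.
move=> l1' l2' M0 bM x y; rewrite [gauge x * _]mulrC mulrA.
apply: (gauge_linear (T := beta^~ y)) => // [|i]; first by rewrite mulr_ge0// gauge_ge0.
exact: gauge_linear.
Qed.

End FiniteDimensionalNorm.

Section PopaFixedPoint.
Context {R : realType} {G : topGroupType} {A : cstarAlgType R}.
Variable alpha : cstar_action G A.

(* The data L, C, g do not depend on the map Psi to be corrected. *)
Lemma fixed_hom_near (B : cstarAlgType R) (sigma : {linear B -> A}) :
  finite_dimensional B -> (forall x y, sigma (x * y) = sigma x * sigma y) ->
  (forall x, sigma (star x) = star (sigma x)) ->
  exists (L : seq A) (C : R) (g : B -> R), [/\ 0 < C, forall x, 0 <= g x
  & forall (Psi : {linear A -> A}) (e : R), 0 < e -> C * e <= 1 ->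
    (forall a, Psi (star a) = star (Psi a)) ->
    (forall a, cnorm (Psi a) <= 3 * cnorm a) ->
    (forall a b, a \in L -> b \in L -> cnorm (Psi a * Psi b - Psi (a * b)) <= e) ->
    (forall a, a \in L -> exists c : fixalg alpha, cnorm (Psi a - fixval c) <= e) ->
    exists S : {linear B -> fixalg alpha},
    [/\ forall x, S (star x) = star (S x), forall x y, S (x * y) = S x * S y
      & forall x, cnorm (fixval (S x) - Psi (sigma x)) <= C * e * g x]].
Proof.
move=> /finite_dimensional_basis[n [b [coord bP]]] sM sS.
pose g := gauge b coord.
have g0 := gauge_ge0 b coord : forall x, 0 <= g x.
have gM := gaugeM bP : forall x y, g (x * y) <= g x * g y.
have gS := gauge_star b coord : forall x, g (star x) = g x.
pose L := [seq sigma (b i) | i <- enum 'I_n].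
have Lb i : sigma (b i) \in L.
  by apply: (map_f (fun i => sigma (b i))); rewrite mem_enum.
pose W : R := 1 + \sum_i g (b i) + 3 * \sum_i cnorm (sigma (b i)).
have sg0 : 0 <= \sum_i g (b i) by apply: sumr_ge0.
have ss0 : 0 <= \sum_i cnorm (sigma (b i)) by apply: sumr_ge0 => i _; exact: cnorm_ge0.
have W1 : 1 <= W by rewrite /W; lra.
have gW i : g (b i) <= W.
  rewrite /W (bigD1 i)//=; have : 0 <= \sum_(j | j != i) g (b j) by apply: sumr_ge0.
  lra.
have sW i : 3 * cnorm (sigma (b i)) <= W.
  rewrite /W [X in _ + 3 * X](bigD1 i)//=.
  have : 0 <= \sum_(j | j != i) cnorm (sigma (b j)) by apply: sumr_ge0 => j _; exact: cnorm_ge0.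
  lra.
pose K := newton_const g b (dual b coord) (2 * W + 1).
have K0 : 0 < K by apply: newton_const_gt0 => //; lra.
(* The defect of T will be 5 W^2 e, so the Newton iteration moves it by 2 K (5 W^2 e); the [+ 1]
   pays for the distance from T to Psi sigma. *)
pose C := 10 * K * W ^+ 2 + 1.
have W2 : 1 <= W ^+ 2 by rewrite expr2; nra.
have KW : 0 < K * W ^+ 2 by rewrite mulr_gt0//; lra.
have C0 : 0 < C by rewrite /C; lra.
exists L, C, g; split => // Psi e e0 Ce PsiS Psi3 PsiM PsiL.
have e1 : e <= 1 by move: Ce; rewrite /C; have := mulr_gt0 KW e0; lra.
have /choice[r rE] : forall i, exists c : fixalg alpha,
  cnorm (Psi (sigma (b i)) - fixval c) <= e by move=> i; exact: PsiL.
pose T0 x : fixalg alpha := \sum_i coord i x *: r i.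
have lT0 : linear T0.
  move=> c x y; rewrite /T0 scaler_sumr -big_split; apply: eq_bigr => i _ /=.
  by rewrite (coord_linear bP) scalerDl scalerA.
(* [T0] interpolates fixed approximants on the basis; symmetrization restores compatibility with
   [star]. *)
pose T x : fixalg alpha := 2^-1 *: (T0 x + star (T0 (star x))).
have lT : linear T.
  move=> c x y; rewrite /T lT0 starD starZ lT0.
  rewrite (starD (c^* *: T0 (star x))) starZ conjCK.
  rewrite scalerA mulrC -scalerA -scalerDr; congr (_ *: _).
  by rewrite scalerDr; ncring.
have sT x : T (star x) = star (T x).
  by rewrite /T star_half starD !starK addrC.
have bT i : cnorm (fixval (T0 (b i)) - Psi (sigma (b i))) <= e.
  rewrite /T0 (bigD1 i)//= big1 => [|j ji].
    by rewrite (coord_basis bP) eqxx scale1r addr0 cnormB.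
  by rewrite (coord_basis bP) (negbTE ji) scale0r.
have T0P x : cnorm (fixval (T0 x) - Psi (sigma x)) <= e * g x.
  apply: (gauge_linear bP (T := fun x => fixval (T0 x) - Psi (sigma x))) => //; last exact: ltW.
  move=> c u v; rewrite lT0 (linearP sigma) (linearP Psi).
  change (c *: fixval (T0 u) + fixval (T0 v) - (c *: Psi (sigma u) + Psi (sigma v)) =
    c *: (fixval (T0 u) - Psi (sigma u)) + (fixval (T0 v) - Psi (sigma v))).
  by rewrite scalerBr; ncring.
have TP x : cnorm (fixval (T x) - Psi (sigma x)) <= e * g x.
  have -> : fixval (T x) - Psi (sigma x) = 2^-1 *: ((fixval (T0 x) - Psi (sigma x)) +
      star (fixval (T0 (star x)) - Psi (sigma (star x)))).
    change (2^-1 *: (fixval (T0 x) + star (fixval (T0 (star x)))) - Psi (sigma x) =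
      2^-1 *: ((fixval (T0 x) - Psi (sigma x)) +
      star (fixval (T0 (star x)) - Psi (sigma (star x))))).
    rewrite starB -PsiS -sS starK -[in LHS](scale_halfD (Psi (sigma x))) -scalerBr.
    by congr (_ *: _); ncring.
  rewrite cnorm_half; have := T0P x; have := T0P (star x); rewrite gS.
  have := cnormD (fixval (T0 x) - Psi (sigma x))
    (star (fixval (T0 (star x)) - Psi (sigma (star x)))).
  by rewrite cnorm_star; lra.
have PsiW i : cnorm (Psi (sigma (b i))) <= W by exact: le_trans (Psi3 _) (sW i).
have TW i : cnorm (T (b i)) <= 2 * W.
  rewrite cnorm_fixval.
  have := cnormD (fixval (T (b i)) - Psi (sigma (b i))) (Psi (sigma (b i))).
  rewrite subrK; have := PsiW i; have := TP (b i); have := gW i; have := g0 (b i); nra.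
have TM : nr_bounded g T (2 * W) by apply: gauge_linear => //; lra.
have defT i j : cnorm (defect T (b i) (b j)) <= 5 * W ^+ 2 * e.
  rewrite cnorm_fixval.
  change (cnorm (fixval (T (b i * b j)) - fixval (T (b i)) * fixval (T (b j))) <= 5 * W ^+ 2 * e).
  have h1 := TP (b i * b j); have h2 := TP (b i); have h3 := TP (b j).
  have h4 := PsiM _ _ (Lb i) (Lb j).
  have h5 := PsiW i; have h6 := TW j; rewrite cnorm_fixval in h6.
  have h7 : g (b i * b j) <= W ^+ 2.
    by apply: le_trans (gM _ _) _; rewrite expr2; apply: ler_pM.
  rewrite sM in h1.
  set t := fixval (T (b i * b j)) in h1 *; set u := fixval (T (b i)) in h2 *.
  set v := fixval (T (b j)) in h3 h6 *.
  set u' := Psi (sigma (b i)) in h2 h4 h5; set v' := Psi (sigma (b j)) in h3 h4.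
  set t' := Psi (sigma (b i) * sigma (b j)) in h1 h4.
  (* The four differences cost 1, 1, 2 and 1 times W^2 e. *)
  have -> : t - u * v = (t - t') - (u' * v' - t') - (u - u') * v - u' * (v - v').
    by ncring.
  have := cnormD (t - t' - (u' * v' - t') - (u - u') * v) (- (u' * (v - v'))).
  have := cnormD (t - t' - (u' * v' - t')) (- ((u - u') * v)).
  have := cnormD (t - t') (- (u' * v' - t')); rewrite !cnormN.
  have h2' : cnorm (u - u') <= e * W by apply: le_trans h2 _; rewrite ler_wpM2l// ltW.
  have h3' : cnorm (v - v') <= e * W by apply: le_trans h3 _; rewrite ler_wpM2l// ltW.
  have h1' : cnorm (t - t') <= e * W ^+ 2 by apply: le_trans h1 _; rewrite ler_wpM2l// ltW.
  have := cnormM_le h2' h6; have := cnormM_le h5 h3'.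
  have : e <= e * W ^+ 2 by rewrite ler_peMr// ltW.
  move: h4 h1'; rewrite expr2; lra.
have Te : almost_hom g T (5 * W ^+ 2 * e).
  split=> // x y; apply: (gauge_bilinear bP (beta := defect T)) => //.
  - move=> v c u w; rewrite /defect mulrDl -scalerAl !lT mulrDl -scalerAl scalerBr.
    by ncring.
  - move=> v c u w; rewrite /defect mulrDr -scalerAr !lT mulrDr -scalerAr scalerBr.
    by ncring.
  - by rewrite !mulr_ge0//; lra.
have W20 : 0 <= 2 * W by lra.
have d0 : 0 < 5 * W ^+ 2 * e by rewrite !mulr_gt0//; lra.
have small : 2 * K * (5 * W ^+ 2 * e) <= 1.
  by move: Ce; rewrite /C; lra.
have [S [lS sS' mS SC]] := newton g0 gS (dual_unit bP)
  (fun beta x => dual_balanced bP (beta := beta) x) W20 d0 TM Te small.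
pose S' : {linear B -> fixalg alpha} :=
  HB.pack S (GRing.isLinear.Build R[i] B (fixalg alpha) *:%R S lS).
exists S'; split => // x.
change (cnorm (fixval (S x) - Psi (sigma x)) <= C * e * g x).
have := cnorm_tri (fixval (T x)) (fixval (S x)) (Psi (sigma x)).
have := TP x; have := SC x; rewrite cnorm_fixval.
change (cnorm (fixval (S x) - fixval (T x)) <= 2 * K * (5 * W ^+ 2 * e) * g x ->
 cnorm (fixval (T x) - Psi (sigma x)) <= e * g x ->
 cnorm (fixval (S x) - Psi (sigma x)) <= cnorm (fixval (S x) - fixval (T x)) + cnorm (fixval (T x) - Psi (sigma x)) ->
 cnorm (fixval (S x) - Psi (sigma x)) <= C * e * g x).
rewrite /C; lra.
Qed.

End PopaFixedPoint.

(** * The Popa property of the fixed point algebra *)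

Lemma dist_to_lt (R : realType) (A : cstarAlgType R) (x : A) (S : set A) (e : R) :
  S !=set0 -> dist_to x S < e <-> exists2 y, S y & cnorm (x - y) < e.
Proof.
move=> [y0 Sy0]; pose D := [set cnorm (x - y) | y in S].
have infD : has_inf D.
  split; first by exists (cnorm (x - y0)), y0.
  by exists 0 => _ [y _ <-]; exact: cnorm_ge0.
split=> [xe|[y Sy xy]].
  have De : 0 < e - inf D by rewrite subr_gt0.
  have [_ [y Sy <-] ye] := inf_adherent De infD.
  by exists y => //; move: ye; rewrite [ltRHS]addrC subrK.
apply: le_lt_trans xy; apply: ge_inf; first exact: infD.2.
by exists y.
Qed.

Lemma projection_cnorm (R : realType) (A : cstarAlgType R) (p : A) :
  is_projection p -> p != 0 -> 1 <= cnorm p.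
Proof.
move=> [pp ps] p0; have := cnormE p; rewrite ps pp expr2 => e.
have : cnorm p != 0 by apply: contra_neq p0; exact: cnorm_eq0.
have := cnorm_ge0 p; rewrite le0r => /orP[->//|c0] _.
by rewrite -(ler_pM2l c0) -e mulr1.
Qed.

Section Popa.
Context {R : realType} {G : topGroupType} {A : cstarAlgType R}.
Variable alpha : cstar_action G A.
Hypothesis cG : compact [set: G].

Lemma popa_fixalg : is_simple A -> separable A -> popa A ->
  tracial_rokhlin_with_comparison alpha -> popa (fixalg alpha).
Proof.
move=> simA sepA [_ _ popA] trp; split.
- exact: fixalg_simple.
- exact: fixalg_separable.
move=> F e e0; have e8 : 0 < e / 8 by rewrite divr_gt0.
have [q [B [sigma [qP q0 fdB [sc s1 sM sS] popq]]]] :=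
  popA [seq fixval a | a <- F] (e / 8) e8.
have /choice[xa xaP] : forall a : fixalg alpha, exists x : B, a \in F ->
    cnorm (q * fixval a * q - sigma x) < e / 8.
  move=> a; have [aF|aF] := boolP (a \in F); last by exists 0.
  have [_ /dist_to_lt[|_ [x _ <-] hx]] := popq _ (map_f (fun a => fixval a) aF).
    by exists (sigma 0), 0.
  by exists x.
have [L0 [C [g [C0 g0 near]]]] := fixed_hom_near alpha fdB sM sS.
have [|s sE] := simple_full (e := 1 / 6) simA q0; first by rewrite divr_gt0.
pose K : R := 1 + \sum_(ab <- s) (cnorm ab.1 + cnorm ab.2).
have s0 : 0 <= \sum_(ab <- s) (cnorm ab.1 + cnorm ab.2).
  by apply: sumr_ge0 => ab _; rewrite addr_ge0 ?cnorm_ge0.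
have K1 : 1 <= K by rewrite /K; lra.
have sK ab : ab \in s -> cnorm ab.1 <= K /\ cnorm ab.2 <= K.
  move=> abs; rewrite /K (big_rem ab abs) /=.
  have : 0 <= \sum_(ab <- rem ab s) (cnorm ab.1 + cnorm ab.2).
    by apply: sumr_ge0 => i _; rewrite addr_ge0 ?cnorm_ge0.
  by have := cnorm_ge0 ab.1; have := cnorm_ge0 ab.2; split; lra.
pose N : R := (size s)%:R; have N0 : 0 <= N by exact: ler0n.
pose D := C * g 1; have D0 : 0 <= D by rewrite mulr_ge0// ltW.
pose M : R := 1 + \sum_(a <- F) (cnorm (fixval a) + g (xa a)).
have sF0 : 0 <= \sum_(a <- F) (cnorm (fixval a) + g (xa a)).
  by apply: sumr_ge0 => a _; rewrite addr_ge0 ?cnorm_ge0.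
have M1 : 1 <= M by rewrite /M; lra.
have MF a : a \in F -> cnorm (fixval a) <= M /\ g (xa a) <= M.
  move=> aF; rewrite /M (big_rem a aF) /=.
  have : 0 <= \sum_(a <- rem a F) (cnorm (fixval a) + g (xa a)).
    by apply: sumr_ge0 => i _; rewrite addr_ge0 ?cnorm_ge0.
  by have := cnorm_ge0 (fixval a); have := g0 (xa a); split; lra.
(* [Y] collects the errors in the proof that the projection is nonzero, [Z] those of the two Popa
   estimates. With t = 1 / W one gets C t <= 1, t Y <= 1 / 3 and t Z <= e / 4. *)
pose Y := 1 + N * (1 + 3 * K + 9 * K ^+ 2 * D).
pose Z := 4 + 4 * M * D + C * M.
have KD0 : 0 <= 1 + 3 * K + 9 * K ^+ 2 * D.
  by have := mulr_ge0 (sqr_ge0 K) D0; lra.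
have Y0 : 0 <= Y by rewrite /Y; have := mulr_ge0 N0 KD0; lra.
have M0 : 0 <= M by lra.
have Z0 : 0 <= Z.
  by rewrite /Z; have := mulr_ge0 M0 D0; have := mulr_ge0 (ltW C0) M0; lra.
pose W := C + 3 * Y + 4 * Z / e.
have W0 : 0 < W.
  rewrite /W; have : 0 <= 4 * Z / e by rewrite divr_ge0 ?mulr_ge0// ltW.
  lra.
pose t := W^-1; have t0 : 0 < t by rewrite invr_gt0.
have tW : t * W = 1 by rewrite /t mulVf// gt_eqF.
have Ze : t * (4 * Z / e) <= 1.
  have := mulr_ge0 (ltW t0) Y0; have := mulr_gt0 t0 C0; move: tW; rewrite /W; lra.
have Zt : t * Z <= e / 4.
  rewrite ler_pdivlMr//; move: Ze; rewrite mulrA ler_pdivrMr//; lra.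
have Yt : t * Y <= 1 / 3.
  have : 0 <= t * (4 * Z / e) by rewrite mulr_ge0 ?divr_ge0 ?mulr_ge0// ltW.
  have := mulr_gt0 t0 C0; move: tW; rewrite /W; lra.
have Ct : C * t <= 1.
  have : 0 <= t * (4 * Z / e) by rewrite mulr_ge0 ?divr_ge0 ?mulr_ge0// ltW.
  have := mulr_ge0 (ltW t0) Y0; move: tW; rewrite /W; lra.
pose L := L0 ++ [seq ab.1 | ab <- s] ++ [seq ab.2 | ab <- s] ++
  [seq ab.1 * q | ab <- s] ++ [seq q * fixval a | a <- F] ++ [:: q].
(* The module estimate for Psi is one-sided; adjoints of elements of [F] give the other side. *)
pose F' := F ++ [seq star a | a <- F].
have [p [Psi [[pP p0 _] [PsiS Psi3 Psi1] PsiM PsiL PsiF]]] :=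
  rokhlin_approximation cG L F' trp t0.
have L0L a : a \in L0 -> a \in L by rewrite mem_cat => ->.
have s1L ab : ab \in s -> ab.1 \in L.
  by move=> abs; rewrite !mem_cat (map_f (fun ab => ab.1))// !orbT.
have s2L ab : ab \in s -> ab.2 \in L.
  by move=> abs; rewrite !mem_cat (map_f (fun ab => ab.2))// !orbT.
have sqL ab : ab \in s -> ab.1 * q \in L.
  by move=> abs; rewrite !mem_cat (map_f (fun ab => ab.1 * q))// !orbT.
have qaL a : a \in F -> q * fixval a \in L.
  by move=> aF; rewrite !mem_cat (map_f (fun a => q * fixval a))// !orbT.
have qL : q \in L by rewrite !mem_cat mem_head !orbT.
have [S [SS SM Snear]] := near Psi t t0 Ct PsiS Psi3
  (fun a b aL bL => PsiM a b (L0L a aL) (L0L b bL)) (fun a aL => PsiL a (L0L a aL)).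
pose P := fixval (S 1).
have Pq : cnorm (P - Psi q) <= D * t.
  by rewrite /P -s1 /D mulrAC; exact: Snear.
have S1P : is_projection (S 1) by split; rewrite -?SM ?mulr1// -SS star1.
have P1 : cnorm P <= 1 := projection_le1 S1P.
exists (S 1), B, S; split => //.
(* If S 1 = 0 then Psi q is small, and so is each Psi (a q b). As 1 is within 1 / 6 of a sum of such
   a q b, this gives |p| <= 1 / 2 + t Y <= 5 / 6, whereas a nonzero projection has norm at least
   1. *)
- apply/eqP => S10.
  have Pq0 : cnorm (Psi q) <= D * t.
    by move: Pq; rewrite /P S10 /= sub0r cnormN.
  have term ab : ab \in s -> cnorm (Psi (ab.1 * q * ab.2)) <=
      t * (1 + 3 * K + 9 * K ^+ 2 * D).
    move=> abs; have [aK bK] := sK ab abs.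
    have h1 := PsiM _ _ (sqL ab abs) (s2L ab abs).
    have h2 := PsiM _ _ (s1L ab abs) qL.
    have a3 : cnorm (Psi ab.1) <= 3 * K by have := Psi3 ab.1; lra.
    have b3 : cnorm (Psi ab.2) <= 3 * K by have := Psi3 ab.2; lra.
    have h3 := cnormM_le a3 Pq0.
    set u := Psi (ab.1 * q) in h1 h2.
    have h4 : cnorm u <= 3 * K * (D * t) + t.
      have := cnormD (Psi ab.1 * Psi q) (- (Psi ab.1 * Psi q - u)).
      by rewrite cnormN opprB addrC subrK; lra.
    have := cnormM_le h4 b3.
    have := cnormD (u * Psi ab.2) (- (u * Psi ab.2 - Psi (ab.1 * q * ab.2))).
    by rewrite cnormN opprB addrC subrK; lra.
  have h1 : cnorm (Psi 1 - Psi (\sum_(ab <- s) ab.1 * q * ab.2)) <= 3 * (1 / 6).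
    by rewrite -linearB; apply: le_trans (Psi3 _) _; lra.
  have h2 : cnorm (Psi (\sum_(ab <- s) ab.1 * q * ab.2)) <=
      N * (t * (1 + 3 * K + 9 * K ^+ 2 * D)).
    rewrite linear_sum; apply: le_trans (cnorm_sum _ _ _) _.
    rewrite big_seq_cond.
    apply: le_trans (ler_sum _ (_ : forall ab, _ -> _ <= t * (1 + 3 * K + 9 * K ^+ 2 * D))) _.
      by move=> ab; rewrite andbT; exact: term.
    rewrite -big_seq_cond big_const_seq (_ : count _ s = size s); last exact: count_predT.
    by rewrite iter_addr addr0 -[leLHS]mulr_natl.
  have := projection_cnorm pP p0; rewrite cnorm_fixval.
  have := cnormD (fixval p - Psi 1) (Psi 1); rewrite subrK cnormB.
  have := cnormD (Psi 1 - Psi (\sum_(ab <- s) ab.1 * q * ab.2))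
    (Psi (\sum_(ab <- s) ab.1 * q * ab.2)); rewrite subrK.
  by move: Psi1 Yt; rewrite /Y; lra.
- split=> //.
  by move=> x; exists (S x) => //; rewrite -!SM mulr1 mul1r.
- move=> a aF; have [aM gM] := MF a aF.
  have aF' : a \in F' by rewrite mem_cat aF.
  have saF' : star a \in F' by rewrite mem_cat map_f// orbT.
  have [qa _] := popq _ (map_f (fun a => fixval a) aF).
  have q1 := projection_le1 qP; have Psiq3 : cnorm (Psi q) <= 3.
    by have := Psi3 q; lra.
  have r1 := PsiF q a qL aF'.
  have l1 : cnorm (fixval a * Psi q - Psi (fixval a * q)) <= t.
    have := PsiF q (star a) qL saF'; rewrite -cnorm_star starB starM -!PsiS starM.
    by rewrite -[fixval (star a)]/(star (fixval a)) !starK qP.2.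
  set f := fixval a in qa aM r1 l1 *.
  have d1 := cnormM_le Pq aM; have d2 := cnormM_le aM Pq.
  have Zt' : 4 * (M * (D * t)) + C * M * t + 4 * t <= e / 4 by move: Zt; rewrite /Z; lra.
  have CMt : 0 <= C * M * t by rewrite !mulr_ge0// ltW.
  have DMt : 0 <= M * (D * t) by rewrite !mulr_ge0// ltW.
  split.
  + change (cnorm (P * f - f * P) < e).
    have := Psi3 (q * f - f * q); rewrite linearB.
    set u := Psi (q * f) in r1 *; set v := Psi (f * q) in l1 *.
    have -> : P * f - f * P = (P - Psi q) * f - f * (P - Psi q) +
      ((Psi q * f - u) - (f * Psi q - v)) + (u - v) by ncring.
    have := cnormD ((P - Psi q) * f - f * (P - Psi q) +
      ((Psi q * f - u) - (f * Psi q - v))) (u - v).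
    have := cnormD ((P - Psi q) * f - f * (P - Psi q)) ((Psi q * f - u) - (f * Psi q - v)).
    have := cnormD ((P - Psi q) * f) (- (f * (P - Psi q))).
    have := cnormD (Psi q * f - u) (- (f * Psi q - v)); rewrite !cnormN.
    lra.
  + apply/dist_to_lt; first by exists (S 0), 0.
    exists (S (xa a)); first by exists (xa a).
    change (cnorm (P * f * P - fixval (S (xa a))) < e).
    have h1 := xaP a aF; rewrite -/f in h1.
    have h2 := PsiM _ _ (qaL a aF) qL; rewrite -/f in h2.
    have h3 := Snear (xa a).
    (* The Popa tolerance e / 8 becomes 3 e / 8 under Psi; the remaining differences amount to t Z
       <= e / 4. *)
    have h4 : cnorm (Psi (q * f * q) - Psi (sigma (xa a))) <= 3 * (e / 8).
      by rewrite -linearB; apply: le_trans (Psi3 _) _; lra.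
    set u := Psi (q * f) in r1 h2; set v := Psi (q * f * q) in h2 h4.
    set w := Psi (sigma (xa a)) in h3 h4; set z := fixval (S (xa a)) in h3 *.
    have -> : P * f * P - z = (P - Psi q) * f * P + Psi q * (f * (P - Psi q))
      + (Psi q * f - u) * Psi q + (u * Psi q - v) + (v - w) - (z - w) by ncring.
    have c1 := cnormM_le d1 P1; have c2 := cnormM_le Psiq3 d2.
    have c3 := cnormM_le r1 Psiq3.
    have c4 : C * t * g (xa a) <= C * M * t.
      by rewrite mulrAC ler_wpM2r ?ler_wpM2l// ltW.
    set x1 := (P - _) * f * P; set x2 := Psi q * (f * _).
    set x3 := (_ - u) * _; set x4 := u * _ - v.
    have := cnormD (x1 + x2 + x3 + x4 + (v - w)) (- (z - w)).
    have := cnormD (x1 + x2 + x3 + x4) (v - w).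
    have := cnormD (x1 + x2 + x3) x4; have := cnormD (x1 + x2) x3.
    have := cnormD x1 x2; rewrite cnormN; lra.
Qed.

End Popa.

Theorem theorem4p11 (R : realType) (A : cstarAlgType R) (G : topGroupType)
    (alpha : cstar_action G A) :
  infinite_dimensional A -> is_simple A -> separable A -> popa A ->
  compact [set: G] -> hausdorff_space G -> @second_countable G ->
  tracial_rokhlin_with_comparison alpha ->
  popa (fixalg alpha).
Proof. by move=> _ simA sepA popA cG _ _; exact: popa_fixalg. Qed.
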